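(* Let $u$ be the global Oleinik's solution of the steady Prandtl system with outer flow $U\equiv1$ described in the context. Assume that $$|u_0(y)-1|\le C_4e^{-C_5y^2}\quad\text{and}\quad -C_6e^{-C_7y^2}\le \partial_y^2u_0(y)\le 0\qquad\text{for all } y\ge 0,$$ for some positive constants $C_4,C_5,C_6,C_7$ with $C_5>C_1$ and $C_7>C_1$, where $C_1$ is the constant in the Gaussian asymptotics of the Blasius profile. Then there exist positive constants $C,c,N$ such that for all $(x,y)\in(N,\infty)\times\mathbb{R}_+$: $$-\frac{C}{x+1}e^{-c\frac{y^2}{x+1}}\le\partial_y^2u(x,y)\le0,\qquad |\partial_y(u-\bar u)(x,y)|\le\frac{C}{(x+1)^{3/4}}\ln(x+e)e^{-c\frac{y^2}{x+1}},$$ $$|\partial_xu(x,y)|\le\frac{C}{x+1}e^{-c\frac{y^2}{x+1}},\qquad |\partial_x\partial_yu(x,y)|\le\frac{C}{(x+1)^{3/4}}e^{-c\frac{y^2}{x+1}}.$$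
   Context: Steady Prandtl system on $\mathbb{R}_+\times\mathbb{R}_+$ with zero pressure gradient (outer flow $U\equiv1$): $u\partial_xu+v\partial_yu-\partial_y^2u=0$, $\partial_xu+\partial_yv=0$, $u(0,y)=u_0(y)$, $u(x,0)=v(x,0)=0$, $\lim_{y\to\infty}u(x,y)=1$. The datum satisfies Oleinik's conditions: $u_0\in C_b^{2,\alpha}([0,\infty))$ for some $\alpha>0$, $u_0(0)=0$, $u_0'(0)>0$, $u_0(y)>0$ for $y>0$, $u_0''(y)=O(y^2)$ as $y\to0$, and $u_0(y)\to1$ as $y\to\infty$. An Oleinik's solution is the (unique) global-in-$x$ solution $u\in C^1(\mathbb{R}_+\times\mathbb{R}_+)$ such that for every $X>0$: $u$ is bounded and continuous on $[0,X]\times\mathbb{R}_+$; $u>0$ for $y>0$; $u_y,u_{yy}$ are bounded and continuous on $[0,X]\times\mathbb{R}_+$; $v,v_y,u_x$ are locally bounded and continuous there. The Blasius profile $f$ solves $\frac12ff''+f'''=0$, $f(0)=f'(0)=0$, $f'(\infty)=1$; it satisfies $0\le f'\le1$, $f''\ge0$, $f''(0)>0$, $f'''<0$ on $(0,\infty)$, and there are positive constants $C_1,C_2$ with $1-f'(\zeta)\sim\zeta^{-1}e^{-C_1\zeta^2-C_2\zeta}$, $f''(\zeta)\sim e^{-C_1\zeta^2-C_2\zeta}$ as $\zeta\to\infty$. The Blasius solution is $\bar u(x,y)=f'(y/\sqrt{x+1})$. *)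

(* Defs.v *)
From Stdlib Require Import Reals Lra.
From Coquelicot Require Import Coquelicot.
Open Scope R_scope.

Definition in_strip (X x y : R) : Prop := 0 <= x <= X /\ 0 <= y.

Definition cont_on_strip (X : R) (F : R -> R -> R) : Prop :=
  forall x y, in_strip X x y ->
  forall eps, 0 < eps -> exists delta, 0 < delta /\
    forall x' y', in_strip X x' y' -> Rabs (x' - x) < delta -> Rabs (y' - y) < delta ->
      Rabs (F x' y' - F x y) < eps.

Definition bdd_on_strip (X : R) (F : R -> R -> R) : Prop :=
  exists M, forall x y, in_strip X x y -> Rabs (F x y) <= M.

Definition loc_bdd_on_strip (X : R) (F : R -> R -> R) : Prop :=
  forall Y, exists M, forall x y, in_strip X x y -> y <= Y -> Rabs (F x y) <= M.

(* Oleinik's conditions on the datum u0, with du0 = u0', d2u0 = u0''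
   (derivatives on (0,oo), extended continuously to y = 0),
   u0 in C_b^{2,alpha}([0,oo)). *)
Definition oleinik_datum (u0 du0 d2u0 : R -> R) (alpha : R) : Prop :=
  0 < alpha /\
  (forall y, 0 < y -> is_derive u0 y (du0 y)) /\
  (forall y, 0 < y -> is_derive du0 y (d2u0 y)) /\
  (forall g, (g = u0 \/ g = du0 \/ g = d2u0) ->
     forall y, 0 <= y -> forall eps, 0 < eps -> exists delta, 0 < delta /\
       forall y', 0 <= y' -> Rabs (y' - y) < delta -> Rabs (g y' - g y) < eps) /\
  (exists M, forall y, 0 <= y ->
     Rabs (u0 y) <= M /\ Rabs (du0 y) <= M /\ Rabs (d2u0 y) <= M) /\
  (exists K, forall a b, 0 <= a -> 0 <= b ->
     Rabs (d2u0 a - d2u0 b) <= K * Rpower (Rabs (a - b)) alpha) /\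
  u0 0 = 0 /\ 0 < du0 0 /\
  (forall y, 0 < y -> 0 < u0 y) /\
  (exists K delta, 0 < delta /\ forall y, 0 <= y < delta -> Rabs (d2u0 y) <= K * y ^ 2) /\
  is_lim u0 p_infty 1.

(* g ~ h as z -> oo, read as two-sided comparability up to positive constants. *)
Definition asymp_comparable (g h : R -> R) : Prop :=
  exists c1 c2 Z, 0 < c1 /\ 0 < c2 /\
    forall z, Z <= z -> c1 * h z <= g z <= c2 * h z.

Definition blasius (f f1 f2 f3 : R -> R) (C1 C2 : R) : Prop :=
  (forall z, 0 <= z -> is_derive f z (f1 z)) /\
  (forall z, 0 <= z -> is_derive f1 z (f2 z)) /\
  (forall z, 0 <= z -> is_derive f2 z (f3 z)) /\
  (forall z, 0 <= z -> / 2 * f z * f2 z + f3 z = 0) /\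
  f 0 = 0 /\ f1 0 = 0 /\ is_lim f1 p_infty 1 /\
  0 < C1 /\
  asymp_comparable (fun z => 1 - f1 z) (fun z => / z * exp (- C1 * z ^ 2 - C2 * z)) /\
  asymp_comparable f2 (fun z => exp (- C1 * z ^ 2 - C2 * z)).

Definition ubar (f1 : R -> R) (x y : R) : R := f1 (y / sqrt (x + 1)).

(* (u, v) is Oleinik's solution of the steady Prandtl system with U = 1 and
   datum u0; ux, uy, uyy, vy are the partial derivatives u_x, u_y, u_yy, v_y
   (classical derivatives in the open quadrant, extended continuously to the
   closed quadrant as required by the regularity class). *)
Definition oleinik_solution (u0 : R -> R) (u v ux uy uyy vy : R -> R -> R) : Prop :=
  (forall x y, 0 < x -> 0 < y -> is_derive (fun s => u s y) x (ux x y)) /\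
  (forall x y, 0 < x -> 0 < y -> is_derive (fun t => u x t) y (uy x y)) /\
  (forall x y, 0 < x -> 0 < y -> is_derive (fun t => uy x t) y (uyy x y)) /\
  (forall x y, 0 < x -> 0 < y -> is_derive (fun t => v x t) y (vy x y)) /\
  (forall x y, 0 < x -> 0 < y -> u x y * ux x y + v x y * uy x y - uyy x y = 0) /\
  (forall x y, 0 < x -> 0 < y -> ux x y + vy x y = 0) /\
  (forall y, 0 <= y -> u 0 y = u0 y) /\
  (forall x, 0 <= x -> u x 0 = 0 /\ v x 0 = 0) /\
  (forall x, 0 <= x -> is_lim (fun y => u x y) p_infty 1) /\
  (forall x y, 0 <= x -> 0 < y -> 0 < u x y) /\
  (forall X, 0 < X ->
     bdd_on_strip X u /\ cont_on_strip X u /\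
     bdd_on_strip X uy /\ cont_on_strip X uy /\
     bdd_on_strip X uyy /\ cont_on_strip X uyy /\
     loc_bdd_on_strip X v /\ cont_on_strip X v /\
     loc_bdd_on_strip X vy /\ cont_on_strip X vy /\
     loc_bdd_on_strip X ux /\ cont_on_strip X ux).

(* Main.v *)
(* Everything rests on maximum principles.  In von Mises coordinates (x, psi) the quantity
   phi = u^2 solves phi_x = sqrt(phi) phi_psipsi, an equation with a comparison principle
   which is invariant under shifts of x and under the scaling (l^2 x, l psi).  Comparison with
   shifted Blasius profiles traps u between f'(y / sqrt(x + b)) and f'(y / sqrt x), so
   u - ubar = O(1/x) with Gaussian tails.  Comparison of phi with phi(x + h, psi) gives
   u_yy <= 0 (the datum is a supersolution), and comparison with phi(l^2 x, l psi), l > 1, gives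
   2 x phi_x + psi phi_psi >= 0, that is -u_yy <= psi u_y / (2x); together they yield
   -y u_y / (2x) <= u_x <= 0.  As u is concave in y, u_y inherits the Gaussian decay of 1 - u, and
   u_y - ubar_y follows by interpolation.  Finally u_xy is controlled by Kruzhkov's doubling of
   variables, applied to difference quotients in x of phi (bound) and then to difference quotients
   in psi of these (existence of the derivative). *)
Require Import Defs.
From Stdlib Require Import Reals Ranalysis5 Lra List ClassicalChoice.
From Coquelicot Require Import Coquelicot.
Open Scope R_scope.

(** * Continuity and extreme values *)

(** The regularity class shapes the proof: u_yy is merely continuous, u_y is not assumed
    differentiable in x, and u_x and v are bounded only locally in y. Comparison is therefore
    carried out at points of maximum with pointwise derivatives, and the existence of u_xy for y > 0
    is itself part of the claim. In von Mises variables the linearised equation has the zero order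
    coefficient phi_psipsi / (2 sqrt phi), singular at the wall. The momentum equation gives u_yy =
    O(u) there, so phi_psipsi is bounded above, and such a one-sided bound is all that the
    comparison asks for. A Blasius solution with origin x = 0 starts from the discontinuous datum 1,
    so it serves as an upper barrier only as a limit of slightly shifted and raised ones. An
    ordering of phi passes to the inverse map [Y], because Y_psi = 1 / sqrt phi; this gives v >= 0
    and 2 x v + psi <= y u, which are needed to turn bounds along streamlines into bounds on u_x at
    fixed y. The rate obtained everywhere is a power of 1/x at least as good as that of the
    statement: 1/x is below (x+1)^(-3/4) up to a factor, and the logarithm is at least 1. *)

Lemma cont_plus {U : UniformSpace} (f g : U -> R) (z : U) :
  continuous f z -> continuous g z -> continuous (fun t => f t + g t) z.
Proof. exact (@continuous_plus U R_AbsRing R_NormedModule f g z). Qed.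

Lemma cont_minus {U : UniformSpace} (f g : U -> R) (z : U) :
  continuous f z -> continuous g z -> continuous (fun t => f t - g t) z.
Proof. exact (@continuous_minus U R_AbsRing R_NormedModule f g z). Qed.

Lemma cont_opp {U : UniformSpace} (f : U -> R) (z : U) :
  continuous f z -> continuous (fun t => - f t) z.
Proof. exact (@continuous_opp U R_AbsRing R_NormedModule f z). Qed.

Lemma cont_mult {U : UniformSpace} (f g : U -> R) (z : U) :
  continuous f z -> continuous g z -> continuous (fun t => f t * g t) z.
Proof. exact (@continuous_mult U R_AbsRing f g z). Qed.

Lemma cont_const {U : UniformSpace} (c : R) (z : U) : continuous (fun _ : U => c) z.
Proof. apply continuous_const. Qed.

Lemma cont_comp {U : UniformSpace} (f : U -> R) (h : R -> R) (z : U) :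
  continuous f z -> continuous h (f z) -> continuous (fun t => h (f t)) z.
Proof. intros; now apply (continuous_comp f h). Qed.

Lemma cont_of_derive (f : R -> R) (x l : R) : is_derive f x l -> continuous f x.
Proof. intros H. exact (ex_derive_continuous (V := R_NormedModule) f x (ex_intro _ l H)). Qed.

Lemma cont_pow {U : UniformSpace} (f : U -> R) (n : nat) (z : U) :
  continuous f z -> continuous (fun t => f t ^ n) z.
Proof.
  intros Hf; induction n; simpl.
  - apply cont_const.
  - now apply cont_mult.
Qed.

Lemma cont_div {U : UniformSpace} (f g : U -> R) (z : U) :
  g z <> 0 -> continuous f z -> continuous g z -> continuous (fun t => f t / g t) z.
Proof.
  intros Hz Hf Hg. apply cont_mult; auto.
  apply (cont_comp g Rinv); auto. now apply continuous_Rinv.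
Qed.

Lemma cont_sqrt {U : UniformSpace} (f : U -> R) (z : U) :
  continuous f z -> continuous (fun t => sqrt (f t)) z.
Proof. intros; apply (cont_comp f sqrt); auto. apply continuous_sqrt. Qed.

Lemma cont_exp {U : UniformSpace} (f : U -> R) (z : U) :
  continuous f z -> continuous (fun t => exp (f t)) z.
Proof. intros; apply (cont_comp f exp); auto. apply continuous_exp. Qed.

Lemma cont_abs {U : UniformSpace} (f : U -> R) (z : U) :
  continuous f z -> continuous (fun t => Rabs (f t)) z.
Proof. intros; apply (cont_comp f Rabs); auto. apply continuous_Rabs. Qed.

Lemma cont_max {U : UniformSpace} (f g : U -> R) (z : U) :
  continuous f z -> continuous g z -> continuous (fun t => Rmax (f t) (g t)) z.
Proof.
  intros Hf Hg.
  apply (continuous_ext (fun t => (f t + g t + Rabs (f t - g t)) * / 2)).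
  - intros t. unfold Rmax, Rabs. destruct Rle_dec; destruct Rcase_abs; lra.
  - apply cont_mult; [ | apply cont_const].
    apply cont_plus; [ | apply cont_abs, cont_minus]; auto. now apply cont_plus.
Qed.

Lemma cont_min {U : UniformSpace} (f g : U -> R) (z : U) :
  continuous f z -> continuous g z -> continuous (fun t => Rmin (f t) (g t)) z.
Proof.
  intros Hf Hg.
  apply (continuous_ext (fun t => - Rmax (- f t) (- g t))).
  - intros t. unfold Rmax, Rmin. destruct Rle_dec; destruct Rle_dec; lra.
  - now apply cont_opp, cont_max; apply cont_opp.
Qed.

Definition cont2 (F : R -> R -> R) (x y : R) : Prop :=
  continuous (fun z : R * R => F (fst z) (snd z)) (x, y).

Lemma cont2_comp {U : UniformSpace} (F : R -> R -> R) (f g : U -> R) (z : U) :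
  continuous f z -> continuous g z -> cont2 F (f z) (g z) ->
  continuous (fun t => F (f t) (g t)) z.
Proof. intros; now apply continuous_comp_2. Qed.

Lemma cont_eps (f : R -> R) (x : R) :
  continuous f x <-> forall eps, 0 < eps -> exists d, 0 < d /\
    forall x', Rabs (x' - x) < d -> Rabs (f x' - f x) < eps.
Proof.
  split.
  - intros H eps He.
    destruct (proj1 (filterlim_locally _ _) H (mkposreal eps He)) as [d Hd].
    exists d; split; [apply cond_pos | ]. intros x' Hx. now apply (Hd x').
  - intros H. apply filterlim_locally. intros [eps He].
    destruct (H eps He) as [d [Hd H']]. exists (mkposreal d Hd). intros x' Hx. now apply H'.
Qed.

Lemma cont2_eps (F : R -> R -> R) (x y : R) :
  cont2 F x y <-> forall eps, 0 < eps -> exists d, 0 < d /\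
    forall x' y', Rabs (x' - x) < d -> Rabs (y' - y) < d -> Rabs (F x' y' - F x y) < eps.
Proof.
  split.
  - intros H eps He.
    destruct (proj1 (filterlim_locally _ _) H (mkposreal eps He)) as [d Hd].
    exists d; split; [apply cond_pos | ]. intros x' y' Hx Hy.
    apply (Hd (x', y')). now split.
  - intros H. apply filterlim_locally. intros [eps He].
    destruct (H eps He) as [d [Hd H']]. exists (mkposreal d Hd).
    intros [x' y'] [Hx Hy]. now apply H'.
Qed.

Lemma cont_fst_comp {U : UniformSpace} (f : U -> R * R) (z : U) :
  continuous f z -> continuous (fun t => fst (f t)) z.
Proof. intros H. apply (continuous_comp f fst z H). destruct (f z). apply continuous_fst. Qed.

Ltac cont_tac :=
  first
    [ assumption
    | lazymatch goal with
      | |- continuous (fun _ => ?c) _ => apply cont_const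
      | |- continuous (fun t => t) _ => apply continuous_id
      | |- continuous (fun t => fst t) _ => apply continuous_fst
      | |- continuous (fun t => snd t) _ => apply continuous_snd
      | |- continuous (fun t => @?a t + @?b t) _ => apply (cont_plus a b); cont_tac
      | |- continuous (fun t => @?a t - @?b t) _ => apply (cont_minus a b); cont_tac
      | |- continuous (fun t => @?a t * @?b t) _ => apply (cont_mult a b); cont_tac
      | |- continuous (fun t => - @?a t) _ => apply (cont_opp a); cont_tac
      | |- continuous (fun t => @?a t ^ ?n) _ => apply (cont_pow a n); cont_tac
      | |- continuous (fun t => exp (@?a t)) _ => apply (cont_exp a); cont_tac
      | |- continuous (fun t => sqrt (@?a t)) _ => apply (cont_sqrt a); cont_tac
      | |- continuous (fun t => Rmin (@?a t) (@?b t)) _ => apply (cont_min a b); cont_tac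
      end ].

Lemma list_max_attained {T : Type} (f : T -> R) (l : list T) (t0 : T) :
  In t0 l -> exists t, In t l /\ forall t', In t' l -> f t' <= f t.
Proof.
  revert t0. induction l as [ | a l IH]; intros t0; [easy | intros _].
  destruct l as [ | b l'].
  - exists a; split; [now left | ]. intros t' [<- | []]; lra.
  - destruct (IH b (or_introl eq_refl)) as [t [Ht Hm]].
    destruct (Rle_dec (f a) (f t)) as [Hat | Hat].
    + exists t; split; [now right | ]. intros t' [<- | Ht']; auto.
    + exists a; split; [now left | ]. intros t' [<- | Ht']; [lra | ].
      specialize (Hm t' Ht'); lra.
Qed.

(** Without a maximiser every point [t] of the box has a strictly better point [q], and by upper
    semicontinuity [f] stays below [f q] near [t]. Finitely many such neighbourhoods cover the box;
    the best of the corresponding points [q] lies in one of them, hence is beaten by another, a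
    contradiction. *)
Lemma extreme_value_n (n : nat) (a b : Compactness.Tn n R) (f : Compactness.Tn n R -> R)
  (t0 : Compactness.Tn n R) :
  bounded_n n a b t0 ->
  (forall t, bounded_n n a b t -> forall eps, 0 < eps ->
     exists d, 0 < d /\ forall t', close_n n d t' t -> f t' < f t + eps) ->
  exists t, bounded_n n a b t /\ forall t', bounded_n n a b t' -> f t' <= f t.
Proof.
  intros Ht0 Hc. apply Classical_Prop.NNPP. intros Hno.
  assert (Hq : forall t, exists qd : Compactness.Tn n R * posreal, bounded_n n a b t ->
     bounded_n n a b (fst qd) /\ forall t', close_n n (snd qd) t' t -> f t' < f (fst qd)).
  { intros t. destruct (Classical_Prop.classic (bounded_n n a b t)) as [Hb | Hb].
    - destruct (Classical_Prop.classic (exists q, bounded_n n a b q /\ f t < f q)) as [[q [Hq Hfq]] | Hq].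
      + destruct (Hc t Hb (f q - f t)) as [d [Hd Hd']]; [lra | ].
        exists (q, mkposreal d Hd). intros _; split; auto. simpl. intros t' Ht'.
        specialize (Hd' t' Ht'); lra.
      + exfalso. apply Hno. exists t; split; auto. intros t' Ht'.
        apply Rnot_lt_le. intros Hlt. apply Hq. now exists t'.
    - exists (t, mkposreal 1 Rlt_0_1). easy. }
  destruct (choice _ Hq) as [qd Hqd].
  (* The finite subcover is given under a double negation, which is harmless because the goal is
     [False]. *)
  apply (compactness_list n a b (fun t => snd (qd t))). intros [l Hl].
  destruct (Hl t0 Ht0) as [s0 [Hs0 [Hbs0 _]]].
  set (g := fun t => f (fst (qd t))).
  destruct (Classical_Prop.classic (exists t, In t l /\ bounded_n n a b t /\
     forall t', In t' l -> bounded_n n a b t' -> g t' <= g t)) as [[t [Ht [Hbt Hmax]]] | Hnm].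
  - destruct (Hqd t Hbt) as [Hbq _].
    destruct (Hl _ Hbq) as [t' [Ht' [Hbt' Hcl]]].
    destruct (Hqd t' Hbt') as [_ Hlt]. specialize (Hlt _ Hcl).
    specialize (Hmax t' Ht' Hbt'). unfold g in Hmax. lra.
  - assert (Hdec : exists l', forall t, In t l' <-> In t l /\ bounded_n n a b t).
    { clear. induction l as [ | s l [l' IH]].
      - exists nil. simpl; tauto.
      - destruct (Classical_Prop.classic (bounded_n n a b s)) as [Hs | Hs].
        + exists (s :: l'). intros t. simpl. rewrite IH. split; intros H; [ | tauto].
          destruct H as [<- | H]; tauto.
        + exists l'. intros t. simpl. rewrite IH. split; intros H; [tauto | ].
          destruct H as [[<- | H] H']; tauto. }
    destruct Hdec as [l' Hl'].
    destruct (list_max_attained g l' s0) as [t [Ht Hm]]; [now apply Hl' | ].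
    apply Hnm. exists t. apply Hl' in Ht. destruct Ht. repeat split; auto.
    intros t' H1 H2. apply Hm, Hl'. now split.
Qed.

Lemma extreme_value_3 (f : R * (R * R) -> R) (a1 b1 a2 b2 a3 b3 : R) :
  a1 <= b1 -> a2 <= b2 -> a3 <= b3 ->
  (forall x y z, a1 <= x <= b1 -> a2 <= y <= b2 -> a3 <= z <= b3 -> continuous f (x, (y, z))) ->
  exists x y z, a1 <= x <= b1 /\ a2 <= y <= b2 /\ a3 <= z <= b3 /\
    forall x' y' z', a1 <= x' <= b1 -> a2 <= y' <= b2 -> a3 <= z' <= b3 ->
      f (x', (y', z')) <= f (x, (y, z)).
Proof.
  intros H1 H2 H3 Hc.
  destruct (extreme_value_n 3 (a1, (a2, (a3, tt))) (b1, (b2, (b3, tt)))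
    (fun t => f (fst t, (fst (snd t), fst (snd (snd t))))) (a1, (a2, (a3, tt))))
    as [[x [y [z []]]] [Hb Hm]].
  - simpl; repeat split; lra.
  - intros [x [y [z []]]] Hb eps He. simpl in Hb. simpl.
    destruct Hb as [B1 [B2 [B3 _]]].
    destruct (proj1 (filterlim_locally _ _) (Hc x y z B1 B2 B3)
      (mkposreal eps He)) as [d Hd].
    exists d; split; [apply cond_pos | ]. intros [x' [y' [z' []]]] Hcl. simpl in Hcl. simpl.
    assert (HB : ball (f (x, (y, z))) eps (f (x', (y', z')))).
    { apply (Hd (x', (y', z'))). destruct Hcl as [A [B [C _]]].
      split; [exact A | split; [exact B | exact C]]. }
    change (Rabs (f (x', (y', z')) - f (x, (y, z))) < eps) in HB. apply Rabs_def2 in HB. lra.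
  - simpl in Hb. exists x, y, z. repeat split; try tauto.
    intros x' y' z' A B C. apply (Hm (x', (y', (z', tt)))). simpl. tauto.
Qed.

Lemma extreme_value_2 (F : R -> R -> R) (a1 b1 a2 b2 : R) :
  a1 <= b1 -> a2 <= b2 ->
  (forall x y, a1 <= x <= b1 -> a2 <= y <= b2 -> cont2 F x y) ->
  exists x y, a1 <= x <= b1 /\ a2 <= y <= b2 /\
    forall x' y', a1 <= x' <= b1 -> a2 <= y' <= b2 -> F x' y' <= F x y.
Proof.
  intros H1 H2 Hc.
  (* The third interval is the degenerate one [0, 0]. *)
  destruct (extreme_value_3 (fun t => F (fst t) (fst (snd t))) a1 b1 a2 b2 0 0)
    as [x [y [z [Hx [Hy [Hz Hm]]]]]]; auto; [lra | | ].
  - intros x y z Hx Hy Hz. apply cont2_comp; [apply continuous_fst | | now apply Hc].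
    apply cont_fst_comp. apply continuous_snd.
  - exists x, y. repeat split; try tauto. intros x' y' A B. apply (Hm x' y' 0); auto. lra.
Qed.

(** * Differential calculus *)

Lemma derive_eps (f : R -> R) (x l : R) :
  is_derive f x l <-> forall eps, 0 < eps -> exists d, 0 < d /\
    forall t, t <> x -> Rabs (t - x) < d -> Rabs ((f t - f x) / (t - x) - l) < eps.
Proof.
  rewrite is_derive_Reals. split.
  - intros H eps He. destruct (H eps He) as [d Hd]. exists d; split; [apply cond_pos | ].
    intros t Ht Htd. replace (f t) with (f (x + (t - x))) by (f_equal; ring).
    apply Hd; auto. lra.
  - intros H eps He. destruct (H eps He) as [d [Hd H']]. exists (mkposreal d Hd).
    intros h Hh Hhd. simpl in Hhd. generalize (H' (x + h)).
    replace (x + h - x) with h by ring. intros H2. apply H2; auto. lra.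
Qed.

Lemma D_eq (f : R -> R) (x l l' : R) : is_derive f x l -> l = l' -> is_derive f x l'.
Proof. now intros H <-. Qed.

Lemma D_const (c x : R) : is_derive (fun _ : R => c) x 0.
Proof. exact (is_derive_const (K := R_AbsRing) (V := R_NormedModule) c x). Qed.

Lemma D_id (x : R) : is_derive (fun t : R => t) x 1.
Proof. exact (is_derive_id (K := R_AbsRing) x). Qed.

Lemma D_plus (f g : R -> R) (x a b : R) :
  is_derive f x a -> is_derive g x b -> is_derive (fun t => f t + g t) x (a + b).
Proof. exact (is_derive_plus (K := R_AbsRing) (V := R_NormedModule) f g x a b). Qed.

Lemma D_minus (f g : R -> R) (x a b : R) :
  is_derive f x a -> is_derive g x b -> is_derive (fun t => f t - g t) x (a - b).
Proof. exact (is_derive_minus (K := R_AbsRing) (V := R_NormedModule) f g x a b). Qed.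

Lemma D_opp (f : R -> R) (x a : R) : is_derive f x a -> is_derive (fun t => - f t) x (- a).
Proof. exact (is_derive_opp (K := R_AbsRing) (V := R_NormedModule) f x a). Qed.

Lemma D_mult (f g : R -> R) (x a b : R) :
  is_derive f x a -> is_derive g x b -> is_derive (fun t => f t * g t) x (a * g x + f x * b).
Proof. intros Hf Hg. apply (is_derive_mult f g x a b Hf Hg). intros; apply Rmult_comm. Qed.

Lemma D_comp (f g : R -> R) (x a b : R) :
  is_derive f (g x) a -> is_derive g x b -> is_derive (fun t => f (g t)) x (a * b).
Proof.
  intros Hf Hg. apply (D_eq _ _ (b * a)); [ | ring].
  exact (is_derive_comp (K := R_AbsRing) (V := R_NormedModule) f g x a b Hf Hg).
Qed.

Lemma mvt (f df : R -> R) (a b : R) :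
  a < b ->
  (forall t, a < t < b -> is_derive f t (df t)) ->
  (forall t, a <= t <= b -> continuous f t) ->
  exists c, a < c < b /\ f b - f a = df c * (b - a).
Proof.
  intros Hab Hd Hc.
  assert (pr1 : forall c, a < c < b -> derivable_pt f c).
  { intros c H. exists (df c). now apply is_derive_Reals, Hd. }
  assert (pr2 : forall c, a < c < b -> derivable_pt id c).
  { intros c H. apply derivable_pt_id. }
  destruct (MVT f id a b pr1 pr2 Hab) as [c [P Heq]].
  - intros c H. now apply continuity_pt_filterlim, Hc.
  - intros c H. apply derivable_continuous_pt, derivable_pt_id.
  - exists c; split; [exact P | ]. unfold id at 1 2 in Heq.
    rewrite (derive_pt_eq_0 f c (df c) (pr1 c P)) in Heq by now apply is_derive_Reals, Hd.
    rewrite (derive_pt_eq_0 id c 1 (pr2 c P)) in Heq by apply derivable_pt_lim_id.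
    unfold id in Heq. lra.
Qed.

Lemma nondecr_of_derive (f df : R -> R) (a b : R) :
  a <= b ->
  (forall t, a < t < b -> is_derive f t (df t)) ->
  (forall t, a < t < b -> 0 <= df t) ->
  (forall t, a <= t <= b -> continuous f t) ->
  f a <= f b.
Proof.
  intros [Hab | <-] Hd Hp Hc; [ | lra].
  destruct (mvt f df a b Hab Hd Hc) as [c [H He]]. specialize (Hp c H). nra.
Qed.

Lemma incr_of_derive (f df : R -> R) (a b : R) :
  a < b ->
  (forall t, a < t < b -> is_derive f t (df t)) ->
  (forall t, a < t < b -> 0 < df t) ->
  (forall t, a <= t <= b -> continuous f t) ->
  f a < f b.
Proof.
  intros Hab Hd Hp Hc.
  destruct (mvt f df a b Hab Hd Hc) as [c [H He]]. specialize (Hp c H). nra.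
Qed.

Lemma lipschitz_of_derive (f df : R -> R) (a b K : R) :
  a <= b ->
  (forall t, a <= t <= b -> is_derive f t (df t)) ->
  (forall t, a <= t <= b -> Rabs (df t) <= K) ->
  forall s t, a <= s <= b -> a <= t <= b -> Rabs (f s - f t) <= K * Rabs (s - t).
Proof.
  intros Hab Hd Hp.
  assert (A : forall s t, a <= s <= b -> a <= t <= b -> s < t -> Rabs (f t - f s) <= K * (t - s)).
  { intros s t Hs Ht Hst. destruct (mvt f df s t Hst) as [c [H He]].
    - intros u Hu. apply Hd; lra.
    - intros u Hu. apply (cont_of_derive _ _ (df u)), Hd; lra.
    - rewrite He, Rabs_mult, (Rabs_right (t - s)) by lra.
      apply Rmult_le_compat_r; [lra | apply Hp; lra]. }
  intros s t Hs Ht. destruct (Rtotal_order s t) as [H | [-> | H]].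
  - rewrite (Rabs_minus_sym (f s)), (Rabs_minus_sym s), (Rabs_right (t - s)) by lra. auto.
  - rewrite !Rminus_diag, Rabs_R0. lra.
  - rewrite (Rabs_right (s - t)) by lra. auto.
Qed.

Lemma derive_ge_right (f : R -> R) (x l c d : R) :
  0 < d -> is_derive f x l ->
  (forall t, x < t < x + d -> f x + c * (t - x) <= f t) -> c <= l.
Proof.
  intros Hd H Hr. apply Rnot_lt_le. intros Hl.
  destruct (proj1 (derive_eps f x l) H (c - l)) as [e [He H']]; [lra | ].
  set (m := Rmin d e / 2).
  assert (Hm : 0 < m /\ m < d /\ m < e).
  { unfold m, Rmin. destruct Rle_dec; lra. }
  specialize (H' (x + m)). specialize (Hr (x + m)).
  replace (x + m - x) with m in * by ring.
  assert (Hq : c <= (f (x + m) - f x) / m).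
  { apply Rmult_le_reg_r with m; [lra | ]. unfold Rdiv. rewrite Rmult_assoc, Rinv_l by lra. lra. }
  specialize (H' ltac:(lra)). rewrite Rabs_right in H' by lra.
  specialize (H' ltac:(lra)). apply Rabs_def2 in H'. lra.
Qed.

Lemma derive_ge_left (f : R -> R) (x l c d : R) :
  0 < d -> is_derive f x l ->
  (forall t, x - d < t < x -> f t + c * (x - t) <= f x) -> c <= l.
Proof.
  intros Hd H Hr.
  apply (derive_ge_right (fun t => - f (2 * x - t)) x l c d Hd).
  - apply (D_eq _ _ (- (l * (0 - 1)))); [ | ring].
    apply D_opp, (D_comp f (fun t => 2 * x - t)).
    + now replace (2 * x - x) with x by ring.
    + apply D_minus; [apply D_const | apply D_id].
  - intros t Ht. specialize (Hr (2 * x - t)). replace (2 * x - x) with x by ring. lra.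
Qed.

Lemma derive_le_right (f : R -> R) (x l c d : R) :
  0 < d -> is_derive f x l ->
  (forall t, x < t < x + d -> f t <= f x + c * (t - x)) -> l <= c.
Proof.
  intros Hd H Hr.
  enough (- c <= - l) by lra.
  apply (derive_ge_right (fun t => - f t) x _ _ d Hd).
  - now apply D_opp.
  - intros t Ht. specialize (Hr t Ht). lra.
Qed.

Lemma derive_abs_le_right (f : R -> R) (x l K d : R) :
  0 < d -> is_derive f x l ->
  (forall t, x < t < x + d -> Rabs (f t - f x) <= K * (t - x)) -> Rabs l <= K.
Proof.
  intros Hd H Hr. apply Rabs_le. split.
  - apply (derive_ge_right f x l _ d Hd H). intros t Ht.
    specialize (Hr t Ht). apply Rabs_le_between in Hr. lra.
  - apply (derive_le_right f x l _ d Hd H). intros t Ht.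
    specialize (Hr t Ht). apply Rabs_le_between in Hr. lra.
Qed.

Lemma max_first_order (f : R -> R) (x l d : R) :
  0 < d -> is_derive f x l -> (forall t, Rabs (t - x) < d -> f t <= f x) -> l = 0.
Proof.
  intros Hd H Hm. apply Rle_antisym.
  - apply (derive_le_right f x l 0 d Hd H). intros t Ht.
    specialize (Hm t). rewrite Rabs_right in Hm by lra. lra.
  - apply (derive_ge_left f x l 0 d Hd H). intros t Ht.
    specialize (Hm t). rewrite Rabs_left in Hm by lra. lra.
Qed.

(** A positive second derivative at the critical point would make [f'] positive just to the right of
    it, and [f] would exceed its maximum. The second derivative enters at the single point [x] only,
    so no continuity of it is required. *)
Lemma max_second_order (f f' : R -> R) (x l d : R) :
  0 < d -> (forall t, Rabs (t - x) < d -> is_derive f t (f' t)) -> is_derive f' x l ->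
  (forall t, Rabs (t - x) < d -> f t <= f x) -> l <= 0.
Proof.
  intros Hd H H2 Hm. apply Rnot_lt_le. intros Hl.
  assert (H0 : f' x = 0).
  { apply (max_first_order f x _ d Hd); auto. apply H. rewrite Rminus_diag, Rabs_R0; auto. }
  destruct (proj1 (derive_eps f' x l) H2 l Hl) as [e [He H']].
  set (m := Rmin d e / 2).
  assert (Hq : 0 < m /\ m < d /\ m < e).
  { unfold m, Rmin. destruct Rle_dec; lra. }
  assert (Hlt : f x < f (x + m)).
  { apply (incr_of_derive f f'); [lra | | | ].
    - intros t Ht. apply H. rewrite Rabs_right; lra.
    - intros t Ht. specialize (H' t ltac:(lra)). rewrite (Rabs_right (t - x)) in H' by lra.
      specialize (H' ltac:(lra)). rewrite H0, Rminus_0_r in H'.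
      apply Rabs_def2 in H'. apply Rmult_lt_reg_r with (/ (t - x)); [apply Rinv_0_lt_compat; lra | ].
      unfold Rdiv in H'. lra.
    - intros t Ht. apply (cont_of_derive _ _ (f' t)), H. rewrite Rabs_right; lra. }
  specialize (Hm (x + m)). replace (x + m - x) with m in Hm by ring.
  rewrite Rabs_right in Hm by lra. lra.
Qed.

Lemma mvt_abs (f df : R -> R) (a b : R) :
  (forall t, Rabs (t - a) <= Rabs (b - a) -> is_derive f t (df t)) ->
  exists c, Rabs (c - a) <= Rabs (b - a) /\ f b - f a = df c * (b - a).
Proof.
  intros H.
  assert (Hb : forall t, Rmin a b <= t <= Rmax a b -> Rabs (t - a) <= Rabs (b - a)).
  { intros t. unfold Rmin, Rmax, Rabs. destruct (Rle_dec a b);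
      destruct (Rcase_abs (t - a)); destruct (Rcase_abs (b - a)); lra. }
  destruct (MVT_gen f a b df) as [c [Hc E]].
  - intros t Ht. apply H, Hb. lra.
  - intros t Ht. apply continuity_pt_filterlim, (cont_of_derive _ _ (df t)), H, Hb, Ht.
  - exists c; auto.
Qed.

Lemma prod_close (a b eps : R) : 0 < eps -> exists eta, 0 < eta /\
  forall a' b', Rabs (a' - a) < eta -> Rabs (b' - b) < eta -> Rabs (a' * b' - a * b) < eps.
Proof.
  intros He.
  assert (H : cont2 Rmult a b).
  { apply (cont_mult fst snd); [apply continuous_fst | apply continuous_snd]. }
  exact (proj1 (cont2_eps _ _ _) H eps He).
Qed.

(** The roles of the two variables differ: the derivative in [t] is used only on the line q = [q0]
    at the point itself, while the derivative in [q] must exist nearby and be jointly continuous at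
    the point, since the mean value theorem evaluates it at intermediate points. This fits the
    moving curves s -> [Y] s p and s -> [psi] s y. *)
Lemma derive_along_curve (g gq : R -> R -> R) (q : R -> R) (t0 q0 a b d : R) :
  0 < d ->
  is_derive (fun t => g t q0) t0 a ->
  (forall t y, Rabs (t - t0) < d -> Rabs (y - q0) < d -> is_derive (g t) y (gq t y)) ->
  cont2 gq t0 q0 ->
  q t0 = q0 -> is_derive q t0 b ->
  is_derive (fun t => g t (q t)) t0 (a + gq t0 q0 * b).
Proof.
  intros Hd Ha Hg Hc Hq0 Hq.
  replace (a + gq t0 q0 * b) with (gq t0 q0 * b + a) by ring.
  apply (is_derive_ext (fun t => (g t (q t) - g t q0) + g t q0)); [intros t; simpl; ring | ].
  apply D_plus; auto. apply derive_eps. intros eps He. rewrite Hq0, Rminus_diag.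
  destruct (prod_close (gq t0 q0) b eps He) as [eta [Heta Hprod]].
  destruct (proj1 (cont2_eps _ _ _) Hc eta Heta) as [d1 [Hd1 H1]].
  destruct (proj1 (derive_eps _ _ _) Hq eta Heta) as [d2 [Hd2 H2]].
  destruct (proj1 (cont_eps _ _) (cont_of_derive _ _ _ Hq) (Rmin d d1)) as [d3 [Hd3 H3]].
  { now apply Rmin_glb_lt. }
  exists (Rmin (Rmin d d1) (Rmin d2 d3)). split; [now repeat apply Rmin_glb_lt | ].
  intros t Ht Hlt.
  assert (L1 := Rmin_l (Rmin d d1) (Rmin d2 d3)). assert (L2 := Rmin_r (Rmin d d1) (Rmin d2 d3)).
  assert (L3 := Rmin_l d d1). assert (L4 := Rmin_r d d1).
  assert (L5 := Rmin_l d2 d3). assert (L6 := Rmin_r d2 d3).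
  assert (Hqt : Rabs (q t - q0) < Rmin d d1).
  { rewrite <- Hq0. apply H3. lra. }
  assert (Hxi : exists xi, Rabs (xi - q0) <= Rabs (q t - q0) /\
    g t (q t) - g t q0 = gq t xi * (q t - q0)).
  { apply mvt_abs. intros y Hy. apply Hg; lra. }
  destruct Hxi as [xi [Hxi ->]]. rewrite Rminus_0_r.
  replace (gq t xi * (q t - q0) / (t - t0)) with (gq t xi * ((q t - q0) / (t - t0)))
    by (unfold Rdiv; ring).
  apply Hprod.
  - apply H1; lra.
  - rewrite <- Hq0 at 1. apply H2; auto. lra.
Qed.

(** [Derive] is total: it is half the sum of the upper and lower limits of the difference quotients
    along one fixed sequence of steps. A Lipschitz bound at [x] therefore controls its value even
    where [f] has no derivative. *)
Lemma Derive_abs_le (f : R -> R) (x K d : R) :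
  0 < d -> (forall t, t <> x -> Rabs (t - x) < d -> Rabs (f t - f x) <= K * Rabs (t - x)) ->
  Rabs (Derive f x) <= K.
Proof.
  intros Hd H. unfold Derive, Lim.
  set (w := fun n => (f (x + Rbar_loc_seq 0 n) - f x) / Rbar_loc_seq 0 n).
  assert (Hw : eventually (fun n => - K <= w n <= K)).
  { destruct (filterlim_Rbar_loc_seq 0 (fun t => Rabs t < d /\ t <> 0)) as [N HN].
    - exists (mkposreal d Hd). intros t Ht Ht0. split; auto.
      change (Rabs (t - 0) < d) in Ht. now rewrite Rminus_0_r in Ht.
    - exists N. intros n Hn. destruct (HN n Hn) as [A B]. unfold w.
      set (h := Rbar_loc_seq 0 n) in *.
      apply Rabs_le_between. unfold Rdiv. rewrite Rabs_mult, Rabs_inv.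
      specialize (H (x + h)). replace (x + h - x) with h in H by ring.
      assert (0 < Rabs h) by now apply Rabs_pos_lt.
      apply Rmult_le_reg_r with (Rabs h); auto.
      rewrite Rmult_assoc, Rinv_l, Rmult_1_r by lra. apply H; auto. lra. }
  assert (H1 : Rbar_le (Lim_seq (fun _ => - K)) (Lim_seq w)).
  { apply Lim_seq_le_loc. destruct Hw as [N HN]. exists N. intros n Hn. now apply HN. }
  assert (H2 : Rbar_le (Lim_seq w) (Lim_seq (fun _ => K))).
  { apply Lim_seq_le_loc. destruct Hw as [N HN]. exists N. intros n Hn. now apply HN. }
  rewrite Lim_seq_const in H1, H2.
  apply Rabs_le. destruct (Lim_seq w); simpl in *; try easy.
Qed.

(** * Comparison principle for the von Mises equation *)

Definition barrier (p : R) : R := 1 + sqrt p + p.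

Lemma barrier_ge (p : R) : 0 <= p -> 1 + p <= barrier p.
Proof. intros Hp. unfold barrier. generalize (sqrt_pos p). lra. Qed.

Lemma barrier_D1 (p : R) : 0 < p -> is_derive barrier p (/ (2 * sqrt p) + 1).
Proof.
  intros Hp. unfold barrier. assert (0 < sqrt p) by now apply sqrt_lt_R0.
  auto_derive; [lra | ]. field. lra.
Qed.

Lemma barrier_D2 (p : R) :
  0 < p -> is_derive (fun p => / (2 * sqrt p) + 1) p (- / (4 * (p * sqrt p))).
Proof.
  intros Hp. assert (H : 0 < sqrt p) by now apply sqrt_lt_R0.
  auto_derive; [repeat split; try lra | ].
  replace (p * sqrt p) with (sqrt p * sqrt p * sqrt p) by now rewrite sqrt_sqrt by lra.
  field. lra.
Qed.

(* [fx], [fp], [fq] stand for the partial derivatives [f_x], [f_p], [f_pp]. *)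
Definition vm_regular (X : R) (f fx fp fq : R -> R -> R) : Prop :=
  (forall x p, 0 <= x <= X -> 0 <= p -> cont2 f x p) /\
  (forall x p, 0 < x <= X -> 0 < p -> is_derive (fun s => f s p) x (fx x p)) /\
  (forall x p, 0 < x <= X -> 0 < p -> is_derive (f x) p (fp x p)) /\
  (forall x p, 0 < x <= X -> 0 < p -> is_derive (fp x) p (fq x p)) /\
  (forall x p, 0 < x <= X -> 0 < p -> 0 < f x p).

(* The quotient of [f1 - f2] by the barrier [e^(A x) (1 + sqrt p + p)] cannot have a positive
   maximum: the singular concavity of [sqrt p] absorbs the zero order coefficient, which
   blows up at [p = 0], and the linear growth excludes a supremum at infinity. *)
Lemma vm_comparison (X M K A : R) (f1 f1x f1p f1q f2 f2x f2p f2q : R -> R -> R) :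
  0 <= K -> 0 < A ->
  vm_regular X f1 f1x f1p f1q -> vm_regular X f2 f2x f2p f2q ->
  (forall x p, 0 < x <= X -> 0 < p -> f1x x p <= sqrt (f1 x p) * f1q x p) ->
  (forall x p, 0 < x <= X -> 0 < p -> sqrt (f2 x p) * f2q x p <= f2x x p) ->
  (forall x p, 0 <= x <= X -> 0 <= p -> f1 x p - f2 x p <= M) ->
  (forall p, 0 <= p -> f1 0 p <= f2 0 p) ->
  (forall x, 0 <= x <= X -> f1 x 0 <= f2 x 0) ->
  (forall x p, 0 < x <= X -> 0 < p -> f1q x p <= K \/ f2q x p <= K) ->
  (forall x p, 0 < x <= X -> 0 < p ->
     K / sqrt (f2 x p) * barrier p < sqrt (f2 x p) * / (4 * (p * sqrt p)) + A * barrier p) ->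
  forall x p, 0 <= x <= X -> 0 <= p -> f1 x p <= f2 x p.
Proof.
  intros HK HA [C1 [D1x [D1p [D1q P1]]]] [C2 [D2x [D2p [D2q P2]]]] Hsub Hsup HM H0 Hb HqK Hbar
    x0 p0 Hx0 Hp0.
  apply Rnot_lt_le. intros Hlt.
  set (B := fun x p => exp (A * x) * barrier p).
  assert (HB : forall x p, 0 <= x -> 0 <= p -> 1 + p <= B x p).
  { intros x p Hx Hp. unfold B. generalize (barrier_ge p Hp).
    assert (1 <= exp (A * x)).
    { rewrite <- exp_0. destruct (Req_dec x 0) as [-> | Hx'].
      - rewrite Rmult_0_r; lra.
      - left; apply exp_increasing; nra. }
    nra. }
  set (r := fun x p => (f1 x p - f2 x p) / B x p).
  assert (Hr0 : 0 < r x0 p0).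
  { unfold r. specialize (HB x0 p0 ltac:(lra) Hp0). apply Rdiv_lt_0_compat; lra. }
  (* Since [B] is at least 1 + p, on the side p = [Rr] the bound [M] keeps the quotient below its
     value at ([x0], [p0]), so the maximum over the box is not attained there. *)
  set (Rr := p0 + 1 + Rabs M / r x0 p0).
  assert (HRr : p0 < Rr /\ Rabs M < r x0 p0 * (1 + Rr)).
  { unfold Rr. assert (0 <= Rabs M / r x0 p0).
    { apply Rmult_le_pos; [apply Rabs_pos | left; now apply Rinv_0_lt_compat]. }
    split; [lra | ]. replace (r x0 p0 * (1 + (p0 + 1 + Rabs M / r x0 p0)))
      with (r x0 p0 * (p0 + 2) + Rabs M) by (field; lra). nra. }
  destruct HRr as [HR1 HR2].
  destruct (extreme_value_2 r 0 X 0 Rr) as [x1 [p1 [Hx1 [Hp1 Hmax]]]]; [lra | lra | | ].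
  { intros x p Hx Hp. unfold r. apply cont_div.
    - simpl. specialize (HB x p ltac:(lra) ltac:(lra)). lra.
    - apply cont_minus; [apply C1 | apply C2]; lra.
    - unfold B, barrier. cont_tac. }
  set (m := r x1 p1) in *.
  assert (Hm : r x0 p0 <= m) by (apply Hmax; lra).
  assert (HW : forall x p, 0 <= x <= X -> 0 <= p <= Rr -> f1 x p - f2 x p <= m * B x p).
  { intros x p Hx Hp. specialize (Hmax x p Hx Hp). unfold r in Hmax.
    specialize (HB x p ltac:(lra) ltac:(lra)).
    apply Rmult_le_reg_r with (/ B x p); [apply Rinv_0_lt_compat; lra | ].
    rewrite Rmult_assoc, Rinv_r, Rmult_1_r by lra. exact Hmax. }
  assert (HE : f1 x1 p1 - f2 x1 p1 = m * B x1 p1).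
  { unfold m, r. specialize (HB x1 p1 ltac:(lra) ltac:(lra)). field. lra. }
  assert (HB1 := HB x1 p1 ltac:(lra) ltac:(lra)).
  assert (Hx1' : 0 < x1).
  { destruct (Req_dec x1 0) as [E | E]; [ | lra].
    rewrite E in HE, HB1. specialize (H0 p1 ltac:(lra)). nra. }
  assert (Hp1' : 0 < p1).
  { destruct (Req_dec p1 0) as [E | E]; [ | lra].
    rewrite E in HE, HB1. specialize (Hb x1 ltac:(lra)). nra. }
  assert (Hp1R : p1 < Rr).
  { destruct (Req_dec p1 Rr) as [E | E]; [ | lra].
    rewrite E in HE, HB1. specialize (HM x1 Rr ltac:(lra) ltac:(lra)).
    generalize (Rle_abs M). nra. }
  assert (DB : forall x p : R, is_derive (fun s => B s p) x (A * B x p)).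
  { intros x p. unfold B. auto_derive; auto. ring. }
  assert (Sx : m * (A * B x1 p1) <= f1x x1 p1 - f2x x1 p1).
  { enough (0 <= f1x x1 p1 - f2x x1 p1 - m * (A * B x1 p1)) by lra.
    apply (derive_ge_left (fun s => f1 s p1 - f2 s p1 - m * B s p1) x1 _ 0 x1 Hx1').
    - apply D_minus; [apply (D_minus (fun s => f1 s p1) (fun s => f2 s p1)); [apply D1x | apply D2x]; lra | ].
      apply (D_eq _ _ (0 * B x1 p1 + m * (A * B x1 p1))); [ | ring].
        apply (D_mult (fun _ => m) (fun s => B s p1)); [apply D_const | apply DB].
    - intros t Ht. specialize (HW t p1 ltac:(lra) ltac:(lra)). lra. }
  set (e := exp (A * x1)).
  assert (He : 0 < e) by apply exp_pos.
  assert (Sp : f1q x1 p1 - f2q x1 p1 - m * (e * - / (4 * (p1 * sqrt p1))) <= 0).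
  { apply (max_second_order (fun p => f1 x1 p - f2 x1 p - m * B x1 p)
      (fun p => f1p x1 p - f2p x1 p - m * (e * (/ (2 * sqrt p) + 1))) p1 _ (Rmin p1 (Rr - p1))).
    - apply Rmin_glb_lt; lra.
    - intros t Ht. assert (0 < t).
      { apply Rabs_def2 in Ht. generalize (Rmin_l p1 (Rr - p1)). lra. }
      apply D_minus; [apply D_minus; [apply D1p | apply D2p]; lra | ].
      apply (D_eq _ _ (0 * B x1 t + m * (0 * barrier t + e * (/ (2 * sqrt t) + 1)))); [ | ring].
      apply (D_mult (fun _ => m) (B x1)); [apply D_const | ].
      apply (D_mult (fun _ => e) barrier); [apply D_const | now apply barrier_D1].
    - apply D_minus; [apply D_minus; [apply D1q | apply D2q]; lra | ].
      set (g := fun p => / (2 * sqrt p) + 1).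
      apply (D_eq _ _ (0 * (e * g p1) + m * (0 * g p1 + e * - / (4 * (p1 * sqrt p1))))); [ | ring].
      apply (D_mult (fun _ => m) (fun p => e * g p)); [apply D_const | ].
      apply (D_mult (fun _ => e) g); [apply D_const | now apply barrier_D2].
    - intros t Ht. apply Rabs_def2 in Ht.
      generalize (Rmin_l p1 (Rr - p1)) (Rmin_r p1 (Rr - p1)); intros.
      specialize (HW x1 t ltac:(lra) ltac:(lra)). lra. }
  specialize (Hsub x1 p1 ltac:(lra) Hp1'). specialize (Hsup x1 p1 ltac:(lra) Hp1').
  specialize (HqK x1 p1 ltac:(lra) Hp1'). specialize (Hbar x1 p1 ltac:(lra) Hp1').
  specialize (P1 x1 p1 ltac:(lra) Hp1'). specialize (P2 x1 p1 ltac:(lra) Hp1').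
  assert (Hs2 : 0 < sqrt (f2 x1 p1)) by now apply sqrt_lt_R0.
  assert (Hgap : 0 < f1 x1 p1 - f2 x1 p1) by (rewrite HE; nra).
  assert (Hs12 : sqrt (f2 x1 p1) <= sqrt (f1 x1 p1)) by (apply sqrt_le_1_alt; lra).
  assert (Hw : 0 < / (4 * (p1 * sqrt p1))).
  { apply Rinv_0_lt_compat. assert (0 < sqrt p1) by now apply sqrt_lt_R0. nra. }
  set (s1 := sqrt (f1 x1 p1)) in *. set (s2 := sqrt (f2 x1 p1)) in *.
  set (w := / (4 * (p1 * sqrt p1))) in *.
  clearbody m w.
  (* The difference of the right-hand sides is split as (s1 - s2) [f1q] + s2 ([f1q] - [f2q]). The
     first term carries the singular zero order coefficient, the second the concavity of the
     barrier. *)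
  assert (Hdiff : s1 - s2 <= m * B x1 p1 / s2).
  { assert (E1 : s1 * s1 = f1 x1 p1) by (apply sqrt_sqrt; lra).
    assert (E2 : s2 * s2 = f2 x1 p1) by (apply sqrt_sqrt; lra).
    apply Rmult_le_reg_r with s2; auto. unfold Rdiv. rewrite Rmult_assoc, Rinv_l, Rmult_1_r by lra.
    rewrite <- HE, <- E1, <- E2. nra. }
  (* At the maximum [f1q] lies below [f2q], so an upper bound on either of the two second
     derivatives is enough. *)
  assert (Hq1 : f1q x1 p1 <= K).
  { destruct HqK as [H | H]; [exact H | ]. assert (0 < m * (e * w)) by (repeat apply Rmult_lt_0_compat; lra). lra. }
  assert (T1 : (s1 - s2) * f1q x1 p1 <= K * (m * B x1 p1 / s2)) by nra.
  assert (T2 : s2 * (f1q x1 p1 - f2q x1 p1) <= s2 * (- (m * (e * w)))).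
  { apply Rmult_le_compat_l; lra. }
  assert (T3 : K * (m * B x1 p1 / s2) - s2 * (m * (e * w)) < m * (A * B x1 p1)).
  { unfold B. fold e. assert (0 < m * e) by (apply Rmult_lt_0_compat; lra).
    replace (K * (m * (e * barrier p1) / s2) - s2 * (m * (e * w)))
      with (m * e * (K / s2 * barrier p1 - s2 * w)) by (field; lra).
    replace (m * (A * (e * barrier p1))) with (m * e * (A * barrier p1)) by ring.
    apply Rmult_lt_compat_l; auto. lra. }
  nra.
Qed.

(** With [K] = 0 the zero order term has the good sign, and no lower bound on [f2] near p = 0 is
    needed. This covers comparisons in which one function is concave in p: a Blasius profile or the
    datum. *)
Lemma vm_comparison_concave (X M : R) (f1 f1x f1p f1q f2 f2x f2p f2q : R -> R -> R) :
  vm_regular X f1 f1x f1p f1q -> vm_regular X f2 f2x f2p f2q ->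
  (forall x p, 0 < x <= X -> 0 < p -> f1x x p <= sqrt (f1 x p) * f1q x p) ->
  (forall x p, 0 < x <= X -> 0 < p -> sqrt (f2 x p) * f2q x p <= f2x x p) ->
  (forall x p, 0 <= x <= X -> 0 <= p -> f1 x p - f2 x p <= M) ->
  (forall p, 0 <= p -> f1 0 p <= f2 0 p) ->
  (forall x, 0 <= x <= X -> f1 x 0 <= f2 x 0) ->
  (forall x p, 0 < x <= X -> 0 < p -> f1q x p <= 0 \/ f2q x p <= 0) ->
  forall x p, 0 <= x <= X -> 0 <= p -> f1 x p <= f2 x p.
Proof.
  intros R1 R2 Hsub Hsup HM H0 Hb HqK.
  apply (vm_comparison X M 0 1 f1 f1x f1p f1q f2 f2x f2p f2q); auto; try lra.
  intros x p Hx Hp. destruct R2 as [_ [_ [_ [_ P2]]]].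
  generalize (barrier_ge p ltac:(lra)); intros.
  assert (0 < sqrt (f2 x p)) by now apply sqrt_lt_R0, P2.
  assert (0 < sqrt p) by now apply sqrt_lt_R0.
  assert (0 < / (4 * (p * sqrt p))) by (apply Rinv_0_lt_compat; nra).
  unfold Rdiv. rewrite Rmult_0_l, Rmult_0_l. nra.
Qed.

(** For p <= 1 the left side is of order p^(-1/2) while s / (4 p^(3/2)) is at least of order 1/p,
    because s is at least of order sqrt p. For p >= 1 both [K / s] and the barrier quotient are
    harmless and the term with [A] wins. *)
Lemma barrier_constant (K c : R) : 0 <= K -> 0 < c -> exists A, 0 < A /\
  forall s p, 0 < p -> c * Rmin p 1 <= s * s -> 0 < s ->
  K / s * barrier p < s * / (4 * (p * sqrt p)) + A * barrier p.
Proof.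
  intros HK Hc. set (r := sqrt c). assert (Hr : 0 < r) by now apply sqrt_lt_R0.
  assert (Er : r * r = c) by (apply sqrt_sqrt; lra).
  set (A0 := 9 * K * K / (r * r * r)).
  assert (HA0 : 0 <= A0).
  { apply Rmult_le_pos; [nra | left; apply Rinv_0_lt_compat; nra]. }
  assert (HKr : 0 <= K / r) by (apply Rmult_le_pos; [lra | left; now apply Rinv_0_lt_compat]).
  exists (A0 + K / r + 1). split; [lra | ].
  intros s p Hp Hs Hs0.
  assert (HB := barrier_ge p ltac:(lra)).
  set (q := sqrt p). assert (Hq : 0 < q) by now apply sqrt_lt_R0.
  assert (Eq : q * q = p) by (apply sqrt_sqrt; lra).
  destruct (Rle_dec p 1) as [H1 | H1].
  - rewrite Rmin_left in Hs by lra.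
    assert (Hsq : r * q <= s).
    { apply Rsqr_incr_0_var; [ | lra]. unfold Rsqr. nra. }
    assert (q <= 1) by nra.
    assert (HB3 : barrier p <= 3) by (unfold barrier; fold q; lra).
    assert (S1 : K / s * barrier p <= 3 * K / (r * q)).
    { assert (K / s <= K / (r * q)).
      { apply Rmult_le_compat_l; auto. apply Rinv_le_contravar; auto. nra. }
      assert (0 <= K / s) by (apply Rmult_le_pos; [lra | left; now apply Rinv_0_lt_compat]).
      replace (3 * K / (r * q)) with (K / (r * q) * 3) by (field; lra). nra. }
    assert (S2 : r / (4 * p) <= s * / (4 * (p * q))).
    { replace (r / (4 * p)) with (r * q * / (4 * (p * q))) by (field; lra).
      apply Rmult_le_compat_r; auto. left; apply Rinv_0_lt_compat; nra. }
    (* AM-GM in [1/q] *)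
    assert (S3 : 3 * K / (r * q) <= r / (4 * p) + A0).
    { assert (E : r / (4 * p) + A0 - 3 * K / (r * q) = / (4 * p * (r * r * r)) * Rsqr (r * r - 6 * K * q)).
      { unfold A0, Rsqr. rewrite <- Eq. field. split; lra. }
      assert (0 <= / (4 * p * (r * r * r)) * Rsqr (r * r - 6 * K * q)).
      { apply Rmult_le_pos; [left; apply Rinv_0_lt_compat; repeat apply Rmult_lt_0_compat; lra | apply Rle_0_sqr]. }
      lra. }
    fold q. nra.
  - rewrite Rmin_right in Hs by lra.
    assert (Hsr : r <= s) by (apply Rsqr_incr_0_var; [unfold Rsqr; nra | lra]).
    assert (K / s <= K / r) by (apply Rmult_le_compat_l; auto; apply Rinv_le_contravar; auto).
    assert (0 < s * / (4 * (p * q))).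
    { apply Rmult_lt_0_compat; auto. apply Rinv_0_lt_compat. nra. }
    fold q. nra.
Qed.

(** The version for comparing phi with its own shifts and dilations, where concavity is not yet
    known and must be replaced by a one-sided bound on the second derivative and a lower bound
    linear at the wall. *)
Lemma vm_comparison_bounded (X M K c : R) (f1 f1x f1p f1q f2 f2x f2p f2q : R -> R -> R) :
  0 <= K -> 0 < c ->
  vm_regular X f1 f1x f1p f1q -> vm_regular X f2 f2x f2p f2q ->
  (forall x p, 0 < x <= X -> 0 < p -> f1x x p <= sqrt (f1 x p) * f1q x p) ->
  (forall x p, 0 < x <= X -> 0 < p -> sqrt (f2 x p) * f2q x p <= f2x x p) ->
  (forall x p, 0 <= x <= X -> 0 <= p -> f1 x p - f2 x p <= M) ->
  (forall p, 0 <= p -> f1 0 p <= f2 0 p) ->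
  (forall x, 0 <= x <= X -> f1 x 0 <= f2 x 0) ->
  (forall x p, 0 < x <= X -> 0 < p -> f1q x p <= K \/ f2q x p <= K) ->
  (forall x p, 0 < x <= X -> 0 < p -> c * Rmin p 1 <= f2 x p) ->
  forall x p, 0 <= x <= X -> 0 <= p -> f1 x p <= f2 x p.
Proof.
  intros HK Hc R1 R2 Hsub Hsup HM H0 Hb HqK Hc2.
  destruct (barrier_constant K c HK Hc) as [A [HA HAb]].
  apply (vm_comparison X M K A f1 f1x f1p f1q f2 f2x f2p f2q); auto.
  intros x p Hx Hp. destruct R2 as [_ [_ [_ [_ P2]]]]. specialize (P2 x p Hx Hp).
  apply HAb; auto.
  - rewrite sqrt_sqrt by lra. auto.
  - now apply sqrt_lt_R0.
Qed.

(** * Kruzhkov's gradient estimate *)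

(* Kruzhkov's doubling of variables: [R(x,p1) - R(x,p2)] solves a parabolic equation in two space
   variables whose ellipticity in the direction [p1 - p2] needs no regularity of [a]. *)
Lemma parabolic_gradient_le (u ux up uq a F : R -> R -> R) (x0 p0 T rho lam M F0 : R) :
  0 < T -> 0 < rho -> 0 < lam -> 0 <= M ->
  (forall x p, x0 - T <= x <= x0 -> Rabs (p - p0) <= rho ->
     cont2 u x p /\ is_derive (fun s => u s p) x (ux x p) /\
     is_derive (u x) p (up x p) /\ is_derive (up x) p (uq x p) /\
     ux x p = a x p * uq x p + F x p /\ lam <= a x p /\ Rabs (F x p) <= F0 /\
     Rabs (u x p) <= M) ->
  up x0 p0 <= 8 * M / rho + rho * F0 / lam + M * rho / (lam * T).
Proof.
  intros HT Hrho Hlam HM H.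
  apply Rle_trans with (r2 := 8 * M / rho + rho * F0 / lam + M * rho / (lam * T)); [ | lra].
  apply Rnot_lt_le. intros Hlt.
  set (N := up x0 p0) in *.
  set (bnd := 8 * M / rho + rho * F0 / lam + M * rho / (lam * T)) in *.
  (* A slope strictly between the bound and the actual derivative: below [N], so that [W] becomes
     positive near the diagonal; above [bnd], so that the maximum leads to a contradiction. *)
  set (N' := (N + bnd) / 2).
  assert (HN' : bnd < N' < N) by (unfold N'; lra).
  assert (HF0 : 0 <= F0).
  { destruct (H x0 p0) as [_ [_ [_ [_ [_ [_ [HF _]]]]]]]; [lra | rewrite Rminus_diag, Rabs_R0; lra | ].
    generalize (Rabs_pos (F x0 p0)); lra. }
  assert (Hbnd : 0 <= bnd).
  { unfold bnd. assert (0 <= 8 * M / rho) by (apply Rdiv_le_0_compat; lra).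
    assert (0 <= rho * F0 / lam) by (apply Rdiv_le_0_compat; nra).
    assert (0 <= M * rho / (lam * T)) by (apply Rdiv_le_0_compat; nra). lra. }
  (* Chosen so that the penalty equals 2 [M], the largest possible difference of values of [u], when
     the midpoint or the half-difference is at distance [rho] / 2 from its centre. *)
  set (k := 4 * M / (rho * rho)).
  assert (Hk : 0 <= k) by (apply Rdiv_le_0_compat; nra).
  (* A concave modulus with slope 1 at 0 and second derivative -1 / [rho]; it contributes N' / [rho]
     to the second derivative condition in each of the two space variables. *)
  set (g := fun s => s - s * s / (2 * rho)).
  set (W := fun x p1 p2 => u x p1 - u x p2 - N' * g (p1 - p2)
     - k * ((p1 - p0) * (p1 - p0) + (p2 - p0) * (p2 - p0)) - 2 * M / T * (x0 - x)).
  assert (Hg : forall s, 0 <= s <= rho -> 0 <= g s).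
  { intros s Hs. unfold g. replace (s - s * s / (2 * rho)) with (s * (2 * rho - s) / (2 * rho)) by (field; lra).
    apply Rdiv_le_0_compat; nra. }
  (* Along p0 + s, p0 - s the function [W] vanishes at s = 0 and has slope 2 [N] - 2 [N'] > 0
     there. *)
  assert (Hpos : exists s, 0 < s < rho / 2 /\ 0 < W x0 (p0 + s) (p0 - s)).
  { apply Classical_Prop.NNPP. intros Hno.
    destruct (H x0 p0) as [_ [_ [Dp _]]]; [lra | rewrite Rminus_diag, Rabs_R0; lra | ].
    enough (2 * N <= 2 * N') by lra.
    apply (derive_le_right (fun s => u x0 (p0 + s) - u x0 (p0 - s) - 2 * k * (s * s)) 0 _ _ (rho / 2)).
    - lra.
    - apply (D_eq _ _ (N * (0 + 1) - N * (0 - 1) - 2 * k * (1 * 0 + 0 * 1))); [ | ring].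
      apply D_minus; [apply D_minus | ].
      + apply (D_comp (u x0) (fun s => p0 + s)).
        * now rewrite Rplus_0_r.
        * apply D_plus; [apply D_const | apply D_id].
      + apply (D_comp (u x0) (fun s => p0 - s)).
        * now rewrite Rminus_0_r.
        * apply D_minus; [apply D_const | apply D_id].
      + auto_derive; [exact I | ring].
    - intros s Hs. rewrite Rplus_0_r, Rminus_0_r, Rminus_diag.
      assert (HWs : W x0 (p0 + s) (p0 - s) <= 0).
      { apply Rnot_lt_le. intros Hw. apply Hno. exists s. split; auto. lra. }
      unfold W in HWs. replace (p0 + s - (p0 - s)) with (2 * s) in HWs by ring.
      assert (g (2 * s) <= 2 * s).
      { unfold g. assert (0 <= 2 * s * (2 * s) / (2 * rho)) by (apply Rdiv_le_0_compat; nra). lra. }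
      assert (N' * g (2 * s) <= N' * (2 * s)) by (apply Rmult_le_compat_l; lra).
      replace (p0 + s - p0) with s in HWs by ring. replace (p0 - s - p0) with (- s) in HWs by ring.
      rewrite Rminus_diag in HWs. nra. }
  destruct Hpos as [s0 [Hs0 HW0]].
  assert (Hdom : forall m s, p0 - rho / 2 <= m <= p0 + rho / 2 -> 0 <= s <= rho / 2 ->
     Rabs (m + s - p0) <= rho /\ Rabs (m - s - p0) <= rho).
  { intros m s Hm Hs. split; apply Rabs_le; lra. }
  (* In terms of the midpoint [m] and the half-difference [s] the region p1 >= p2 becomes a box. On
     its faces other than x = [x0] the penalties, or the vanishing on the diagonal, make [W]
     nonpositive. *)
  destruct (extreme_value_3 (fun t => W (fst t) (fst (snd t) + snd (snd t)) (fst (snd t) - snd (snd t)))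
    (x0 - T) x0 (p0 - rho / 2) (p0 + rho / 2) 0 (rho / 2)) as [x1 [m [s [Hx1 [Hm [Hs Hmax]]]]]];
    [lra | lra | lra | | ].
  { intros x m s Hx Hm Hs. destruct (Hdom m s Hm Hs) as [B1 B2].
    assert (C1 : forall U : UniformSpace, forall f : U -> R * R, forall z, continuous f z -> continuous (fun t => snd (f t)) z).
    { intros U f z Hf. apply (continuous_comp f snd z Hf). destruct (f z). apply continuous_snd. }
    assert (Cm : continuous (fun t : R * (R * R) => fst (snd t)) (x, (m, s))).
    { apply cont_fst_comp, continuous_snd. }
    assert (Cs : continuous (fun t : R * (R * R) => snd (snd t)) (x, (m, s))).
    { apply C1, continuous_snd. }
    assert (Cx : continuous (fun t : R * (R * R) => fst t) (x, (m, s))) by apply continuous_fst.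
    unfold W, g, Rdiv.
    assert (Cu1 : continuous (fun t : R * (R * R) => u (fst t) (fst (snd t) + snd (snd t))) (x, (m, s))).
    { apply cont2_comp; [exact Cx | now apply cont_plus | ]. now apply H. }
    assert (Cu2 : continuous (fun t : R * (R * R) => u (fst t) (fst (snd t) - snd (snd t))) (x, (m, s))).
    { apply cont2_comp; [exact Cx | now apply cont_minus | ]. now apply H. }
    cont_tac. }
  simpl in Hmax.
  set (p1 := m + s) in *. set (p2 := m - s) in *.
  assert (HW1 : 0 < W x1 p1 p2).
  { specialize (Hmax x0 p0 s0 ltac:(lra) ltac:(lra) ltac:(lra)). lra. }
  destruct (Hdom m s Hm Hs) as [B1 B2]. fold p1 in B1. fold p2 in B2.
  destruct (H x1 p1 Hx1 B1) as [_ [D1x [D1p [D1q [E1 [A1 [F1 M1]]]]]]].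
  destruct (H x1 p2 Hx1 B2) as [_ [D2x [D2p [D2q [E2 [A2 [F2 M2]]]]]]].
  apply Rabs_le_between in M1, M2, F1, F2.
  assert (Hks : k * ((p1 - p0) * (p1 - p0) + (p2 - p0) * (p2 - p0)) = 2 * k * ((m - p0) * (m - p0) + s * s)).
  { unfold p1, p2. ring. }
  assert (Hkr : 2 * k * (rho / 2 * (rho / 2)) = 2 * M).
  { unfold k. field. lra. }
  assert (HMT : 2 * M / T * T = 2 * M) by (field; lra).
  assert (HMT' : 0 <= 2 * M / T) by (apply Rdiv_le_0_compat; lra).
  assert (Hgs : 0 <= N' * g (p1 - p2)).
  { apply Rmult_le_pos; [lra | ]. apply Hg. unfold p1, p2. lra. }
  assert (Hx0' : 0 <= 2 * M / T * (x0 - x1)) by (apply Rmult_le_pos; lra).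
  assert (Hsum : 0 <= k * ((p1 - p0) * (p1 - p0) + (p2 - p0) * (p2 - p0))).
  { apply Rmult_le_pos; auto. apply Rplus_le_le_0_compat; [exact (Rle_0_sqr (p1 - p0)) | exact (Rle_0_sqr (p2 - p0))]. }
  assert (Is0 : s <> 0).
  { intros E. unfold W, p1, p2, g in HW1. rewrite E in HW1. unfold p1, p2 in Hsum. rewrite E in Hsum.
    replace (m + 0 - (m - 0)) with 0 in HW1 by ring.
    replace (m + 0) with m in * by ring. replace (m - 0) with m in * by ring.
    unfold Rdiv in HW1. rewrite !Rmult_0_l, Rminus_0_r, Rmult_0_r in HW1. unfold Rdiv in Hx0'. lra. }
  assert (Is1 : s <> rho / 2).
  { intros E. unfold W in HW1. rewrite Hks in HW1. rewrite E in HW1.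
    assert (0 <= 2 * k * ((m - p0) * (m - p0))) by (apply Rmult_le_pos; [lra | exact (Rle_0_sqr (m - p0))]). lra. }
  assert (Im1 : m <> p0 - rho / 2).
  { intros E. unfold W in HW1. rewrite Hks in HW1. rewrite E in HW1.
    assert (0 <= 2 * k * (s * s)) by (apply Rmult_le_pos; [lra | exact (Rle_0_sqr s)]).
    replace (p0 - rho / 2 - p0) with (- (rho / 2)) in HW1 by ring. lra. }
  assert (Im2 : m <> p0 + rho / 2).
  { intros E. unfold W in HW1. rewrite Hks in HW1. rewrite E in HW1.
    assert (0 <= 2 * k * (s * s)) by (apply Rmult_le_pos; [lra | exact (Rle_0_sqr s)]).
    replace (p0 + rho / 2 - p0) with (rho / 2) in HW1 by ring. lra. }
  assert (Ix : x0 - T < x1).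
  { destruct (Req_dec x1 (x0 - T)) as [E | E]; [ | lra].
    exfalso. unfold W in HW1. replace (x0 - x1) with T in HW1 by lra. lra. }
  set (d := Rmin (Rmin s (rho / 2 - s)) (Rmin (m - (p0 - rho / 2)) (p0 + rho / 2 - m))).
  assert (Hd : 0 < d) by (unfold d; repeat apply Rmin_glb_lt; lra).
  assert (Hd1 : d <= s /\ d <= rho / 2 - s /\ d <= m - (p0 - rho / 2) /\ d <= p0 + rho / 2 - m).
  { unfold d. generalize (Rmin_l (Rmin s (rho / 2 - s)) (Rmin (m - (p0 - rho / 2)) (p0 + rho / 2 - m)))
     (Rmin_r (Rmin s (rho / 2 - s)) (Rmin (m - (p0 - rho / 2)) (p0 + rho / 2 - m)))
     (Rmin_l s (rho / 2 - s)) (Rmin_r s (rho / 2 - s))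
     (Rmin_l (m - (p0 - rho / 2)) (p0 + rho / 2 - m)) (Rmin_r (m - (p0 - rho / 2)) (p0 + rho / 2 - m)). lra. }
  clearbody d.
  assert (Hnear : forall q1 q2, Rabs (q1 - p1) < d -> Rabs (q2 - p2) < d -> W x1 q1 q2 <= W x1 p1 p2).
  { intros q1 q2 Hq1 Hq2. apply Rabs_def2 in Hq1, Hq2. unfold p1, p2 in Hq1, Hq2.
    specialize (Hmax x1 ((q1 + q2) / 2) ((q1 - q2) / 2) ltac:(lra) ltac:(lra) ltac:(lra)).
    replace ((q1 + q2) / 2 + (q1 - q2) / 2) with q1 in Hmax by field.
    replace ((q1 + q2) / 2 - (q1 - q2) / 2) with q2 in Hmax by field. exact Hmax. }
  assert (Sx : 0 <= ux x1 p1 - ux x1 p2 + 2 * M / T).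
  { apply (derive_ge_left (fun x => W x p1 p2) x1 _ 0 (x1 - (x0 - T))); [lra | | ].
    - apply (D_eq _ _ (ux x1 p1 - ux x1 p2 - 0 - 0 - 2 * M / T * (0 - 1))); [ | ring].
      unfold W. repeat apply D_minus; try apply D_const; auto.
      apply (D_eq _ _ (0 * (x0 - x1) + 2 * M / T * (0 - 1))); [ | ring].
      apply (D_mult (fun _ => 2 * M / T) (fun x => x0 - x)); [apply D_const | ].
      apply D_minus; [apply D_const | apply D_id].
    - intros t Ht. specialize (Hmax t m s ltac:(lra) Hm Hs). fold p1 p2 in Hmax. lra. }
  assert (S1 : uq x1 p1 + N' / rho - 2 * k <= 0).
  { apply (max_second_order (fun p => W x1 p p2) (fun p => up x1 p - N' * (1 - (p - p2) / rho) - 2 * k * (p - p0))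
      p1 _ d Hd).
    - intros t Ht. apply Rabs_def2 in Ht. unfold W.
      apply (D_eq _ _ (up x1 t - 0 - N' * (1 - (t - p2) / rho) - 2 * k * (t - p0) - 0)); [ | ring].
      apply D_minus; [apply D_minus; [apply D_minus; [apply D_minus | ] | ] | ]; try apply D_const.
      + apply H; auto. apply Rabs_le. unfold p1 in *. lra.
      + unfold g. auto_derive; [exact I | field; lra].
      + auto_derive; [exact I | ring].
    - apply (D_eq _ _ (uq x1 p1 - - N' / rho - 2 * k)); [ | field; lra].
      apply D_minus; [apply D_minus | ]; auto.
      + auto_derive; [exact I | field; lra].
      + auto_derive; [exact I | ring].
    - intros t Ht. apply Hnear; auto. rewrite Rminus_diag, Rabs_R0; auto. }
  assert (S2 : - uq x1 p2 + N' / rho - 2 * k <= 0).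
  { apply (max_second_order (fun p => W x1 p1 p) (fun p => - up x1 p + N' * (1 - (p1 - p) / rho) - 2 * k * (p - p0))
      p2 _ d Hd).
    - intros t Ht. apply Rabs_def2 in Ht. unfold W.
      apply (D_eq _ _ (0 - up x1 t - - N' * (1 - (p1 - t) / rho) - 2 * k * (t - p0) - 0)); [ | ring].
      apply D_minus; [apply D_minus; [apply D_minus; [apply D_minus | ] | ] | ]; try apply D_const.
      + apply H; auto. apply Rabs_le. unfold p2 in *. lra.
      + unfold g. auto_derive; [exact I | field; lra].
      + auto_derive; [exact I | ring].
    - apply (D_eq _ _ (- uq x1 p2 + N' / rho - 2 * k)); [ | field; lra].
      apply D_minus; [apply D_plus | ].
      + now apply D_opp.
      + auto_derive; [exact I | field; lra].
      + auto_derive; [exact I | ring].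
    - intros t Ht. apply Hnear; auto. rewrite Rminus_diag, Rabs_R0; auto. }
  set (z := N' / rho - 2 * k) in *.
  (* The three terms of [bnd] are calibrated to give exactly [lam] ([bnd] / [rho] - 2 [k]) = [F0] +
     [M] / [T]. *)
  assert (Hz : lam * z > F0 + M / T).
  { unfold z, k. assert (E : lam * (bnd / rho - 2 * (4 * M / (rho * rho))) = F0 + M / T).
    { unfold bnd. field. lra. }
    assert (bnd / rho < N' / rho) by (apply Rmult_lt_compat_r; [now apply Rinv_0_lt_compat | lra]). nra. }
  assert (0 <= M / T) by (apply Rdiv_le_0_compat; lra).
  assert (Hz0 : 0 < z) by nra.
  assert (Hu1 : uq x1 p1 <= - z) by (unfold z; lra).
  assert (Hu2 : z <= uq x1 p2) by (unfold z; lra).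
  rewrite E1, E2 in Sx. replace (2 * M / T) with (2 * (M / T)) in Sx by (field; lra).
  (* The second derivatives have opposite known signs at the two points, so the lower bound on [a]
     suffices and the values of [a] at the two points need not be compared. *)
  assert (a x1 p1 * uq x1 p1 <= lam * - z) by nra.
  assert (lam * z <= a x1 p2 * uq x1 p2) by nra.
  lra.
Qed.

Lemma parabolic_gradient_bound (u ux up uq a F : R -> R -> R) (x0 p0 T rho lam M F0 : R) :
  0 < T -> 0 < rho -> 0 < lam -> 0 <= M ->
  (forall x p, x0 - T <= x <= x0 -> Rabs (p - p0) <= rho ->
     cont2 u x p /\ is_derive (fun s => u s p) x (ux x p) /\
     is_derive (u x) p (up x p) /\ is_derive (up x) p (uq x p) /\
     ux x p = a x p * uq x p + F x p /\ lam <= a x p /\ Rabs (F x p) <= F0 /\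
     Rabs (u x p) <= M) ->
  Rabs (up x0 p0) <= 8 * M / rho + rho * F0 / lam + M * rho / (lam * T).
Proof.
  intros HT Hrho Hlam HM H. apply Rabs_le. split.
  - enough (- up x0 p0 <= 8 * M / rho + rho * F0 / lam + M * rho / (lam * T)) by lra.
    apply (parabolic_gradient_le (fun x p => - u x p) (fun x p => - ux x p) (fun x p => - up x p)
      (fun x p => - uq x p) a (fun x p => - F x p)); auto.
    intros x p Hx Hp. destruct (H x p Hx Hp) as [C [Dx [Dp [Dq [E [A [B D]]]]]]].
    rewrite !Rabs_Ropp. split; [now apply cont_opp | ].
    split; [exact (D_opp (fun s => u s p) x _ Dx) | ].
    split; [exact (D_opp (u x) p _ Dp) | ].
    split; [exact (D_opp (up x) p _ Dq) | ].
    split; [rewrite E; ring | now split].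
  - now apply (parabolic_gradient_le u ux up uq a F).
Qed.

(** * Stream function and von Mises coordinates *)

Section Inversion.

Variables psi U V : R -> R -> R.
Hypothesis psi_incr : forall x y1 y2, y1 < y2 -> psi x y1 < psi x y2.
Hypothesis psi_surj : forall x p, exists y, psi x y = p.
Hypothesis psi_0 : forall x, psi x 0 = 0.
Hypothesis psi_cont : forall x y, cont2 psi x y.
Hypothesis psi_y : forall x y, 0 < y -> is_derive (psi x) y (U x y).
Hypothesis U_cont : forall x y, cont2 U x y.
Hypothesis U_pos : forall x y, 0 < y -> 0 < U x y.
Hypothesis psi_x : forall x y, 0 < x -> 0 < y -> is_derive (fun s => psi s y) x (- V x y).

(** Joint continuity of [Y] comes from monotonicity: the values of [psi] at [Y] x p - eps and [Y] x
    p + eps enclose p and vary continuously with x. The x-derivative is that of the implicit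
    function theorem with psi_x = -V and psi_y = U, obtained from the mean value theorem in y. *)
Lemma stream_inverse : exists Y : R -> R -> R,
  (forall x p, psi x (Y x p) = p) /\
  (forall x y, Y x (psi x y) = y) /\
  (forall x, Y x 0 = 0) /\
  (forall x p, 0 < p -> 0 < Y x p) /\
  (forall x p1 p2, p1 < p2 -> Y x p1 < Y x p2) /\
  (forall x p, cont2 Y x p) /\
  (forall x p, 0 < p -> is_derive (Y x) p (/ U x (Y x p))) /\
  (forall x p, 0 < x -> 0 < p -> is_derive (fun s => Y s p) x (V x (Y x p) / U x (Y x p))).
Proof.
  destruct (choice (fun z y => psi (fst z) y = snd z) (fun z => psi_surj (fst z) (snd z))) as [Y0 HY0].
  set (Y := fun x p => Y0 (x, p)).
  assert (HY : forall x p, psi x (Y x p) = p) by (intros x p; apply (HY0 (x, p))).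
  clearbody Y. clear Y0 HY0.
  assert (Hlt : forall x y1 y2, psi x y1 < psi x y2 -> y1 < y2).
  { intros x y1 y2 H. apply Rnot_le_lt. intros [Hl | ->]; [ | lra].
    specialize (psi_incr x _ _ Hl). lra. }
  assert (Hinv : forall x y, Y x (psi x y) = y).
  { intros x y. destruct (Rtotal_order (Y x (psi x y)) y) as [H | [H | H]]; auto;
      specialize (psi_incr x _ _ H); rewrite HY in psi_incr; lra. }
  assert (HYm : forall x p1 p2, p1 < p2 -> Y x p1 < Y x p2).
  { intros x p1 p2 H. apply (Hlt x). now rewrite !HY. }
  assert (HYz : forall x, Y x 0 = 0).
  { intros x. rewrite <- (psi_0 x) at 1. apply Hinv. }
  assert (HYp : forall x p, 0 < p -> 0 < Y x p).
  { intros x p Hp. rewrite <- (HYz x). now apply HYm. }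
  assert (HYc : forall x p, cont2 Y x p).
  { intros x p. apply cont2_eps. intros eps He. set (y := Y x p).
    assert (A : psi x (y - eps) < p).
    { rewrite <- (HY x p). apply psi_incr. fold y. lra. }
    assert (B : p < psi x (y + eps)).
    { rewrite <- (HY x p). apply psi_incr. fold y. lra. }
    destruct (proj1 (cont2_eps _ _ _) (psi_cont x (y - eps)) ((p - psi x (y - eps)) / 2)) as [d1 [Hd1 H1]]; [lra | ].
    destruct (proj1 (cont2_eps _ _ _) (psi_cont x (y + eps)) ((psi x (y + eps) - p) / 2)) as [d2 [Hd2 H2]]; [lra | ].
    exists (Rmin (Rmin d1 d2) (Rmin ((p - psi x (y - eps)) / 2) ((psi x (y + eps) - p) / 2))).
    split; [repeat apply Rmin_glb_lt; lra | ].
    intros x' p' Hx Hp.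
    assert (L1 := Rmin_l (Rmin d1 d2) (Rmin ((p - psi x (y - eps)) / 2) ((psi x (y + eps) - p) / 2))).
    assert (L2 := Rmin_r (Rmin d1 d2) (Rmin ((p - psi x (y - eps)) / 2) ((psi x (y + eps) - p) / 2))).
    assert (L3 := Rmin_l d1 d2). assert (L4 := Rmin_r d1 d2).
    assert (L5 := Rmin_l ((p - psi x (y - eps)) / 2) ((psi x (y + eps) - p) / 2)).
    assert (L6 := Rmin_r ((p - psi x (y - eps)) / 2) ((psi x (y + eps) - p) / 2)).
    specialize (H1 x' (y - eps) ltac:(lra)). rewrite Rminus_diag, Rabs_R0 in H1.
    specialize (H2 x' (y + eps) ltac:(lra)). rewrite Rminus_diag, Rabs_R0 in H2.
    specialize (H1 Hd1). specialize (H2 Hd2). apply Rabs_def2 in H1, H2, Hp.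
    assert (y - eps < Y x' p') by (apply (Hlt x'); rewrite HY; lra).
    assert (Y x' p' < y + eps) by (apply (Hlt x'); rewrite HY; lra).
    apply Rabs_def1; lra. }
  exists Y. do 6 (split; [assumption | ]). split.
  - intros x p Hp. apply derive_eps. intros eps He. set (y := Y x p).
    assert (Hy : 0 < y) by now apply HYp.
    assert (HU := U_pos x y Hy).
    assert (Ci : continuous Rinv (U x y)).
    { apply continuous_Rinv. lra. }
    destruct (proj1 (cont_eps _ _) Ci eps He) as [d1 [Hd1 H1]].
    destruct (proj1 (derive_eps _ _ _) (psi_y x y Hy) d1 Hd1) as [d2 [Hd2 H2]].
    destruct (proj1 (cont2_eps _ _ _) (HYc x p) d2 Hd2) as [d3 [Hd3 H3]].
    exists d3; split; auto. intros p' Hne Hp'.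
    set (y' := Y x p').
    assert (Hy' : Rabs (y' - y) < d2).
    { apply H3; auto. rewrite Rminus_diag, Rabs_R0; auto. }
    assert (Hyne : y' <> y).
    { intros E. apply Hne. rewrite <- (HY x p'), <- (HY x p). fold y y'. now rewrite E. }
    specialize (H2 y' Hyne Hy'). unfold y, y' in H2. rewrite !HY in H2. fold y y' in H2.
    specialize (H1 _ H2).
    replace ((y' - y) / (p' - p)) with (/ ((p' - p) / (y' - y))); auto.
    field. split; lra.
  - intros x p Hx Hp. apply derive_eps. intros eps He. set (y := Y x p).
    assert (Hy : 0 < y) by now apply HYp.
    assert (HU := U_pos x y Hy).
    assert (Ci : cont2 (fun x y => / U x y) x y).
    { apply (cont_comp (fun z => U (fst z) (snd z)) Rinv); [apply U_cont | ].
      apply continuous_Rinv. simpl. lra. }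
    destruct (prod_close (/ U x y) (V x y) eps He) as [eta [Heta Hprod]].
    destruct (proj1 (cont2_eps _ _ _) Ci eta Heta) as [d1 [Hd1 H1]].
    destruct (proj1 (derive_eps _ _ _) (psi_x x y Hx Hy) eta Heta) as [d2 [Hd2 H2]].
    destruct (proj1 (cont2_eps _ _ _) (HYc x p) (Rmin d1 y)) as [d3 [Hd3 H3]].
    { now apply Rmin_glb_lt. }
    exists (Rmin (Rmin d1 d2) d3). split; [now repeat apply Rmin_glb_lt | ].
    intros s Hne Hs.
    assert (L1 := Rmin_l (Rmin d1 d2) d3). assert (L2 := Rmin_r (Rmin d1 d2) d3).
    assert (L3 := Rmin_l d1 d2). assert (L4 := Rmin_r d1 d2).
    assert (L5 := Rmin_l d1 y). assert (L6 := Rmin_r d1 y).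
    set (y' := Y s p).
    assert (Hy' : Rabs (y' - y) < Rmin d1 y).
    { apply H3; [lra | ]. rewrite Rminus_diag, Rabs_R0; auto. }
    destruct (mvt_abs (psi s) (U s) y y') as [xi [Hxi E]].
    { intros t Ht. apply psi_y. assert (Rabs (t - y) < y) by lra.
      apply Rabs_def2 in H. lra. }
    assert (Hxp : 0 < xi).
    { assert (Rabs (xi - y) < y) by lra. apply Rabs_def2 in H. lra. }
    assert (HUxi := U_pos s xi Hxp).
    assert (E2 : (y' - y) / (s - x) = / U s xi * - ((psi s y - psi x y) / (s - x))).
    { unfold y' in E at 1. rewrite HY in E. unfold y at 3. rewrite HY.
      assert (y' - y = (p - psi s y) / U s xi) as -> by (rewrite E; field; lra).
      field. split; lra. }
    rewrite E2. replace (V x y / U x y) with (/ U x y * V x y) by (unfold Rdiv; ring).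
    apply Hprod.
    + apply H1; lra.
    + specialize (H2 s Hne ltac:(lra)). rewrite <- Rabs_Ropp.
      replace (- (- ((psi s y - psi x y) / (s - x)) - V x y))
        with ((psi s y - psi x y) / (s - x) - - V x y) by ring. exact H2.
Qed.

End Inversion.

(** Extending by constants across both axes preserves continuity, so continuity up to the boundary
    of the quadrant becomes ordinary continuity in the plane. *)
Definition ext (F : R -> R -> R) (x y : R) : R := F (Rmax 0 x) (Rmax 0 y).

Lemma ext_eq (F : R -> R -> R) (x y : R) : 0 <= x -> 0 <= y -> ext F x y = F x y.
Proof. intros Hx Hy. unfold ext. now rewrite !Rmax_right. Qed.

Lemma Rmax_0_lip (a b : R) : Rabs (Rmax 0 a - Rmax 0 b) <= Rabs (a - b).
Proof.
  unfold Rmax, Rabs. destruct (Rle_dec 0 a); destruct (Rle_dec 0 b);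
    repeat destruct Rcase_abs; lra.
Qed.

Lemma ext_cont (F : R -> R -> R) :
  (forall X, 0 < X -> cont_on_strip X F) -> forall x y, cont2 (ext F) x y.
Proof.
  intros H x y. apply cont2_eps. intros eps He.
  assert (Hx := Rmax_l 0 x). assert (Hy := Rmax_l 0 y).
  destruct (H (Rmax 0 x + 1) ltac:(lra) (Rmax 0 x) (Rmax 0 y)) with (eps := eps) as [d [Hd H']]; auto.
  { unfold in_strip. lra. }
  exists (Rmin d 1). split; [apply Rmin_glb_lt; lra | ].
  intros x' y' Hx' Hy'. assert (L1 := Rmin_l d 1). assert (L2 := Rmin_r d 1).
  assert (A := Rmax_0_lip x' x). assert (B := Rmax_0_lip y' y).
  apply H'; try lra. assert (Rmax 0 x' - Rmax 0 x < 1).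
  { apply Rle_lt_trans with (2 := Rlt_le_trans _ _ _ Hx' L2).
    apply Rle_trans with (2 := A). apply Rle_abs. }
  unfold in_strip. generalize (Rmax_l 0 x') (Rmax_l 0 y'). lra.
Qed.

Lemma near_pos (x t : R) : 0 < x -> Rabs (t - x) < x -> 0 < t.
Proof. intros Hx H. apply Rabs_def2 in H. lra. Qed.

Lemma cont2_sec (F : R -> R -> R) (x y : R) : cont2 F x y -> continuous (F x) y.
Proof.
  intros H. apply (cont2_comp F (fun _ => x) (fun t => t)).
  - apply cont_const.
  - apply continuous_id.
  - exact H.
Qed.

Lemma uniform_on_segment (F : R -> R -> R) (x a b eps : R) :
  (forall t, cont2 F x t) -> 0 < eps -> exists d, 0 < d /\
  forall s t, Rabs (s - x) < d -> a <= t <= b -> Rabs (F s t - F x t) < eps.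
Proof.
  intros HF He.
  destruct (uniform_continuity_2d_1d' F a b x) with (eps := mkposreal eps He) as [d Hd].
  - intros t Ht. apply continuity_2d_pt_filterlim. apply HF.
  - exists d; split; [apply cond_pos | ]. intros s t Hs Ht. apply Rabs_def2 in Hs.
    assert (Hdp := cond_pos d). simpl in Hd.
    apply (Hd t x t s); try lra. now rewrite Rminus_diag, Rabs_R0.
Qed.

(** * The stream function as the primitive of [U] in y *)

Section StreamFunction.

Variables U V W : R -> R -> R.
Hypothesis U_cont : forall x y, cont2 U x y.
Hypothesis U_0 : forall x y, y <= 0 -> U x y = 0.
Hypothesis U_pos : forall x y, 0 < y -> 0 < U x y.
Hypothesis U_lim : forall x, exists y0, 0 <= y0 /\ forall y, y0 <= y -> / 2 <= U x y.
Hypothesis W_cont : forall x y, cont2 W x y.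
Hypothesis V_cont : forall x y, cont2 V x y.
Hypothesis V_0 : forall x, V x 0 = 0.
Hypothesis U_x : forall x y, 0 < x -> 0 < y -> is_derive (fun s => U s y) x (W x y).
Hypothesis V_y : forall x y, 0 < x -> 0 < y -> is_derive (V x) y (- W x y).

Let J (x y : R) : R := RInt (U x) 0 y.

Lemma J_D (x y : R) : is_derive (J x) y (U x y).
Proof.
  apply (is_derive_RInt (V := R_NormedModule) (U x) (J x) 0 y).
  - exists (mkposreal 1 Rlt_0_1). intros t _. apply (RInt_correct (V := R_CompleteNormedModule)).
    apply (ex_RInt_continuous (V := R_CompleteNormedModule)). intros z _. apply cont2_sec, U_cont.
  - apply cont2_sec, U_cont.
Qed.

Lemma J_0 (x : R) : J x 0 = 0.
Proof. exact (RInt_point (V := R_CompleteNormedModule) 0 (U x)). Qed.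

Lemma U_ge0 (x y : R) : 0 <= U x y.
Proof. destruct (Rle_dec y 0); [rewrite U_0; lra | left; apply U_pos; lra]. Qed.

Lemma J_cont (x y : R) : continuous (J x) y.
Proof. apply (cont_of_derive _ _ (U x y)), J_D. Qed.

Lemma J_nondecr (x y1 y2 : R) : y1 <= y2 -> J x y1 <= J x y2.
Proof.
  intros H. apply (nondecr_of_derive (J x) (U x)); auto.
  - intros; apply J_D.
  - intros; apply U_ge0.
  - intros; apply J_cont.
Qed.

Lemma J_incr (x y1 y2 : R) : 0 <= y1 -> y1 < y2 -> J x y1 < J x y2.
Proof.
  intros H0 H. apply (incr_of_derive (J x) (U x)); auto.
  - intros; apply J_D.
  - intros; apply U_pos; lra.
  - intros; apply J_cont.
Qed.

(* Adding [min(y, 0)] makes [psi x] an increasing bijection of the whole line, so that its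
   inverse is continuous up to the boundary. *)
Definition psi (x y : R) : R := J x y + Rmin y 0.

Lemma psi_J (x y : R) : 0 <= y -> psi x y = J x y.
Proof. intros H. unfold psi. rewrite Rmin_right by lra. ring. Qed.

Lemma psi_at_0 (x : R) : psi x 0 = 0.
Proof. rewrite psi_J by lra. apply J_0. Qed.

Lemma psi_strict (x y1 y2 : R) : y1 < y2 -> psi x y1 < psi x y2.
Proof.
  intros H. unfold psi. destruct (Rlt_dec y1 0) as [H0 | H0].
  - generalize (J_nondecr x y1 y2 ltac:(lra)). rewrite (Rmin_left y1) by lra.
    assert (y1 < Rmin y2 0) by (apply Rmin_glb_lt; lra). lra.
  - generalize (J_incr x y1 y2 ltac:(lra) H). rewrite !Rmin_right by lra. lra.
Qed.

Lemma psi_sec_cont (x y : R) : continuous (psi x) y.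
Proof.
  unfold psi. apply cont_plus; [apply J_cont | ]. apply cont_min; [apply continuous_id | apply cont_const].
Qed.

Lemma psi_onto (x p : R) : exists y, psi x y = p.
Proof.
  destruct (U_lim x) as [y0 [Hy0 H0]].
  set (y1 := y0 + 2 * Rabs p + 1). set (y2 := Rmin p 0).
  assert (Hp := Rle_abs p). assert (Hp0 := Rabs_pos p).
  assert (A : p <= psi x y1).
  { rewrite psi_J by (unfold y1; lra).
    assert (J x y0 - / 2 * y0 <= J x y1 - / 2 * y1).
    { apply (nondecr_of_derive (fun t => J x t - / 2 * t) (fun t => U x t - / 2)); [unfold y1; lra | | | ].
      - intros t _. apply D_minus; [apply J_D | ].
        auto_derive; [exact I | ring].
      - intros t Ht. specialize (H0 t ltac:(lra)). lra.
      - intros t _. apply cont_minus; [apply J_cont | ]. apply cont_mult; [apply cont_const | apply continuous_id]. }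
    generalize (J_nondecr x 0 y0 Hy0). rewrite J_0. unfold y1 in *. lra. }
  assert (B : psi x y2 <= p).
  { unfold psi. generalize (J_nondecr x y2 0 (Rmin_r _ _)). rewrite J_0.
    rewrite (Rmin_left y2) by apply Rmin_r. generalize (Rmin_l p 0). fold y2. lra. }
  assert (Hc : continuity (psi x)).
  { intros t. apply continuity_pt_filterlim, psi_sec_cont. }
  destruct (IVT_gen (psi x) y2 y1 p Hc) as [y [_ Hy]].
  - split.
    + apply Rle_trans with (psi x y2); auto. apply Rmin_l.
    + apply Rle_trans with (psi x y1); auto. apply Rmax_r.
  - now exists y.
Qed.

Lemma psi_cont_x (x y eps : R) : 0 < eps -> exists d, 0 < d /\
  forall s, Rabs (s - x) < d -> Rabs (psi s y - psi x y) < eps.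
Proof.
  intros He. set (r := Rabs y + 1). assert (Hr : 0 < r) by (unfold r; generalize (Rabs_pos y); lra).
  destruct (uniform_on_segment U x (- r) r (eps / (2 * r))) as [d [Hd H]].
  - intros t; apply U_cont.
  - apply Rdiv_lt_0_compat; lra.
  - exists d; split; auto. intros s Hs. unfold psi.
    replace (J s y + Rmin y 0 - (J x y + Rmin y 0)) with ((J s y - J x y) - (J s 0 - J x 0))
      by (rewrite !J_0; ring).
    apply Rle_lt_trans with (eps / (2 * r) * Rabs (y - 0)).
    + assert (Hy : - Rabs y <= y <= Rabs y) by (generalize (Rle_abs y) (Rle_abs (- y)); rewrite Rabs_Ropp; lra).
      apply (lipschitz_of_derive (fun t => J s t - J x t) (fun t => U s t - U x t) (- r) r); try (unfold r; lra).
      * intros t _. apply D_minus; apply J_D.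
      * intros t Ht. left; now apply H.
    + rewrite Rminus_0_r. apply Rle_lt_trans with (eps / (2 * r) * r).
      * apply Rmult_le_compat_l; [apply Rdiv_le_0_compat; lra | unfold r; lra].
      * replace (eps / (2 * r) * r) with (eps / 2) by (field; lra). lra.
Qed.

(** Monotonicity in y traps [psi] x' y' between its values on two horizontal lines, where continuity
    in x alone is enough. *)
Lemma psi_continuous (x y : R) : cont2 psi x y.
Proof.
  apply cont2_eps. intros eps He.
  destruct (proj1 (cont_eps _ _) (psi_sec_cont x y) (eps / 2) ltac:(lra)) as [d [Hd H]].
  destruct (psi_cont_x x (y - d / 2) (eps / 2) ltac:(lra)) as [d1 [Hd1 H1]].
  destruct (psi_cont_x x (y + d / 2) (eps / 2) ltac:(lra)) as [d2 [Hd2 H2]].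
  exists (Rmin (Rmin d1 d2) (d / 2)). split; [repeat apply Rmin_glb_lt; lra | ].
  intros x' y' Hx Hy.
  assert (L1 := Rmin_l (Rmin d1 d2) (d / 2)). assert (L2 := Rmin_r (Rmin d1 d2) (d / 2)).
  assert (L3 := Rmin_l d1 d2). assert (L4 := Rmin_r d1 d2).
  specialize (H1 x' ltac:(lra)). specialize (H2 x' ltac:(lra)).
  assert (E1 := H (y - d / 2)). assert (E2 := H (y + d / 2)).
  rewrite Rabs_left in E1 by lra. rewrite Rabs_right in E2 by lra.
  specialize (E1 ltac:(lra)). specialize (E2 ltac:(lra)).
  apply Rabs_def2 in H1, H2, E1, E2, Hy.
  assert (psi x' (y - d / 2) < psi x' y') by (apply psi_strict; lra).
  assert (psi x' y' < psi x' (y + d / 2)) by (apply psi_strict; lra).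
  apply Rabs_def1; lra.
Qed.

Lemma psi_Dy (x y : R) : 0 < y -> is_derive (psi x) y (U x y).
Proof.
  intros Hy. apply (is_derive_ext_loc (J x)).
  - exists (mkposreal y Hy). intros t Ht. symmetry. apply psi_J. left. now apply (near_pos y).
  - apply J_D.
Qed.

(** The function D(t) = J(s,t) - J(x,t) + (s - x) V(x,t) vanishes at t = 0, and by V_y = -W its
    derivative is U(s,t) - U(x,t) - (s - x) W(x,t), which is o(s - x) uniformly on the open segment
    from 0 to y. This replaces differentiation under the integral. *)
Lemma psi_Dx (x y : R) : 0 < x -> 0 < y -> is_derive (fun s => psi s y) x (- V x y).
Proof.
  intros Hx Hy. apply derive_eps. intros eps He.
  destruct (uniform_on_segment W x 0 y (eps / (2 * y))) as [d [Hd H]].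
  - intros t; apply W_cont.
  - apply Rdiv_lt_0_compat; lra.
  - exists (Rmin d x). split; [now apply Rmin_glb_lt | ]. intros s Hne Hs.
    assert (L1 := Rmin_l d x). assert (L2 := Rmin_r d x).
    rewrite !psi_J by lra.
    set (D := fun t => J s t - J x t + (s - x) * V x t).
    assert (HD : Rabs (D y) <= eps / 2 * Rabs (s - x)).
    { destruct (mvt D (fun t => U s t - U x t + (s - x) * - W x t) 0 y Hy) as [c [Hc E]].
      - intros t Ht. unfold D. apply D_plus; [apply D_minus; apply J_D | ].
        apply (D_eq _ _ (0 * V x t + (s - x) * - W x t)); [ | ring].
        apply (D_mult (fun _ => s - x) (V x)); [apply D_const | now apply V_y].
      - intros t _. unfold D. apply cont_plus; [apply cont_minus; apply J_cont | ].
        apply cont_mult; [apply cont_const | apply cont2_sec, V_cont].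
      - assert (D 0 = 0) as E0 by (unfold D; rewrite !J_0, V_0; ring).
        rewrite E0, !Rminus_0_r in E. rewrite E.
        destruct (mvt_abs (fun r => U r c) (fun r => W r c) x s) as [xi [Hxi Ex]].
        { intros t Ht. apply U_x; [apply (near_pos x); lra | lra]. }
        rewrite Ex. replace ((W xi c * (s - x) + (s - x) * - W x c) * y)
          with ((W xi c - W x c) * y * (s - x)) by ring.
        rewrite Rabs_mult. apply Rmult_le_compat_r; [apply Rabs_pos | ].
        rewrite Rabs_mult, (Rabs_right y) by lra.
        specialize (H xi c ltac:(lra) ltac:(lra)).
        replace (eps / 2) with (eps / (2 * y) * y) by (field; lra).
        apply Rmult_le_compat_r; lra. }
    replace ((J s y - J x y) / (s - x) - - V x y) with (D y / (s - x)) by (unfold D; field; lra).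
    unfold Rdiv. rewrite Rabs_mult, Rabs_inv.
    assert (0 < Rabs (s - x)) by (apply Rabs_pos_lt; lra).
    apply Rmult_lt_reg_r with (Rabs (s - x)); auto.
    rewrite Rmult_assoc, Rinv_l, Rmult_1_r by lra. nra.
Qed.

End StreamFunction.

(* The Prandtl system for data extended to the whole plane; [W], [P], [Q] stand for
   [u_x], [u_y], [u_yy]. *)
Record prandtl (U V W P Q : R -> R -> R) : Prop := {
  pr_U_cont : forall x y, cont2 U x y;
  pr_V_cont : forall x y, cont2 V x y;
  pr_W_cont : forall x y, cont2 W x y;
  pr_P_cont : forall x y, cont2 P x y;
  pr_Q_cont : forall x y, cont2 Q x y;
  pr_U_0 : forall x y, y <= 0 -> U x y = 0;
  pr_V_0 : forall x, V x 0 = 0;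
  pr_U_pos : forall x y, 0 < y -> 0 < U x y;
  pr_U_lim : forall x, exists y0, 0 <= y0 /\ forall y, y0 <= y -> / 2 <= U x y;
  pr_U_x : forall x y, 0 < x -> 0 < y -> is_derive (fun s => U s y) x (W x y);
  pr_U_y : forall x y, 0 < x -> 0 < y -> is_derive (U x) y (P x y);
  pr_P_y : forall x y, 0 < x -> 0 < y -> is_derive (P x) y (Q x y);
  pr_V_y : forall x y, 0 < x -> 0 < y -> is_derive (V x) y (- W x y);
  pr_eq : forall x y, 0 < x -> 0 < y -> U x y * W x y + V x y * P x y - Q x y = 0
}.

Record von_mises (U V psi Y : R -> R -> R) : Prop := {
  vm_psi_Y : forall x p, psi x (Y x p) = p;
  vm_Y_psi : forall x y, Y x (psi x y) = y;
  vm_psi_0 : forall x, psi x 0 = 0;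
  vm_Y_0 : forall x, Y x 0 = 0;
  vm_psi_lt : forall x y1 y2, y1 < y2 -> psi x y1 < psi x y2;
  vm_Y_lt : forall x p1 p2, p1 < p2 -> Y x p1 < Y x p2;
  vm_psi_cont : forall x y, cont2 psi x y;
  vm_Y_cont : forall x p, cont2 Y x p;
  vm_psi_y : forall x y, 0 < y -> is_derive (psi x) y (U x y);
  vm_psi_x : forall x y, 0 < x -> 0 < y -> is_derive (fun s => psi s y) x (- V x y);
  vm_Y_p : forall x p, 0 < p -> is_derive (Y x) p (/ U x (Y x p));
  vm_Y_x : forall x p, 0 < x -> 0 < p -> is_derive (fun s => Y s p) x (V x (Y x p) / U x (Y x p))
}.

Lemma von_mises_exists (U V W P Q : R -> R -> R) :
  prandtl U V W P Q -> exists psi Y, von_mises U V psi Y.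
Proof.
  intros [HU HV HW HP HQ U0 V0 Upos Ulim Ux Uy Py Vy Heq].
  exists (psi U).
  assert (Hlt := psi_strict U HU U0 Upos).
  assert (Hc := psi_continuous U HU U0 Upos).
  assert (Hy := psi_Dy U HU).
  assert (Hx := psi_Dx U V W HU HW HV V0 Ux Vy).
  destruct (stream_inverse (psi U) U V Hlt (psi_onto U HU U0 Upos Ulim) (psi_at_0 U)
    Hc Hy HU Upos Hx) as [Y [A [B [C [D [E [F [G H]]]]]]]].
  exists Y. constructor; auto. exact (psi_at_0 U).
Qed.

(** * The equation for phi = u^2 along streamlines *)

Section VonMises.

Variables U V W P Q psi Y : R -> R -> R.
Hypothesis HP : prandtl U V W P Q.
Hypothesis HV : von_mises U V psi Y.

Lemma vm_Y_pos (x p : R) : 0 < p -> 0 < Y x p.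
Proof. intros Hp. rewrite <- (vm_Y_0 _ _ _ _ HV x). now apply (vm_Y_lt _ _ _ _ HV). Qed.

Lemma vm_Y_ge0 (x p : R) : 0 <= p -> 0 <= Y x p.
Proof.
  intros [Hp | <-]; [left; now apply vm_Y_pos | ]. rewrite (vm_Y_0 _ _ _ _ HV). lra.
Qed.

Lemma vm_psi_pos (x y : R) : 0 < y -> 0 < psi x y.
Proof. intros Hp. rewrite <- (vm_psi_0 _ _ _ _ HV x). now apply (vm_psi_lt _ _ _ _ HV). Qed.

Lemma vm_psi_ge0 (x y : R) : 0 <= y -> 0 <= psi x y.
Proof.
  intros [Hp | <-]; [left; now apply vm_psi_pos | ]. rewrite (vm_psi_0 _ _ _ _ HV). lra.
Qed.

Lemma U_nonneg (x y : R) : 0 <= U x y.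
Proof.
  destruct (Rle_dec y 0) as [H | H].
  - rewrite (pr_U_0 _ _ _ _ _ HP); lra.
  - left. apply (pr_U_pos _ _ _ _ _ HP). lra.
Qed.

(** Along streamlines phi_x = 2 (u u_x + v u_y), which is 2 u_yy by the momentum equation, phi_psi =
    2 u_y and phi_psipsi = 2 u_yy / u. Only the last carries the factor 1 / u, singular at the
    wall. *)
Definition vm_phi (x p : R) : R := U x (Y x p) * U x (Y x p).
Definition vm_phi_x (x p : R) : R := 2 * Q x (Y x p).
Definition vm_phi_p (x p : R) : R := 2 * P x (Y x p).
Definition vm_phi_q (x p : R) : R := 2 * Q x (Y x p) / U x (Y x p).

Lemma sqrt_phi (x p : R) : sqrt (vm_phi x p) = U x (Y x p).
Proof. apply sqrt_square, U_nonneg. Qed.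

Lemma comp_Y_cont (F : R -> R -> R) : (forall x y, cont2 F x y) ->
  forall x p, cont2 (fun x p => F x (Y x p)) x p.
Proof.
  intros HF x p. apply (cont2_comp F fst (fun z => Y (fst z) (snd z))).
  - apply continuous_fst.
  - apply (vm_Y_cont _ _ _ _ HV).
  - apply HF.
Qed.

Lemma phi_cont (x p : R) : cont2 vm_phi x p.
Proof. apply cont_mult; apply (comp_Y_cont U), (pr_U_cont _ _ _ _ _ HP). Qed.

Lemma phi_x_cont (x p : R) : cont2 vm_phi_x x p.
Proof. apply cont_mult; [apply cont_const | apply (comp_Y_cont Q), (pr_Q_cont _ _ _ _ _ HP)]. Qed.

Lemma phi_p_cont (x p : R) : cont2 vm_phi_p x p.
Proof. apply cont_mult; [apply cont_const | apply (comp_Y_cont P), (pr_P_cont _ _ _ _ _ HP)]. Qed.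

Lemma phi_q_cont (x p : R) : 0 < p -> cont2 vm_phi_q x p.
Proof.
  intros Hp. apply cont_div.
  - simpl. apply Rgt_not_eq, (pr_U_pos _ _ _ _ _ HP), vm_Y_pos, Hp.
  - apply (phi_x_cont x p).
  - apply (comp_Y_cont U), (pr_U_cont _ _ _ _ _ HP).
Qed.

Lemma phi_pos (x p : R) : 0 < p -> 0 < vm_phi x p.
Proof.
  intros Hp. assert (H := pr_U_pos _ _ _ _ _ HP x (Y x p) (vm_Y_pos x p Hp)). unfold vm_phi. nra.
Qed.

Lemma phi_at_0 (x : R) : vm_phi x 0 = 0.
Proof. unfold vm_phi. rewrite (vm_Y_0 _ _ _ _ HV), (pr_U_0 _ _ _ _ _ HP) by lra. ring. Qed.

Lemma phi_Dx (x p : R) : 0 < x -> 0 < p -> is_derive (fun s => vm_phi s p) x (vm_phi_x x p).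
Proof.
  intros Hx Hp. assert (Hy := vm_Y_pos x p Hp).
  assert (HU := pr_U_pos _ _ _ _ _ HP x (Y x p) Hy).
  assert (D : is_derive (fun s => U s (Y s p)) x (W x (Y x p) + P x (Y x p) * (V x (Y x p) / U x (Y x p)))).
  { apply (derive_along_curve U P (fun s => Y s p) x (Y x p) _ _ (Rmin x (Y x p))); auto.
    - now apply Rmin_glb_lt.
    - now apply (pr_U_x _ _ _ _ _ HP).
    - intros t y Ht Hy'. assert (L1 := Rmin_l x (Y x p)). assert (L2 := Rmin_r x (Y x p)).
      apply (pr_U_y _ _ _ _ _ HP); [apply (near_pos x) | apply (near_pos (Y x p))]; lra.
    - apply (pr_P_cont _ _ _ _ _ HP).
    - now apply (vm_Y_x _ _ _ _ HV). }
  apply (D_eq _ _ _ (vm_phi_x x p) (D_mult _ _ _ _ _ D D)).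
  unfold vm_phi_x. generalize (pr_eq _ _ _ _ _ HP x (Y x p) Hx Hy); intros E.
  assert (Q x (Y x p) = U x (Y x p) * W x (Y x p) + V x (Y x p) * P x (Y x p)) as -> by lra.
  field. lra.
Qed.

Lemma phi_Dp (x p : R) : 0 < x -> 0 < p -> is_derive (vm_phi x) p (vm_phi_p x p).
Proof.
  intros Hx Hp. assert (Hy := vm_Y_pos x p Hp).
  assert (HU := pr_U_pos _ _ _ _ _ HP x (Y x p) Hy).
  assert (D : is_derive (fun s => U x (Y x s)) p (P x (Y x p) * / U x (Y x p))).
  { apply (D_comp (U x) (Y x)); [now apply (pr_U_y _ _ _ _ _ HP) | now apply (vm_Y_p _ _ _ _ HV)]. }
  apply (D_eq _ _ _ (vm_phi_p x p) (D_mult _ _ _ _ _ D D)).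
  unfold vm_phi_p. field. lra.
Qed.

Lemma phi_Dq (x p : R) : 0 < x -> 0 < p -> is_derive (vm_phi_p x) p (vm_phi_q x p).
Proof.
  intros Hx Hp. assert (Hy := vm_Y_pos x p Hp).
  assert (D : is_derive (fun s => P x (Y x s)) p (Q x (Y x p) * / U x (Y x p))).
  { apply (D_comp (P x) (Y x)); [now apply (pr_P_y _ _ _ _ _ HP) | now apply (vm_Y_p _ _ _ _ HV)]. }
  apply (D_eq _ _ _ (vm_phi_q x p) (D_mult (fun _ => 2) _ _ _ _ (D_const 2 p) D)).
  unfold vm_phi_q, Rdiv. ring.
Qed.

Lemma phi_eq (x p : R) : 0 < p -> vm_phi_x x p = sqrt (vm_phi x p) * vm_phi_q x p.
Proof.
  intros Hp. rewrite sqrt_phi. unfold vm_phi_x, vm_phi_q. field.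
  apply Rgt_not_eq, (pr_U_pos _ _ _ _ _ HP), vm_Y_pos, Hp.
Qed.

Lemma phi_regular (X : R) : vm_regular X vm_phi vm_phi_x vm_phi_p vm_phi_q.
Proof.
  split; [intros x p _ _; apply phi_cont | ].
  split; [intros x p Hx Hp; now apply phi_Dx | ].
  split; [intros x p Hx Hp; now apply phi_Dp | ].
  split; [intros x p Hx Hp; now apply phi_Dq | ].
  intros x p _ Hp; now apply phi_pos.
Qed.

End VonMises.

(** * The Blasius profile *)

Lemma lim_infty_eps (f : R -> R) (l eps : R) :
  is_lim f p_infty l -> 0 < eps -> exists M, 0 <= M /\ forall x, M <= x -> Rabs (f x - l) < eps.
Proof.
  intros H He. apply is_lim_spec in H. destruct (H (mkposreal eps He)) as [M HM].
  exists (Rabs M + 1). generalize (Rabs_pos M) (Rle_abs M); intros.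
  split; [lra | ]. intros x Hx. apply HM. lra.
Qed.

Lemma incr_below_limit (f : R -> R) (l a : R) :
  is_lim f p_infty l -> (forall x y, a <= x -> x <= y -> f x <= f y) -> forall x, a <= x -> f x <= l.
Proof.
  intros H Hm x Hx. apply Rnot_lt_le. intros Hl.
  destruct (lim_infty_eps f l (f x - l) H ltac:(lra)) as [M [HM H']].
  specialize (H' (Rmax x M) (Rmax_r _ _)). specialize (Hm x (Rmax x M) Hx (Rmax_l _ _)).
  apply Rabs_def2 in H'. lra.
Qed.

(** On [0, 1] a concave function vanishing at 0 lies above its chord; beyond 1 monotonicity takes
    over. *)
Lemma concave_ge_min (h : R -> R) (h' : R -> R) :
  (forall s, 0 <= s -> continuous h s) -> (forall s, 0 < s -> is_derive h s (h' s)) ->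
  h 0 = 0 -> (forall s, 0 < s -> 0 <= h' s) ->
  (forall s t, 0 < s -> s <= t -> h' t <= h' s) ->
  forall s, 0 <= s -> h 1 * Rmin s 1 <= h s.
Proof.
  intros Hc Hd H0 Hp Hm s Hs. destruct (Rle_dec s 1) as [H1 | H1].
  - rewrite Rmin_left by lra. destruct (Req_dec s 0) as [-> | Hs0]; [lra | ].
    destruct (Req_dec s 1) as [-> | Hs1]; [lra | ].
    destruct (mvt h h' 0 s) as [c1 [Hc1 E1]]; [lra | intros; apply Hd; lra | intros; apply Hc; lra | ].
    destruct (mvt h h' s 1) as [c2 [Hc2 E2]]; [lra | intros; apply Hd; lra | intros; apply Hc; lra | ].
    specialize (Hm c1 c2 ltac:(lra) ltac:(lra)). rewrite H0 in E1.
    assert (0 <= (h' c1 - h' c2) * (s * (1 - s))) by (apply Rmult_le_pos; nra).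
    assert (h 1 = h s + h' c2 * (1 - s)) as -> by lra. assert (h s = h' c1 * s) as -> by lra. nra.
  - rewrite Rmin_right by lra.
    rewrite Rmult_1_r. apply (nondecr_of_derive h h'); [lra | | | ].
    + intros; apply Hd; lra.
    + intros; apply Hp; lra.
    + intros; apply Hc; lra.
Qed.

Lemma exp_le (a b : R) : a <= b -> exp a <= exp b.
Proof. intros [H | ->]; [left; now apply exp_increasing | lra]. Qed.

Lemma gauss_absorb_upper (a b z : R) : 0 < a ->
  exp (- a * z ^ 2 - b * z) <= exp (b ^ 2 / (2 * a)) * exp (- (a / 2) * z ^ 2).
Proof.
  intros Ha. rewrite <- exp_plus. apply exp_le.
  assert (E : b ^ 2 / (2 * a) + - (a / 2) * z ^ 2 - (- a * z ^ 2 - b * z) = / (2 * a) * (a * z + b) ^ 2).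
  { field. lra. }
  assert (0 <= / (2 * a) * (a * z + b) ^ 2).
  { apply Rmult_le_pos; [left; apply Rinv_0_lt_compat; lra | apply pow2_ge_0]. }
  lra.
Qed.

Section Blasius.

Variables (f f1 f2 f3 : R -> R) (C1 C2 : R).
Hypothesis HB : blasius f f1 f2 f3 C1 C2.

Lemma bl_Df (z : R) : 0 <= z -> is_derive f z (f1 z).
Proof. destruct HB as [H _]. apply H. Qed.
Lemma bl_Df1 (z : R) : 0 <= z -> is_derive f1 z (f2 z).
Proof. destruct HB as [_ [H _]]. apply H. Qed.
Lemma bl_Df2 (z : R) : 0 <= z -> is_derive f2 z (f3 z).
Proof. destruct HB as [_ [_ [H _]]]. apply H. Qed.
Lemma bl_ode (z : R) : 0 <= z -> f3 z = - (/ 2 * f z * f2 z).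
Proof. destruct HB as [_ [_ [_ [H _]]]]. intros Hz. specialize (H z Hz). lra. Qed.
Lemma bl_f0 : f 0 = 0.
Proof. now destruct HB as [_ [_ [_ [_ [H _]]]]]. Qed.
Lemma bl_f10 : f1 0 = 0.
Proof. now destruct HB as [_ [_ [_ [_ [_ [H _]]]]]]. Qed.
Lemma bl_lim : is_lim f1 p_infty 1.
Proof. now destruct HB as [_ [_ [_ [_ [_ [_ [H _]]]]]]]. Qed.
Lemma bl_C1 : 0 < C1.
Proof. now destruct HB as [_ [_ [_ [_ [_ [_ [_ [H _]]]]]]]]. Qed.

Lemma bl_cf (z : R) : 0 <= z -> continuous f z.
Proof. intros Hz. exact (cont_of_derive _ _ _ (bl_Df z Hz)). Qed.
Lemma bl_cf1 (z : R) : 0 <= z -> continuous f1 z.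
Proof. intros Hz. exact (cont_of_derive _ _ _ (bl_Df1 z Hz)). Qed.
Lemma bl_cf2 (z : R) : 0 <= z -> continuous f2 z.
Proof. intros Hz. exact (cont_of_derive _ _ _ (bl_Df2 z Hz)). Qed.

(* [f2' = - f f2 / 2] is linear, so a zero of [f2] would propagate to infinity, where the
   asymptotics makes [f2] positive. *)
Lemma bl_f2_pos (z : R) : 0 <= z -> 0 < f2 z.
Proof.
  assert (Hlarge : exists Z, 0 <= Z /\ forall z, Z <= z -> 0 < f2 z).
  { destruct HB as [_ [_ [_ [_ [_ [_ [_ [_ [_ [c1 [c2 [Z [H1 [H2 H]]]]]]]]]]]]]].
    exists (Rmax 0 Z). split; [apply Rmax_l | ]. intros t Ht.
    specialize (H t (Rle_trans _ _ _ (Rmax_r _ _) Ht)). generalize (exp_pos (- C1 * t ^ 2 - C2 * t)). nra. }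
  destruct Hlarge as [Z [HZ Hlarge]].
  assert (Hne : forall t, 0 <= t -> f2 t <> 0).
  { intros t Ht E. set (b := Rmax t Z + 1).
    assert (Hb : t < b /\ Z < b) by (unfold b; generalize (Rmax_l t Z) (Rmax_r t Z); lra).
    destruct (continuity_ab_maj f t b) as [m [Hm _]]; [lra | | ].
    { intros c Hc. apply continuity_pt_filterlim, bl_cf. lra. }
    destruct (continuity_ab_maj (fun s => - f s) t b) as [m' [Hm' _]]; [lra | | ].
    { intros c Hc. apply continuity_pt_filterlim, cont_opp, bl_cf. lra. }
    set (K := - f m').
    assert (Hdec : f2 b * f2 b * exp (- (K * b)) <= f2 t * f2 t * exp (- (K * t))).
    { enough (- (f2 t * f2 t * exp (- (K * t))) <= - (f2 b * f2 b * exp (- (K * b)))) by lra.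
      apply (nondecr_of_derive (fun s => - (f2 s * f2 s * exp (- (K * s))))
        (fun s => (f s + K) * (f2 s * f2 s) * exp (- (K * s)))); [lra | | | ].
      - intros s Hs.
        assert (D1 := bl_Df2 s ltac:(lra)).
        assert (D2 : is_derive (fun s => exp (- (K * s))) s (- K * exp (- (K * s)))).
        { auto_derive; [exact I | ring]. }
        apply (D_eq _ _ _ _ (D_opp _ _ _ (D_mult _ _ _ _ _ (D_mult _ _ _ _ _ D1 D1) D2))).
        rewrite (bl_ode s) by lra. field.
      - intros s Hs. specialize (Hm' s ltac:(lra)). unfold K.
        apply Rmult_le_pos; [ | left; apply exp_pos]. apply Rmult_le_pos; [lra | exact (Rle_0_sqr (f2 s))].
      - intros s Hs. assert (C := bl_cf2 s ltac:(lra)). cont_tac. }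
    rewrite E in Hdec. specialize (Hlarge b ltac:(lra)).
    assert (0 < f2 b * f2 b * exp (- (K * b))).
    { apply Rmult_lt_0_compat; [nra | apply exp_pos]. }
    lra. }
  intros Hz. apply Rnot_le_lt. intros Hle.
  set (b := Rmax z Z).
  assert (Hb : z <= b /\ Z <= b) by (split; [apply Rmax_l | apply Rmax_r]).
  destruct (Req_dec z b) as [E | E].
  { rewrite E in Hle. specialize (Hlarge b ltac:(lra)). lra. }
  destruct (IVT_interv f2 z b) as [c [Hc Ec]].
  - intros s Hs. apply continuity_pt_filterlim, bl_cf2. lra.
  - lra.
  - generalize (Hne z Hz). lra.
  - apply Hlarge; lra.
  - apply (Hne c); [lra | exact Ec].
Qed.

Lemma bl_f1_incr (a b : R) : 0 <= a -> a < b -> f1 a < f1 b.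
Proof.
  intros Ha Hab. apply (incr_of_derive f1 f2); auto.
  - intros; apply bl_Df1; lra.
  - intros; apply bl_f2_pos; lra.
  - intros; apply bl_cf1; lra.
Qed.

Lemma bl_f1_le (a b : R) : 0 <= a -> a <= b -> f1 a <= f1 b.
Proof. intros Ha [H | ->]; [left; now apply bl_f1_incr | lra]. Qed.

Lemma bl_f1_pos (z : R) : 0 < z -> 0 < f1 z.
Proof. intros Hz. rewrite <- bl_f10. apply bl_f1_incr; lra. Qed.

Lemma bl_f1_lt1 (z : R) : 0 <= z -> f1 z < 1.
Proof.
  intros Hz. apply Rlt_le_trans with (f1 (z + 1)); [apply bl_f1_incr; lra | ].
  apply (incr_below_limit f1 1 0 bl_lim); [ | lra]. intros; now apply bl_f1_le.
Qed.

Lemma bl_f_incr (a b : R) : 0 <= a -> a < b -> f a < f b.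
Proof.
  intros Ha Hab. apply (incr_of_derive f f1); auto.
  - intros; apply bl_Df; lra.
  - intros; apply bl_f1_pos; lra.
  - intros; apply bl_cf; lra.
Qed.

Lemma bl_f_ge0 (z : R) : 0 <= z -> 0 <= f z.
Proof.
  intros [Hz | <-]; [ | rewrite bl_f0; lra]. left. rewrite <- bl_f0. apply bl_f_incr; lra.
Qed.

Lemma bl_f_le (z : R) : 0 <= z -> f z <= z.
Proof.
  intros Hz. enough (0 - f 0 <= z - f z) by (rewrite bl_f0 in *; lra).
  apply (nondecr_of_derive (fun t => t - f t) (fun t => 1 - f1 t)); auto.
  - intros t Ht. apply D_minus; [apply D_id | apply bl_Df; lra].
  - intros t Ht. generalize (bl_f1_lt1 t ltac:(lra)). lra.
  - intros t Ht. apply cont_minus; [apply continuous_id | apply bl_cf; lra].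
Qed.

Lemma bl_f_ge_linear (z : R) : 0 <= z -> f1 1 * (z - 1) <= f z.
Proof.
  intros Hz. destruct (Rle_dec z 1) as [H | H].
  { generalize (bl_f_ge0 z Hz) (bl_f1_pos 1 ltac:(lra)). nra. }
  enough (f 1 - f1 1 * 1 <= f z - f1 1 * z) by (generalize (bl_f_ge0 1 ltac:(lra)); lra).
  apply (nondecr_of_derive (fun t => f t - f1 1 * t) (fun t => f1 t - f1 1)); [lra | | | ].
  - intros t Ht. apply D_minus; [apply bl_Df; lra | ]. auto_derive; [exact I | ring].
  - intros t Ht. generalize (bl_f1_le 1 t ltac:(lra) ltac:(lra)). lra.
  - intros t Ht. assert (C := bl_cf t ltac:(lra)). cont_tac.
Qed.

Lemma bl_f3_le (z : R) : 0 <= z -> f3 z <= 0.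
Proof.
  intros Hz. rewrite bl_ode by auto. generalize (bl_f_ge0 z Hz) (bl_f2_pos z Hz). nra.
Qed.

Lemma bl_f2_decr (a b : R) : 0 <= a -> a <= b -> f2 b <= f2 a.
Proof.
  intros Ha Hab. enough (- f2 a <= - f2 b) by lra.
  apply (nondecr_of_derive (fun t => - f2 t) (fun t => - f3 t)); auto.
  - intros; apply D_opp, bl_Df2; lra.
  - intros t Ht. generalize (bl_f3_le t ltac:(lra)). lra.
  - intros; apply cont_opp, bl_cf2; lra.
Qed.

Lemma bl_f1_ge_min (z : R) : 0 <= z -> f1 1 * Rmin z 1 <= f1 z.
Proof.
  apply (concave_ge_min f1 f2).
  - apply bl_cf1.
  - intros; apply bl_Df1; lra.
  - apply bl_f10.
  - intros; left; apply bl_f2_pos; lra.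
  - intros; apply bl_f2_decr; lra.
Qed.

Lemma bl_f1_diff (a b : R) : 0 <= a -> a <= b -> f1 b - f1 a <= f2 a * (b - a).
Proof.
  intros Ha [H | ->]; [ | lra].
  destruct (mvt f1 f2 a b H) as [c [Hc E]].
  - intros; apply bl_Df1; lra.
  - intros; apply bl_cf1; lra.
  - rewrite E. apply Rmult_le_compat_r; [lra | apply bl_f2_decr; lra].
Qed.

Lemma bl_upper : exists K c, 0 < K /\ 0 < c /\ forall z, 0 <= z ->
  1 - f1 z <= K * exp (- c * z ^ 2) /\ f2 z <= K * exp (- c * z ^ 2).
Proof.
  assert (HC := bl_C1).
  assert (H : exists Z k, 1 <= Z /\ 0 < k /\ forall z, Z <= z ->
    1 - f1 z <= k * exp (- (C1 / 2) * z ^ 2) /\ f2 z <= k * exp (- (C1 / 2) * z ^ 2)).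
  { destruct HB as [_ [_ [_ [_ [_ [_ [_ [_ [[a1 [a2 [Z1 [_ [Ha Hb]]]]] [c1 [c2 [Z2 [_ [Hc Hd]]]]]]]]]]]]]].
    set (e := exp (C2 ^ 2 / (2 * C1))). assert (He : 0 < e) by apply exp_pos.
    exists (Rmax 1 (Rmax Z1 Z2)), ((a2 + c2) * e).
    split; [apply Rmax_l | ]. split; [apply Rmult_lt_0_compat; lra | ].
    intros z Hz.
    assert (L1 := Rmax_l 1 (Rmax Z1 Z2)). assert (L2 := Rmax_r 1 (Rmax Z1 Z2)).
    assert (L3 := Rmax_l Z1 Z2). assert (L4 := Rmax_r Z1 Z2).
    specialize (Hb z ltac:(lra)). specialize (Hd z ltac:(lra)).
    assert (G := gauss_absorb_upper C1 C2 z HC). fold e in G.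
    assert (G0 := exp_pos (- C1 * z ^ 2 - C2 * z)).
    assert (Hz1 : / z <= 1) by (rewrite <- Rinv_1; apply Rinv_le_contravar; lra).
    assert (0 < / z) by (apply Rinv_0_lt_compat; lra).
    assert (G1 := exp_pos (- (C1 / 2) * z ^ 2)).
    set (X := exp (- C1 * z ^ 2 - C2 * z)) in *. set (Y := exp (- (C1 / 2) * z ^ 2)) in *.
    assert (/ z * X <= X) by nra.
    assert (0 < e * Y) by now apply Rmult_lt_0_compat.
    split; [apply Rle_trans with (a2 * X); nra | apply Rle_trans with (c2 * X); nra]. }
  destruct H as [Z [k [HZ [Hk H]]]].
  set (E := exp (- (C1 / 2) * Z ^ 2)). assert (HE : 0 < E) by apply exp_pos.
  assert (Hf20 := bl_f2_pos 0 ltac:(lra)).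
  set (k' := (1 + f2 0) / E).
  assert (Hk' : 0 < k') by (apply Rdiv_lt_0_compat; lra).
  exists (k + k'), (C1 / 2). repeat split; try lra.
  - destruct (Rle_dec Z z) as [Hz | Hz].
    + destruct (H z Hz) as [A _]. generalize (exp_pos (- (C1 / 2) * z ^ 2)). nra.
    + assert (z ^ 2 <= Z ^ 2) by (apply pow_incr; lra).
      assert (E <= exp (- (C1 / 2) * z ^ 2)) by (apply exp_le; nra).
      assert (k' * E = 1 + f2 0) by (unfold k'; field; lra).
      generalize (bl_f1_le 0 z ltac:(lra) ltac:(lra)) (exp_pos (- (C1 / 2) * z ^ 2)). rewrite bl_f10. nra.
  - destruct (Rle_dec Z z) as [Hz | Hz].
    + destruct (H z Hz) as [_ A]. generalize (exp_pos (- (C1 / 2) * z ^ 2)). nra.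
    + assert (z ^ 2 <= Z ^ 2) by (apply pow_incr; lra).
      assert (E <= exp (- (C1 / 2) * z ^ 2)) by (apply exp_le; nra).
      assert (k' * E = 1 + f2 0) by (unfold k'; field; lra).
      generalize (bl_f2_decr 0 z ltac:(lra) ltac:(lra)) (exp_pos (- (C1 / 2) * z ^ 2)). nra.
Qed.

Lemma bl_lower : exists k c, 0 < k /\ 0 < c /\ forall z, 0 <= z -> k * exp (- c * z ^ 2) <= 1 - f1 z.
Proof.
  assert (HC := bl_C1).
  destruct HB as [_ [_ [_ [_ [_ [_ [_ [_ [[a1 [a2 [Z1 [Ha [_ Hb]]]]] _]]]]]]]]].
  (* For z >= 1 the summand [Rabs C2] absorbs the linear term of the exponent, and the summand 1
     absorbs the factor 1 / z through z <= e^z. *)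
  set (c := C1 + Rabs C2 + 1). set (Z := Rmax 1 Z1).
  assert (HZ1 : 1 <= Z) by apply Rmax_l. assert (HZ2 : Z1 <= Z) by apply Rmax_r.
  assert (HcC : C2 <= Rabs C2) by apply Rle_abs.
  assert (HcC' := Rabs_pos C2).
  assert (Hg := bl_f1_lt1 Z ltac:(lra)).
  exists (Rmin a1 (1 - f1 Z)), c. split; [apply Rmin_glb_lt; lra | ]. split; [unfold c; lra | ].
  assert (L1 := Rmin_l a1 (1 - f1 Z)). assert (L2 := Rmin_r a1 (1 - f1 Z)).
  intros z Hz. destruct (Rle_dec Z z) as [HzZ | HzZ].
  - specialize (Hb z ltac:(lra)). apply Rle_trans with (a1 * (/ z * exp (- C1 * z ^ 2 - C2 * z))); [ | lra].
    assert (Hlow : exp (- c * z ^ 2) <= / z * exp (- C1 * z ^ 2 - C2 * z)).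
    { apply Rmult_le_reg_l with z; [lra | ]. rewrite <- Rmult_assoc, Rinv_r, Rmult_1_l by lra.
      apply Rle_trans with (exp z * exp (- c * z ^ 2)).
      - apply Rmult_le_compat_r; [left; apply exp_pos | ]. generalize (exp_ineq1_le z). lra.
      - rewrite <- exp_plus. apply exp_le.
        assert (E : - C1 * z ^ 2 - C2 * z - (z + - c * z ^ 2) = Rabs C2 * (z * (z - 1)) + (Rabs C2 - C2) * z + z * (z - 1))
          by (unfold c; ring).
        assert (0 <= z * (z - 1)) by (apply Rmult_le_pos; lra).
        assert (0 <= (Rabs C2 - C2) * z) by (apply Rmult_le_pos; lra).
        assert (0 <= Rabs C2 * (z * (z - 1))) by (apply Rmult_le_pos; lra). lra. }
    apply Rmult_le_compat; auto; [ | left; apply exp_pos]. apply Rmin_glb; lra.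
  - apply Rle_trans with (1 - f1 Z).
    + assert (exp (- c * z ^ 2) <= 1).
      { rewrite <- exp_0. apply exp_le. assert (0 <= c * z ^ 2) by (apply Rmult_le_pos; [unfold c; lra | apply pow2_ge_0]). lra. }
      generalize (exp_pos (- c * z ^ 2)). intros.
      assert (0 <= Rmin a1 (1 - f1 Z)) by (apply Rmin_glb; lra). nra.
    + generalize (bl_f1_le z Z Hz ltac:(lra)). lra.
Qed.

End Blasius.

(** * The Blasius solution in von Mises variables *)

Section Profile.

Variables (f f1 f2 f3 : R -> R) (C1 C2 : R).
Hypothesis HB : blasius f f1 f2 f3 C1 C2.

Lemma cont_clamp (h : R -> R) (t : R) :
  (forall z, 0 <= z -> continuous h z) -> continuous (fun s => h (Rmax 0 s)) t.
Proof.
  intros H. apply (cont_comp (fun s => Rmax 0 s) h).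
  - apply cont_max; [apply cont_const | apply continuous_id].
  - apply H, Rmax_l.
Qed.

Lemma cont2_of_snd (h : R -> R) (x y : R) : continuous h y -> cont2 (fun _ t => h t) x y.
Proof. intros H. apply (cont_comp snd h); [apply continuous_snd | exact H]. Qed.

(** [f] is the stream function of the profile f', so the inversion of stream functions applies to
    data independent of x with V = 0, after continuing [f] by the identity to negative arguments. *)
Lemma blasius_inverse : exists g : R -> R,
  (forall s, 0 <= s -> f (g s) = s) /\ (forall z, 0 <= z -> g (f z) = z) /\ g 0 = 0 /\
  (forall s t, s < t -> g s < g t) /\ (forall s, continuous g s) /\
  (forall s, 0 < s -> is_derive g s (/ f1 (g s))).
Proof.
  set (q := fun y => f (Rmax 0 y) + Rmin y 0).
  assert (q_pos : forall y, 0 <= y -> q y = f y).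
  { intros y Hy. unfold q. rewrite Rmax_right, Rmin_right by lra. ring. }
  assert (q_neg : forall y, y <= 0 -> q y = y).
  { intros y Hy. unfold q. rewrite Rmax_left, Rmin_left by lra. rewrite (bl_f0 _ _ _ _ _ _ HB). ring. }
  assert (q_cont : forall y, continuous q y).
  { intros y. unfold q. apply cont_plus; [apply (cont_clamp f), (bl_cf _ _ _ _ _ _ HB) | ].
    apply cont_min; [apply continuous_id | apply cont_const]. }
  assert (q_incr : forall a b, a < b -> q a < q b).
  { intros a b Hab. destruct (Rle_dec b 0); [rewrite !q_neg by lra; lra | ].
    destruct (Rle_dec 0 a).
    - rewrite !q_pos by lra. apply (bl_f_incr _ _ _ _ _ _ HB); lra.
    - rewrite (q_neg a), (q_pos b) by lra. generalize (bl_f_ge0 _ _ _ _ _ _ HB b ltac:(lra)). lra. }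
  assert (Hk := bl_f1_pos _ _ _ _ _ _ HB 1 ltac:(lra)).
  destruct (stream_inverse (fun _ => q) (fun _ y => f1 (Rmax 0 y)) (fun _ _ => 0))
    as [Y [A [B [C [D [E [F [G _]]]]]]]].
  - intros _; apply q_incr.
  - intros _ p. destruct (Rle_dec p 0) as [Hp | Hp]; [exists p; now apply q_neg | ].
    set (z := 1 + p / f1 1).
    assert (Hpz : 0 < p / f1 1) by (apply Rdiv_lt_0_compat; lra).
    destruct (IVT_gen q 0 z p) as [y [_ Hy]].
    + intros t. apply continuity_pt_filterlim, q_cont.
    + rewrite q_neg, q_pos by (unfold z; lra).
      assert (p <= f z).
      { apply Rle_trans with (2 := bl_f_ge_linear _ _ _ _ _ _ HB z ltac:(unfold z; lra)).
        unfold z. right. field. lra. }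
      rewrite Rmin_left, Rmax_right by lra. lra.
    + now exists y.
  - intros _. apply q_neg; lra.
  - intros x y. apply cont2_of_snd, q_cont.
  - intros _ y Hy. rewrite Rmax_right by lra. apply (is_derive_ext_loc f).
    + exists (mkposreal y Hy). intros t Ht. symmetry. apply q_pos. left. now apply (near_pos y).
    + apply (bl_Df _ _ _ _ _ _ HB); lra.
  - intros x y. apply (cont2_of_snd (fun y => f1 (Rmax 0 y))), cont_clamp, (bl_cf1 _ _ _ _ _ _ HB).
  - intros _ y Hy. rewrite Rmax_right by lra. now apply (bl_f1_pos _ _ _ _ _ _ HB).
  - intros x y Hx Hy. rewrite Ropp_0. apply D_const.
  - exists (Y 0).
    assert (HY0 : forall s, 0 <= s -> 0 <= Y 0 s).
    { intros s [Hs | <-]; [left; auto | rewrite C; lra]. }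
    split; [intros s Hs; rewrite <- q_pos by auto; apply A | ].
    split; [intros z Hz; rewrite <- q_pos by auto; apply B | ].
    split; [apply C | ]. split; [apply E | ].
    split; [intros s; apply cont2_sec, F | ].
    intros s Hs. rewrite <- (Rmax_right 0 (Y 0 s)) at 1 by auto with real. apply G, Hs.
Qed.

Variable g : R -> R.
Hypothesis g_f : forall s, 0 <= s -> f (g s) = s.
Hypothesis f_g : forall z, 0 <= z -> g (f z) = z.
Hypothesis g_0 : g 0 = 0.
Hypothesis g_lt : forall s t, s < t -> g s < g t.
Hypothesis g_cont : forall s, continuous g s.
Hypothesis g_D : forall s, 0 < s -> is_derive g s (/ f1 (g s)).

Lemma g_pos (s : R) : 0 < s -> 0 < g s.
Proof. intros Hs. rewrite <- g_0. now apply g_lt. Qed.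

Lemma g_ge0 (s : R) : 0 <= s -> 0 <= g s.
Proof. intros [Hs | <-]; [left; now apply g_pos | rewrite g_0; lra]. Qed.

(** The square of f' as a function of f. A Blasius solution with origin x = -b has the stream
    function sqrt(x+b) f(y / sqrt(x+b)), so its phi is [prof] (p / sqrt (x + b)). *)
Definition prof (s : R) : R := f1 (Rmax 0 (g s)) * f1 (Rmax 0 (g s)).

Lemma prof_eq (s : R) : 0 <= s -> prof s = f1 (g s) * f1 (g s).
Proof. intros Hs. unfold prof. rewrite Rmax_right; auto using g_ge0. Qed.

Lemma prof_0 : prof 0 = 0.
Proof. rewrite prof_eq, g_0, (bl_f10 _ _ _ _ _ _ HB) by lra. ring. Qed.

Lemma prof_f (z : R) : 0 <= z -> prof (f z) = f1 z * f1 z.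
Proof. intros Hz. rewrite prof_eq, f_g; auto. now apply (bl_f_ge0 _ _ _ _ _ _ HB). Qed.

Lemma prof_cont (s : R) : continuous prof s.
Proof.
  assert (H : continuous (fun s => f1 (Rmax 0 (g s))) s).
  { apply (cont_comp g (fun t => f1 (Rmax 0 t))); [apply g_cont | ]. apply cont_clamp, (bl_cf1 _ _ _ _ _ _ HB). }
  now apply cont_mult.
Qed.

Lemma prof_D1 (s : R) : 0 < s -> is_derive prof s (2 * f2 (g s)).
Proof.
  intros Hs. apply (is_derive_ext_loc (fun s => f1 (g s) * f1 (g s))).
  - exists (mkposreal s Hs). intros t Ht. symmetry. apply prof_eq. left. now apply (near_pos s).
  - assert (Hg := g_pos s Hs). assert (H1 := bl_f1_pos _ _ _ _ _ _ HB _ Hg).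
    assert (D : is_derive (fun s => f1 (g s)) s (f2 (g s) * / f1 (g s))).
    { apply (D_comp f1 g); [apply (bl_Df1 _ _ _ _ _ _ HB); lra | now apply g_D]. }
    apply (D_eq _ _ _ _ (D_mult _ _ _ _ _ D D)). field. lra.
Qed.

Lemma prof_D2 (s : R) : 0 < s -> is_derive (fun s => 2 * f2 (g s)) s (2 * f3 (g s) / f1 (g s)).
Proof.
  intros Hs. assert (Hg := g_pos s Hs). assert (H1 := bl_f1_pos _ _ _ _ _ _ HB _ Hg).
  assert (D : is_derive (fun s => f2 (g s)) s (f3 (g s) * / f1 (g s))).
  { apply (D_comp f2 g); [apply (bl_Df2 _ _ _ _ _ _ HB); lra | now apply g_D]. }
  apply (D_eq _ _ _ _ (D_mult (fun _ => 2) _ _ _ _ (D_const 2 s) D)). field. lra.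
Qed.

Lemma prof_ge_min (s : R) : 0 <= s -> prof 1 * Rmin s 1 <= prof s.
Proof.
  apply (concave_ge_min prof (fun s => 2 * f2 (g s))).
  - intros; apply prof_cont.
  - intros; now apply prof_D1.
  - apply prof_0.
  - intros t Ht. generalize (bl_f2_pos _ _ _ _ _ _ HB (g t) (g_ge0 t ltac:(lra))). lra.
  - intros a b Ha Hab. apply Rmult_le_compat_l; [lra | ].
    apply (bl_f2_decr _ _ _ _ _ _ HB); [apply g_ge0; lra | ].
    destruct Hab as [H | ->]; [left; now apply g_lt | lra].
Qed.

Lemma prof_pos (s : R) : 0 < s -> 0 < prof s.
Proof.
  intros Hs. rewrite prof_eq by lra.
  generalize (bl_f1_pos _ _ _ _ _ _ HB (g s) (g_pos s Hs)). nra.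
Qed.

Lemma prof_le (s t : R) : 0 <= s -> s <= t -> prof s <= prof t.
Proof.
  intros Hs Hst. apply (nondecr_of_derive prof (fun s => 2 * f2 (g s))); auto.
  - intros; apply prof_D1; lra.
  - intros r Hr. generalize (bl_f2_pos _ _ _ _ _ _ HB (g r) (g_ge0 r ltac:(lra))). lra.
  - intros; apply prof_cont.
Qed.

Lemma prof_le_linear (s : R) : 0 <= s -> prof s <= 2 * f2 0 * s.
Proof.
  intros [Hs | <-]; [ | rewrite prof_0; lra].
  destruct (mvt prof (fun s => 2 * f2 (g s)) 0 s Hs) as [c [Hc E]].
  - intros; apply prof_D1; lra.
  - intros; apply prof_cont.
  - rewrite prof_0 in E. replace (prof s) with (2 * f2 (g c) * s) by lra.
    apply Rmult_le_compat_r; [lra | ]. apply Rmult_le_compat_l; [lra | ].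
    apply (bl_f2_decr _ _ _ _ _ _ HB); [lra | apply g_ge0; lra].
Qed.

Lemma prof_le_1 (s : R) : 0 <= s -> prof s <= 1.
Proof.
  intros Hs. rewrite prof_eq by auto.
  assert (H1 := bl_f1_lt1 _ _ _ _ _ _ HB (g s) (g_ge0 s Hs)).
  assert (H0 := bl_f1_le _ _ _ _ _ _ HB 0 (g s) ltac:(lra) (g_ge0 s Hs)).
  rewrite (bl_f10 _ _ _ _ _ _ HB) in H0. nra.
Qed.

Lemma prof_near_1 (eps : R) : 0 < eps -> exists A, 0 < A /\ forall s, A <= s -> 1 - eps <= prof s.
Proof.
  intros He. destruct (lim_infty_eps f1 1 (eps / 2) (bl_lim _ _ _ _ _ _ HB) ltac:(lra)) as [M [HM H]].
  exists (f M + 1). assert (HfM := bl_f_ge0 _ _ _ _ _ _ HB M HM). split; [lra | ].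
  intros s Hs. apply Rle_trans with (prof (f M)); [ | apply prof_le; lra].
  rewrite prof_f by auto. specialize (H M ltac:(lra)). apply Rabs_def2 in H.
  assert (H1 := bl_f1_lt1 _ _ _ _ _ _ HB M HM). nra.
Qed.

(** [f] grows at least linearly, so [g] s <= 1 + s / r and the Gaussian in z stays a Gaussian in s;
    (1 + t)^2 <= 2 + 2 t^2 separates the constant factor. *)
Lemma prof_tail : exists k c, 0 < k /\ 0 < c /\ forall s, 0 <= s -> k * exp (- c * s ^ 2) <= 1 - prof s.
Proof.
  destruct (bl_lower _ _ _ _ _ _ HB) as [k [c [Hk [Hc H]]]].
  assert (Hf := bl_f1_pos _ _ _ _ _ _ HB 1 ltac:(lra)). set (r := f1 1) in *.
  exists (k * exp (- (2 * c))), (2 * c / (r * r)).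
  split; [apply Rmult_lt_0_compat; [auto | apply exp_pos] | ].
  split; [apply Rdiv_lt_0_compat; nra | ].
  intros s Hs. assert (Hg := g_ge0 s Hs).
  assert (Hgs : g s <= 1 + s / r).
  { generalize (bl_f_ge_linear _ _ _ _ _ _ HB (g s) Hg). rewrite g_f by auto. fold r. intros H1.
    apply Rmult_le_reg_l with r; auto. replace (r * (1 + s / r)) with (r + s) by (field; lra). lra. }
  assert (Hs2 : 0 <= s / r) by (apply Rdiv_le_0_compat; lra).
  apply Rle_trans with (k * exp (- c * g s ^ 2)).
  - rewrite Rmult_assoc. apply Rmult_le_compat_l; [lra | ]. rewrite <- exp_plus. apply exp_le.
    replace (- (2 * c) + - (2 * c / (r * r)) * s ^ 2) with (- c * (2 + 2 * (s / r) ^ 2)) by (field; lra).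
    assert (g s ^ 2 <= (1 + s / r) ^ 2) by (apply pow_incr; lra).
    assert (0 <= (1 - s / r) ^ 2) by apply pow2_ge_0. nra.
  - apply Rle_trans with (1 := H (g s) Hg). rewrite prof_eq by auto.
    assert (H1 := bl_f1_lt1 _ _ _ _ _ _ HB (g s) Hg).
    assert (H0 := bl_f1_le _ _ _ _ _ _ HB 0 (g s) ltac:(lra) Hg).
    rewrite (bl_f10 _ _ _ _ _ _ HB) in H0. nra.
Qed.

(** The Blasius solution with origin x = -[b], raised by [e]. As the profile is concave, enlarging
    the coefficient sqrt phi by raising only lowers the diffusion term, so the raised function is a
    supersolution. *)
Definition bar (b e x p : R) : R := prof (p / sqrt (x + b)) + e.
Definition bar_x (b x p : R) : R :=
  2 * f2 (g (p / sqrt (x + b))) * - (p / (2 * (x + b) * sqrt (x + b))).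
Definition bar_p (b x p : R) : R := 2 * f2 (g (p / sqrt (x + b))) * / sqrt (x + b).
Definition bar_q (b x p : R) : R :=
  2 * f3 (g (p / sqrt (x + b))) / f1 (g (p / sqrt (x + b))) * / (x + b).

Lemma bar_q_le (b x p : R) : 0 < b -> 0 <= x -> 0 < p -> bar_q b x p <= 0.
Proof.
  intros Hb Hx Hp. unfold bar_q.
  assert (Hs : 0 < p / sqrt (x + b)) by (apply Rdiv_lt_0_compat; [auto | apply sqrt_lt_R0; lra]).
  assert (Hg := g_pos _ Hs).
  assert (H1 := bl_f1_pos _ _ _ _ _ _ HB _ Hg). assert (H3 := bl_f3_le _ _ _ _ _ _ HB _ (Rlt_le _ _ Hg)).
  set (a := g (p / sqrt (x + b))) in *. unfold Rdiv.
  assert (0 < / f1 a) by now apply Rinv_0_lt_compat.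
  assert (0 < / (x + b)) by (apply Rinv_0_lt_compat; lra).
  assert (0 < / f1 a * / (x + b)) by now apply Rmult_lt_0_compat.
  rewrite Rmult_assoc. nra.
Qed.

Lemma bar_eq (b x p : R) : 0 < b -> 0 <= x -> 0 < p ->
  bar_x b x p = sqrt (bar b 0 x p) * bar_q b x p.
Proof.
  intros Hb Hx Hp. unfold bar_x, bar_q, bar. set (r := sqrt (x + b)).
  assert (Hr : 0 < r) by (apply sqrt_lt_R0; lra).
  assert (Er : x + b = r * r) by (symmetry; apply sqrt_sqrt; lra).
  assert (Hs : 0 < p / r) by now apply Rdiv_lt_0_compat.
  assert (Hg := g_pos _ Hs). assert (H1 := bl_f1_pos _ _ _ _ _ _ HB _ Hg).
  rewrite Rplus_0_r, prof_eq, sqrt_square, (bl_ode _ _ _ _ _ _ HB), g_f, Er by lra.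
  field. lra.
Qed.

Lemma bar_regular (b e X : R) : 0 < b -> 0 <= e ->
  vm_regular X (bar b e) (bar_x b) (bar_p b) (bar_q b).
Proof.
  intros Hb He.
  assert (Hr : forall x, 0 <= x -> 0 < sqrt (x + b)) by (intros; apply sqrt_lt_R0; lra).
  assert (Hs : forall x p, 0 < x <= X -> 0 < p -> 0 < p / sqrt (x + b)).
  { intros x p Hx Hp. apply Rdiv_lt_0_compat; auto. apply Hr; lra. }
  split; [ | split; [ | split; [ | split]]].
  - intros x p Hx Hp. apply cont_plus; [ | apply cont_const].
    apply (cont_comp (fun z : R * R => snd z / sqrt (fst z + b)) prof); [ | apply prof_cont].
    apply cont_div.
    + simpl. generalize (Hr x ltac:(lra)). lra.
    + apply continuous_snd.
    + apply cont_sqrt, cont_plus; [apply continuous_fst | apply cont_const].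
  - intros x p Hx Hp. specialize (Hr x ltac:(lra)).
    apply (D_eq _ _ (bar_x b x p + 0)); [ | ring]. apply D_plus; [ | apply D_const].
    apply (D_comp prof (fun x => p / sqrt (x + b))); [now apply prof_D1, Hs | ].
    auto_derive; [split; [lra | split; [lra | exact I]] | ].
    set (r := sqrt (x + b)) in *. assert (Er : x + b = r * r) by (symmetry; apply sqrt_sqrt; lra).
    rewrite Er. field. lra.
  - intros x p Hx Hp. specialize (Hr x ltac:(lra)).
    apply (D_eq _ _ (bar_p b x p + 0)); [ | ring]. apply D_plus; [ | apply D_const].
    apply (D_comp prof (fun p => p / sqrt (x + b))); [now apply prof_D1, Hs | ].
    auto_derive; [exact I | field; lra].
  - intros x p Hx Hp. specialize (Hr x ltac:(lra)).
    set (r := sqrt (x + b)) in *. assert (Er : x + b = r * r) by (symmetry; apply sqrt_sqrt; lra).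
    unfold bar_p, bar_q. fold r.
    apply (D_eq _ _ (2 * f3 (g (p / r)) / f1 (g (p / r)) * / r * / r + 2 * f2 (g (p / r)) * 0)).
    + apply (D_mult (fun p => 2 * f2 (g (p / r))) (fun _ => / r)); [ | apply D_const].
      apply (D_comp (fun s => 2 * f2 (g s)) (fun p => p / r)); [now apply prof_D2, Hs | ].
      auto_derive; [exact I | field; lra].
    + assert (Hg := g_pos _ (Hs x p Hx Hp)). fold r in Hg.
      assert (H1 := bl_f1_pos _ _ _ _ _ _ HB _ Hg). rewrite Er. field. lra.
  - intros x p Hx Hp. generalize (prof_pos _ (Hs x p Hx Hp)). unfold bar. lra.
Qed.

End Profile.

(** * Comparison with Blasius solutions *)

(** Concavity makes [h1] nonincreasing. A negative value of it would force [h] below a falling line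
    and eventually below 0, so [h] increases to its limit 1. The remaining bounds come from chords
    and the mean value theorem. *)
Lemma concave_datum (h h1 h2 : R -> R) (M : R) :
  (forall y, continuous h y) -> h 0 = 0 -> (forall y, 0 < y -> 0 < h y) ->
  (forall y, 0 < y -> is_derive h y (h1 y)) -> (forall y, 0 < y -> is_derive h1 y (h2 y)) ->
  (forall y, 0 < y -> h2 y <= 0) -> (forall y, 0 < y -> Rabs (h1 y) <= M) ->
  is_lim h p_infty 1 ->
  (forall a b, 0 <= a -> a <= b -> h a <= h b) /\
  (forall y, 0 <= y -> h y <= 1) /\
  (forall y, 0 <= y -> h 1 * Rmin y 1 <= h y) /\
  (forall y, 0 <= y -> h y <= M * y).
Proof.
  intros Hc H0 Hp Hd1 Hd2 Hneg HM Hlim.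
  assert (Hdec : forall s t, 0 < s -> s <= t -> h1 t <= h1 s).
  { intros s t Hs Hst. enough (- h1 s <= - h1 t) by lra.
    apply (nondecr_of_derive (fun y => - h1 y) (fun y => - h2 y)); auto.
    - intros y Hy. apply D_opp, Hd2; lra.
    - intros y Hy. specialize (Hneg y ltac:(lra)). lra.
    - intros y Hy. apply cont_opp, (cont_of_derive _ _ (h2 y)), Hd2; lra. }
  assert (Hpos : forall y, 0 < y -> 0 <= h1 y).
  { intros y Hy. apply Rnot_lt_le. intros Hn.
    (* The abscissa at which the tangent line at y takes the negative value [h1] y. *)
    set (t := y + 1 + h y / - h1 y).
    assert (Hq : 0 < h y / - h1 y) by (apply Rdiv_lt_0_compat; [auto | lra]).
    destruct (mvt h h1 y t) as [c [Hcc E]]; [unfold t; lra | intros; apply Hd1; lra | auto | ].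
    specialize (Hdec y c Hy ltac:(lra)). specialize (Hp t ltac:(unfold t; lra)).
    assert (h1 c * (t - y) <= h1 y * (t - y)) by (apply Rmult_le_compat_r; unfold t in *; lra).
    assert (h1 y * (t - y) = h1 y - h y) by (unfold t; field; lra). lra. }
  assert (Hm : forall a b, 0 <= a -> a <= b -> h a <= h b).
  { intros a b Ha Hab. apply (nondecr_of_derive h h1); auto.
    - intros; apply Hd1; lra.
    - intros; apply Hpos; lra. }
  repeat split; auto.
  - intros y Hy. apply (incr_below_limit h 1 0); auto.
  - intros y Hy. apply (concave_ge_min h h1); auto.
  - intros y [Hy | <-]; [ | rewrite H0; lra].
    destruct (mvt h h1 0 y Hy) as [c [Hcc E]]; [intros; apply Hd1; lra | auto | ].
    rewrite H0 in E. specialize (HM c ltac:(lra)). apply Rabs_le_between in HM. nra.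
Qed.

(** The return from von Mises to physical variables: since Y_psi = 1 / u, a faster flow has its
    streamlines closer to the wall. *)
Lemma inverse_compare (Y1 Y2 s1 s2 : R -> R) :
  (forall p, continuous Y1 p) -> (forall p, continuous Y2 p) -> Y1 0 = 0 -> Y2 0 = 0 ->
  (forall p, 0 < p -> is_derive Y1 p (/ s1 p)) -> (forall p, 0 < p -> is_derive Y2 p (/ s2 p)) ->
  (forall p, 0 < p -> 0 < s1 p <= s2 p) -> forall p, 0 <= p -> Y2 p <= Y1 p.
Proof.
  intros C1 C2 E1 E2 D1 D2 Hs p Hp.
  enough (Y1 0 - Y2 0 <= Y1 p - Y2 p) by lra.
  apply (nondecr_of_derive (fun p => Y1 p - Y2 p) (fun p => / s1 p - / s2 p)); auto.
  - intros t Ht. apply D_minus; [apply D1 | apply D2]; lra.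
  - intros t Ht. specialize (Hs t ltac:(lra)).
    assert (/ s2 t <= / s1 t) by (apply Rinv_le_contravar; lra). lra.
  - intros t _. now apply cont_minus.
Qed.

Section Sandwich.

Variables U V W P Q psi Y : R -> R -> R.
Hypothesis HP : prandtl U V W P Q.
Hypothesis HV : von_mises U V psi Y.
Variables (f f1 f2 f3 : R -> R) (C1 C2 : R).
Hypothesis HB : blasius f f1 f2 f3 C1 C2.
Variable g : R -> R.
Hypothesis g_f : forall s, 0 <= s -> f (g s) = s.
Hypothesis f_g : forall z, 0 <= z -> g (f z) = z.
Hypothesis g_0 : g 0 = 0.
Hypothesis g_lt : forall s t, s < t -> g s < g t.
Hypothesis g_cont : forall s, continuous g s.
Hypothesis g_D : forall s, 0 < s -> is_derive g s (/ f1 (g s)).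

Variables (k0 K0 C4 C5 : R).
Hypothesis k0_pos : 0 < k0.
Hypothesis K0_pos : 0 < K0.
Hypothesis C4_pos : 0 < C4.
Hypothesis C5_pos : 0 < C5.
Hypothesis init_low : forall y, 0 <= y -> k0 * Rmin y 1 <= U 0 y.
Hypothesis init_lin : forall y, 0 <= y -> U 0 y <= K0 * y.
Hypothesis init_le1 : forall y, 0 <= y -> U 0 y <= 1.
Hypothesis init_gauss : forall y, 0 <= y -> 1 - U 0 y <= C4 * exp (- C5 * y ^ 2).
Variables u1 u2 : R -> R.
Hypothesis init_D1 : forall y, 0 < y -> is_derive (U 0) y (u1 y).
Hypothesis init_D2 : forall y, 0 < y -> is_derive u1 y (u2 y).
Hypothesis init_u1 : forall y, 0 < y -> u1 y <= K0.
Hypothesis init_u2 : forall y, 0 < y -> u2 y <= 0.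
Hypothesis U_bdd : forall X, 0 < X -> exists M, forall x y, 0 <= x <= X -> 0 <= y -> Rabs (U x y) <= M.

Notation phi := (vm_phi U Y).
Notation prof := (prof f1 g).

Let psi_le (y : R) : 0 <= y -> psi 0 y <= y /\ psi 0 y <= K0 * (y * y).
Proof.
  intros Hy. assert (Hpc := fun t => cont2_sec psi 0 t (vm_psi_cont _ _ _ _ HV 0 t)).
  assert (Hp0 := vm_psi_0 _ _ _ _ HV 0). split.
  - enough (0 - psi 0 0 <= y - psi 0 y) by lra.
    apply (nondecr_of_derive (fun t => t - psi 0 t) (fun t => 1 - U 0 t)); auto.
    + intros t Ht. apply D_minus; [apply D_id | apply (vm_psi_y _ _ _ _ HV); lra].
    + intros t Ht. specialize (init_le1 t ltac:(lra)). lra.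
    + intros t _. apply cont_minus; [apply continuous_id | auto].
  - enough (K0 * (0 * 0) - psi 0 0 <= K0 * (y * y) - psi 0 y) by lra.
    apply (nondecr_of_derive (fun t => K0 * (t * t) - psi 0 t) (fun t => 2 * K0 * t - U 0 t)); auto.
    + intros t Ht. apply D_minus; [ | apply (vm_psi_y _ _ _ _ HV); lra].
      auto_derive; [exact I | ring].
    + intros t Ht. specialize (init_lin t ltac:(lra)). nra.
    + intros t _. apply cont_minus; [ | auto]. apply cont_mult; [apply cont_const | ].
      apply cont_mult; apply continuous_id.
Qed.

(** Both sides are of order y^2 at the wall, as psi is of order y^2 there, and stretching the
    profile by B makes its curve as low as needed on bounded sets. In the far region stretching also
    widens the Gaussian tail of the profile until it dominates the tail of the datum. *)
Lemma initial_lower : exists b, 1 <= b /\ forall y, 0 <= y -> prof (psi 0 y / sqrt b) <= U 0 y * U 0 y.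
Proof.
  destruct (prof_tail f f1 f2 f3 C1 C2 HB g g_f g_0 g_lt) as [k [c [Hk [Hc Htail]]]].
  assert (Hf2 := bl_f2_pos _ _ _ _ _ _ HB 0 ltac:(lra)).
  (* Beyond [M] the gain 1 + [C5] y^2 / 2 from half of the Gaussian exceeds 2 [C4] / [k]. *)
  set (M := 1 + 4 * C4 / (k * C5)).
  assert (HM : 0 < 4 * C4 / (k * C5)) by (apply Rdiv_lt_0_compat; nra).
  assert (HM' : 4 * C4 <= k * C5 * M * M).
  { assert (4 * C4 / (k * C5) <= M * M) by (unfold M; nra).
    replace (4 * C4) with (k * C5 * (4 * C4 / (k * C5))) by (field; lra).
    replace (k * C5 * M * M) with (k * C5 * (M * M)) by ring. apply Rmult_le_compat_l; nra. }
  set (L := 2 * f2 0 * K0 * (M * M) / (k0 * k0)).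
  assert (HL : 0 < L).
  { apply Rdiv_lt_0_compat; [ | nra]. repeat apply Rmult_lt_0_compat; unfold M; lra. }
  assert (HcC : 0 < 2 * c / C5) by (apply Rdiv_lt_0_compat; lra).
  (* [L] settles the region y <= [M]; 2 [c] / [C5] makes the exponent of the stretched tail at most
     [C5] / 2; the 1 ensures B <= B^2, where B^2 is the shift b. *)
  set (B := 1 + 2 * c / C5 + L).
  assert (HBB : B <= B * B) by (unfold B; nra).
  exists (B * B). split; [unfold B in *; lra | ].
  intros y Hy. rewrite sqrt_square by (unfold B; lra).
  destruct (psi_le y Hy) as [Hp1 Hp2].
  assert (Hp0 := vm_psi_ge0 U V psi Y HV 0 y Hy).
  assert (HB0 : 0 < B) by (unfold B; lra).
  assert (Hs : 0 <= psi 0 y / B) by (apply Rdiv_le_0_compat; lra).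
  destruct (Rle_dec y M) as [HyM | HyM].
  - apply Rle_trans with (1 := prof_le_linear _ _ _ _ _ _ HB g g_0 g_lt g_cont g_D _ Hs).
    assert (Hmin : k0 * k0 * (y * y) <= M * M * (U 0 y * U 0 y)).
    { assert (Hl := init_low y Hy). assert (0 <= U 0 y) by apply (U_nonneg _ _ _ _ _ HP).
      assert (HyMin : y <= M * Rmin y 1).
      { unfold Rmin. destruct (Rle_dec y 1); unfold M in *; nra. }
      assert (k0 * y <= M * U 0 y).
      { apply Rle_trans with (M * (k0 * Rmin y 1)); [nra | ]. apply Rmult_le_compat_l; [unfold M; lra | auto]. }
      replace (k0 * k0 * (y * y)) with (k0 * y * (k0 * y)) by ring.
      replace (M * M * (U 0 y * U 0 y)) with (M * U 0 y * (M * U 0 y)) by ring.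
      apply Rmult_le_compat; auto; nra. }
    assert (HLy : 2 * f2 0 * (K0 * (y * y)) <= L * (U 0 y * U 0 y)).
    { replace (2 * f2 0 * (K0 * (y * y))) with (2 * f2 0 * K0 / (k0 * k0) * (k0 * k0 * (y * y))) by (field; lra).
      replace (L * (U 0 y * U 0 y)) with (2 * f2 0 * K0 / (k0 * k0) * (M * M * (U 0 y * U 0 y))) by (unfold L; field; lra).
      apply Rmult_le_compat_l; auto. apply Rdiv_le_0_compat; nra. }
    apply Rmult_le_reg_r with B; auto.
    replace (2 * f2 0 * (psi 0 y / B) * B) with (2 * f2 0 * psi 0 y) by (field; lra).
    apply Rle_trans with (2 * f2 0 * (K0 * (y * y))); [apply Rmult_le_compat_l; lra | ].
    apply Rle_trans with (1 := HLy).
    assert (0 <= U 0 y * U 0 y) by exact (Rle_0_sqr (U 0 y)).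
    unfold B. nra.
  - specialize (Htail _ Hs). specialize (init_gauss y Hy). specialize (init_le1 y Hy).
    assert (U0 := U_nonneg _ _ _ _ _ HP 0 y).
    enough (2 * (1 - U 0 y) <= k * exp (- c * (psi 0 y / B) ^ 2)) by nra.
    assert (Hexp : exp (- (C5 / 2) * y ^ 2) <= exp (- c * (psi 0 y / B) ^ 2)).
    { apply exp_le. enough (c * (psi 0 y / B) ^ 2 <= C5 / 2 * y ^ 2) by lra.
      assert (Hsq : psi 0 y ^ 2 <= y ^ 2) by (apply pow_incr; lra).
      replace (c * (psi 0 y / B) ^ 2) with (c / (B * B) * psi 0 y ^ 2) by (field; lra).
      apply Rmult_le_compat; auto; [apply Rdiv_le_0_compat; nra | apply pow2_ge_0 | ].
      apply Rmult_le_reg_r with (B * B); [nra | ].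
      replace (c / (B * B) * (B * B)) with c by (field; lra).
      assert (2 * c / C5 <= B * B) by (unfold B in *; lra).
      replace c with (C5 / 2 * (2 * c / C5)) by (field; lra). apply Rmult_le_compat_l; lra. }
    apply Rle_trans with (k * exp (- (C5 / 2) * y ^ 2)); [ | apply Rmult_le_compat_l; lra].
    apply Rle_trans with (2 * (C4 * exp (- C5 * y ^ 2))); [lra | ].
    assert (E : exp (- C5 * y ^ 2) = exp (- (C5 / 2) * y ^ 2) * exp (- (C5 / 2) * y ^ 2)).
    { rewrite <- exp_plus. f_equal. field. }
    assert (E2 : exp (- (C5 / 2) * y ^ 2) * (1 + C5 / 2 * y ^ 2) <= 1).
    { apply Rle_trans with (exp (- (C5 / 2) * y ^ 2) * exp (C5 / 2 * y ^ 2)).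
      - apply Rmult_le_compat_l; [left; apply exp_pos | apply exp_ineq1_le].
      - rewrite <- exp_plus, <- exp_0. right. f_equal. ring. }
    rewrite E. set (e := exp (- (C5 / 2) * y ^ 2)) in *. assert (He : 0 < e) by apply exp_pos.
    assert (H4 : 2 * C4 <= k * (1 + C5 / 2 * y ^ 2)).
    { assert (M * M <= y ^ 2) by (simpl; unfold M in *; nra).
      assert (k * C5 * (M * M) <= k * C5 * y ^ 2) by (apply Rmult_le_compat_l; nra). lra. }
    assert (2 * C4 * e <= k).
    { apply Rle_trans with (k * (e * (1 + C5 / 2 * y ^ 2))); [ | nra]. nra. }
    nra.
Qed.

(** Because (u^2)_y = 2 u u_y is at most 2 K0 u = 2 K0 psi_y. *)
Lemma initial_square_le (y : R) : 0 <= y -> U 0 y * U 0 y <= 2 * K0 * psi 0 y.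
Proof.
  intros Hy.
  enough (2 * K0 * psi 0 0 - U 0 0 * U 0 0 <= 2 * K0 * psi 0 y - U 0 y * U 0 y).
  { rewrite (vm_psi_0 _ _ _ _ HV), (pr_U_0 _ _ _ _ _ HP) in H by lra. lra. }
  apply (nondecr_of_derive (fun t => 2 * K0 * psi 0 t - U 0 t * U 0 t)
    (fun t => (0 * psi 0 t + 2 * K0 * U 0 t) - (u1 t * U 0 t + U 0 t * u1 t))); auto.
  - intros t Ht. apply D_minus.
    + apply (D_mult (fun _ => 2 * K0) (psi 0)); [apply D_const | apply (vm_psi_y _ _ _ _ HV); lra].
    + apply (D_mult (U 0) (U 0)); apply init_D1; lra.
  - intros t Ht. specialize (init_u1 t ltac:(lra)). assert (H := U_nonneg _ _ _ _ _ HP 0 t). nra.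
  - intros t _. assert (A := cont2_sec psi 0 t (vm_psi_cont _ _ _ _ HV 0 t)).
    assert (B := cont2_sec U 0 t (pr_U_cont _ _ _ _ _ HP 0 t)). cont_tac.
Qed.

Lemma phi_psi (x y : R) : phi x (psi x y) = U x y * U x y.
Proof. unfold vm_phi. now rewrite (vm_Y_psi _ _ _ _ HV). Qed.

Lemma phi_ge0 (x p : R) : 0 <= phi x p.
Proof. exact (Rle_0_sqr (U x (Y x p))). Qed.

Lemma sandwich_lower : exists b, 1 <= b /\ forall x p, 0 <= x -> 0 <= p ->
  prof (p / sqrt (x + b)) <= phi x p.
Proof.
  destruct initial_lower as [b [Hb H0]]. exists b; split; auto. intros x p Hx Hp.
  rewrite <- (Rplus_0_r (prof _)). fold (bar f1 g b 0 x p).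
  apply (vm_comparison_concave (x + 1) 1 (bar f1 g b 0) (bar_x f2 g b) (bar_p f2 g b) (bar_q f1 f3 g b)
    phi (vm_phi_x Q Y) (vm_phi_p P Y) (vm_phi_q U Q Y)); try lra.
  - apply (bar_regular _ _ _ _ _ _ HB g); auto; lra.
  - now apply (phi_regular U V W P Q psi Y).
  - intros s q Hs Hq. right. apply (bar_eq _ _ _ _ _ _ HB g); auto; lra.
  - intros s q Hs Hq. right. symmetry. now apply (phi_eq U V W P Q psi Y).
  - intros s q Hs Hq. unfold bar. generalize (phi_ge0 s q). intros.
    assert (0 <= q / sqrt (s + b)) by (apply Rdiv_le_0_compat; [auto | apply sqrt_lt_R0; lra]).
    generalize (prof_le_1 _ _ _ _ _ _ HB g g_0 g_lt _ H1). lra.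
  - intros q Hq. unfold bar. rewrite Rplus_0_l, Rplus_0_r.
    rewrite <- (vm_psi_Y _ _ _ _ HV 0 q). rewrite phi_psi.
    apply H0. now apply (vm_Y_ge0 U V psi Y HV).
  - intros s Hs. unfold bar. rewrite Rdiv_0_l, (prof_0 _ _ _ _ _ _ HB g g_0 g_lt). generalize (phi_ge0 s 0). lra.
  - intros s q Hs Hq. left. apply (bar_q_le _ _ _ _ _ _ HB g); auto; lra.
Qed.

Lemma phi_bdd (X : R) : 0 < X -> exists M, forall x p, 0 <= x <= X -> 0 <= p -> phi x p <= M.
Proof.
  intros HX. destruct (U_bdd X HX) as [M HM]. exists (M * M). intros x p Hx Hp.
  specialize (HM x (Y x p) Hx (vm_Y_ge0 U V psi Y HV x p Hp)).
  assert (H := U_nonneg _ _ _ _ _ HP x (Y x p)). rewrite Rabs_right in HM by lra.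
  unfold vm_phi. apply Rmult_le_compat; auto.
Qed.

(** The barrier with origin x = -a, raised by e, dominates the datum once a is small in terms of e.
    Shifting its origin back to 0 only increases it, as [prof] is nondecreasing, and e is
    arbitrary. *)
Lemma sandwich_upper (x p : R) : 0 < x -> 0 <= p -> phi x p <= prof (p / sqrt x).
Proof.
  intros Hx Hp. apply Rle_plus_epsilon. intros e He.
  destruct (prof_near_1 _ _ _ _ _ _ HB g f_g g_0 g_lt g_cont g_D e He) as [A [HA HAe]].
  (* For q / r >= A the raised profile is at least 1 and hence above the datum; for q / r < A the
     datum satisfies phi <= 2 [K0] q <= 2 [K0] A r = e. *)
  set (r := e / (2 * K0 * A)).
  assert (Hr : 0 < r) by (apply Rdiv_lt_0_compat; [ | repeat apply Rmult_lt_0_compat]; lra).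
  set (a := r * r). assert (Ha : 0 < a) by (unfold a; nra).
  assert (Hsa : sqrt a = r) by (apply sqrt_square; lra).
  destruct (phi_bdd (x + 1) ltac:(lra)) as [M HM].
  apply Rle_trans with (bar f1 g a e x p).
  - apply (vm_comparison_concave (x + 1) M phi (vm_phi_x Q Y) (vm_phi_p P Y) (vm_phi_q U Q Y)
      (bar f1 g a e) (bar_x f2 g a) (bar_p f2 g a) (bar_q f1 f3 g a)); try lra.
    + now apply (phi_regular U V W P Q psi Y).
    + apply (bar_regular _ _ _ _ _ _ HB g); auto; lra.
    + intros s q Hs Hq. right. now apply (phi_eq U V W P Q psi Y).
    + intros s q Hs Hq. rewrite (bar_eq _ _ _ _ _ _ HB g); auto; try lra.
      assert (Hq0 := bar_q_le _ _ _ _ _ _ HB g g_0 g_lt a s q Ha ltac:(lra) Hq).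
      assert (sqrt (bar f1 g a 0 s q) <= sqrt (bar f1 g a e s q)).
      { apply sqrt_le_1_alt. unfold bar. lra. }
      nra.
    + intros s q Hs Hq. specialize (HM s q Hs Hq).
      assert (0 <= q / sqrt (s + a)) by (apply Rdiv_le_0_compat; [auto | apply sqrt_lt_R0; lra]).
      assert (H1 := prof_le _ _ _ _ _ _ HB g g_0 g_lt g_cont g_D 0 _ (Rle_refl 0) H).
      rewrite (prof_0 _ _ _ _ _ _ HB g g_0 g_lt) in H1. unfold bar. lra.
    + intros q Hq. unfold bar. rewrite Rplus_0_l, Hsa.
      set (y := Y 0 q). assert (Hy : 0 <= y) by now apply (vm_Y_ge0 U V psi Y HV).
      assert (Eq : q = psi 0 y) by (unfold y; now rewrite (vm_psi_Y _ _ _ _ HV)).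
      assert (Hqr : 0 <= q / r) by (apply Rdiv_le_0_compat; lra).
      unfold vm_phi. fold y.
      assert (HU1 := init_le1 y Hy). assert (HU0 := U_nonneg _ _ _ _ _ HP 0 y).
      destruct (Rle_dec A (q / r)) as [HAq | HAq].
      * specialize (HAe _ HAq). nra.
      * assert (H1 := prof_le _ _ _ _ _ _ HB g g_0 g_lt g_cont g_D 0 _ (Rle_refl 0) Hqr).
        rewrite (prof_0 _ _ _ _ _ _ HB g g_0 g_lt) in H1.
        enough (U 0 y * U 0 y <= e) by lra.
        assert (H2 : U 0 y * U 0 y <= 2 * K0 * q) by (rewrite Eq; now apply initial_square_le).
        assert (q < A * r).
        { apply Rmult_lt_reg_r with (/ r); [now apply Rinv_0_lt_compat | ].
          rewrite Rmult_assoc, Rinv_r, Rmult_1_r by lra. unfold Rdiv in HAq. lra. }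
        assert (2 * K0 * (A * r) = e) by (unfold r; field; lra). nra.
    + intros s Hs. unfold vm_phi. rewrite (vm_Y_0 _ _ _ _ HV), (pr_U_0 _ _ _ _ _ HP) by lra.
      unfold bar. rewrite Rdiv_0_l, (prof_0 _ _ _ _ _ _ HB g g_0 g_lt). lra.
    + intros s q Hs Hq. right. apply (bar_q_le _ _ _ _ _ _ HB g); auto; lra.
  - unfold bar. apply Rplus_le_compat_r. apply (prof_le _ _ _ _ _ _ HB g); auto.
    + apply Rdiv_le_0_compat; [auto | apply sqrt_lt_R0; lra].
    + apply Rmult_le_compat_l; auto. apply Rinv_le_contravar; [now apply sqrt_lt_R0 | apply sqrt_le_1_alt; lra].
Qed.

End Sandwich.

(** * Monotonicity in x and under scaling *)

Lemma Rmin_scale (a r y : R) : 0 < a -> 0 <= y -> a <= r -> a <= 1 -> a * Rmin y 1 <= Rmin (r * y) 1.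
Proof.
  intros Ha Hy Hr H1. apply Rmin_glb.
  - apply Rmult_le_compat; try lra; [apply Rmin_glb; lra | apply Rmin_l].
  - generalize (Rmin_r y 1). nra.
Qed.

Section Monotonicity.

Variables U V W P Q psi Y : R -> R -> R.
Hypothesis HP : prandtl U V W P Q.
Hypothesis HV : von_mises U V psi Y.
Variables (f f1 f2 f3 : R -> R) (C1 C2 : R).
Hypothesis HB : blasius f f1 f2 f3 C1 C2.
Variable g : R -> R.
Hypothesis g_f : forall s, 0 <= s -> f (g s) = s.
Hypothesis f_g : forall z, 0 <= z -> g (f z) = z.
Hypothesis g_0 : g 0 = 0.
Hypothesis g_lt : forall s t, s < t -> g s < g t.
Hypothesis g_cont : forall s, continuous g s.
Hypothesis g_D : forall s, 0 < s -> is_derive g s (/ f1 (g s)).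

Notation phi := (vm_phi U Y).
Notation phi_x := (vm_phi_x Q Y).
Notation phi_p := (vm_phi_p P Y).
Notation phi_q := (vm_phi_q U Q Y).
Notation prof := (prof f1 g).

Variable b : R.
Hypothesis b_ge1 : 1 <= b.
Hypothesis low : forall x p, 0 <= x -> 0 <= p -> prof (p / sqrt (x + b)) <= phi x p.
Hypothesis up : forall x p, 0 < x -> 0 <= p -> phi x p <= prof (p / sqrt x).

Let sec_Y (x p : R) : continuous (Y x) p := cont2_sec Y x p (vm_Y_cont _ _ _ _ HV x p).

Let scaled_inverse (r : R) : 0 < r ->
  (forall p, continuous (fun p => r * g (p / r)) p) /\ r * g (0 / r) = 0 /\
  (forall p, 0 < p -> is_derive (fun p => r * g (p / r)) p (/ f1 (g (p / r)))).
Proof.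
  intros Hr. split; [ | split].
  - intros p. apply cont_mult; [apply cont_const | ]. apply (cont_comp (fun p => p / r) g); [ | apply g_cont].
    apply cont_mult; [apply continuous_id | apply cont_const].
  - rewrite Rdiv_0_l, g_0. ring.
  - intros p Hp. assert (Hs : 0 < p / r) by now apply Rdiv_lt_0_compat.
    assert (H1 := bl_f1_pos _ _ _ _ _ _ HB _ (g_pos g g_0 g_lt _ Hs)).
    assert (D : is_derive (fun p => g (p / r)) p (/ f1 (g (p / r)) * / r)).
    { apply (D_comp g (fun p => p / r)); [now apply g_D | ]. auto_derive; [exact I | field; lra]. }
    apply (D_eq _ _ _ _ (D_mult (fun _ => r) _ _ _ _ (D_const r p) D)). field. lra.
Qed.

Let sqrt_prof (s : R) : 0 <= s -> sqrt (prof s) = f1 (g s).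
Proof.
  intros Hs. rewrite (prof_eq f1 g g_0 g_lt) by auto. apply sqrt_square.
  assert (H := bl_f1_le _ _ _ _ _ _ HB 0 (g s) (Rle_refl 0) (g_ge0 g g_0 g_lt s Hs)).
  rewrite (bl_f10 _ _ _ _ _ _ HB) in H. exact H.
Qed.

Lemma Y_derive_sec (x p : R) : 0 < p -> is_derive (Y x) p (/ sqrt (phi x p)).
Proof. intros Hp. rewrite (sqrt_phi U V W P Q Y HP). now apply (vm_Y_p _ _ _ _ HV). Qed.

(** The bound on phi is used twice: integrated, it gives y <= r g(psi / r); evaluated at psi, it
    gives u >= f'(g(psi / r)). Monotonicity of f' joins the two. *)
Lemma U_lower (x y : R) : 0 <= x -> 0 <= y -> f1 (y / sqrt (x + b)) <= U x y.
Proof.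
  intros Hx Hy. set (r := sqrt (x + b)). assert (Hr : 0 < r) by (apply sqrt_lt_R0; lra).
  destruct (scaled_inverse r Hr) as [Hc [H0 HD]].
  assert (Hp := vm_psi_ge0 U V psi Y HV x y Hy).
  assert (Hp' : 0 <= psi x y / r) by (apply Rdiv_le_0_compat; lra).
  assert (Hle := inverse_compare (fun p => r * g (p / r)) (Y x) (fun p => f1 (g (p / r)))
    (fun p => sqrt (phi x p)) Hc (sec_Y x) H0 (vm_Y_0 _ _ _ _ HV x) HD (Y_derive_sec x)).
  specialize (Hle ltac:(intros p Hp1; assert (Hs : 0 < p / r) by (now apply Rdiv_lt_0_compat);
    split; [apply (bl_f1_pos _ _ _ _ _ _ HB), (g_pos g g_0 g_lt _ Hs) | ];
    rewrite <- (sqrt_prof (p / r)) by lra; apply sqrt_le_1_alt, low; lra) _ Hp).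
  rewrite (vm_Y_psi _ _ _ _ HV) in Hle.
  apply Rle_trans with (f1 (g (psi x y / r))).
  - apply (bl_f1_le _ _ _ _ _ _ HB); [apply Rdiv_le_0_compat; lra | ].
    apply Rmult_le_reg_l with r; auto. replace (r * (y / r)) with y by (field; lra). exact Hle.
  - rewrite <- sqrt_prof by auto. rewrite <- (sqrt_square (U x y)) by apply (U_nonneg _ _ _ _ _ HP).
    apply sqrt_le_1_alt. rewrite <- (phi_psi U V psi Y HV). now apply low.
Qed.

Lemma U_upper (x y : R) : 0 < x -> 0 <= y -> U x y <= f1 (y / sqrt x).
Proof.
  intros Hx Hy. set (r := sqrt x). assert (Hr : 0 < r) by (apply sqrt_lt_R0; lra).
  destruct (scaled_inverse r Hr) as [Hc [H0 HD]].
  assert (Hp := vm_psi_ge0 U V psi Y HV x y Hy).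
  assert (Hp' : 0 <= psi x y / r) by (apply Rdiv_le_0_compat; lra).
  assert (Hle := inverse_compare (Y x) (fun p => r * g (p / r)) (fun p => sqrt (phi x p))
    (fun p => f1 (g (p / r))) (sec_Y x) Hc (vm_Y_0 _ _ _ _ HV x) H0 (Y_derive_sec x) HD).
  specialize (Hle ltac:(intros p Hp1; assert (Hs : 0 < p / r) by (now apply Rdiv_lt_0_compat);
    split; [apply sqrt_lt_R0, (phi_pos U V W P Q psi Y HP HV); lra | ];
    rewrite <- (sqrt_prof (p / r)) by lra; apply sqrt_le_1_alt, up; lra) _ Hp).
  rewrite (vm_Y_psi _ _ _ _ HV) in Hle.
  apply Rle_trans with (f1 (g (psi x y / r))).
  - rewrite <- sqrt_prof by auto. rewrite <- (sqrt_square (U x y)) by apply (U_nonneg _ _ _ _ _ HP).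
    apply sqrt_le_1_alt. rewrite <- (phi_psi U V psi Y HV). now apply up.
  - apply (bl_f1_le _ _ _ _ _ _ HB); [now apply (g_ge0 g g_0 g_lt) | ].
    apply Rmult_le_reg_l with r; auto. replace (r * (y / r)) with y by (field; lra). exact Hle.
Qed.

Lemma min_lower (X : R) : 0 < X -> exists k, 0 < k /\
  (forall x y, 0 <= x <= X -> 0 <= y -> k * Rmin y 1 <= U x y) /\
  (forall x p, 0 <= x <= X -> 0 <= p -> k * Rmin p 1 <= phi x p).
Proof.
  intros HX. set (r := sqrt (X + b)).
  assert (Hr : 1 <= r) by (rewrite <- sqrt_1; apply sqrt_le_1_alt; lra).
  assert (Hf := bl_f1_pos _ _ _ _ _ _ HB 1 ltac:(lra)).
  assert (Hpr := prof_pos _ _ _ _ _ _ HB g g_0 g_lt 1 ltac:(lra)).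
  set (m := Rmin (f1 1) (prof 1)). assert (Hm : 0 < m) by (apply Rmin_glb_lt; lra).
  assert (Hir : 0 < / r <= 1).
  { split; [apply Rinv_0_lt_compat; lra | rewrite <- Rinv_1; apply Rinv_le_contravar; lra]. }
  assert (Key : forall x y, 0 <= x <= X -> 0 <= y -> / r * Rmin y 1 <= Rmin (y / sqrt (x + b)) 1).
  { intros x y Hx Hy. unfold Rdiv. rewrite (Rmult_comm y). apply Rmin_scale; try lra.
    apply Rinv_le_contravar; [apply sqrt_lt_R0; lra | apply sqrt_le_1_alt; lra]. }
  assert (Hpos : forall x y, 0 <= x <= X -> 0 <= y -> 0 <= y / sqrt (x + b)).
  { intros x y Hx Hy. apply Rdiv_le_0_compat; [auto | apply sqrt_lt_R0; lra]. }
  exists (m * / r). split; [apply Rmult_lt_0_compat; lra | ]. split.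
  - intros x y Hx Hy. apply Rle_trans with (2 := U_lower x y ltac:(lra) Hy).
    apply Rle_trans with (2 := bl_f1_ge_min _ _ _ _ _ _ HB _ (Hpos x y Hx Hy)).
    rewrite Rmult_assoc. apply Rmult_le_compat; auto; [lra | | apply Rmin_l].
    apply Rmult_le_pos; [lra | apply Rmin_glb; lra].
  - intros x p Hx Hp. apply Rle_trans with (2 := low x p ltac:(lra) Hp).
    apply Rle_trans with (2 := prof_ge_min _ _ _ _ _ _ HB g g_0 g_lt g_cont g_D _ (Hpos x p Hx Hp)).
    rewrite Rmult_assoc. apply Rmult_le_compat; auto; [lra | | apply Rmin_r].
    apply Rmult_le_pos; [lra | apply Rmin_glb; lra].
Qed.

Hypothesis U_bdd : forall X, 0 < X -> exists M, forall x y, 0 <= x <= X -> 0 <= y -> Rabs (U x y) <= M.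
Hypothesis P_bdd : forall X, 0 < X -> exists M, forall x y, 0 <= x <= X -> 0 <= y -> Rabs (P x y) <= M.
Hypothesis Q_bdd : forall X, 0 < X -> exists M, forall x y, 0 <= x <= X -> 0 <= y -> Rabs (Q x y) <= M.
Hypothesis W_bdd : forall X, 0 < X -> exists M, forall x y, 0 <= x <= X -> 0 <= y <= 1 -> Rabs (W x y) <= M.

(** Near the wall the equation u_yy = u u_x + v u_y and v = O(y) = O(u) show that u_yy / u is
    bounded above; for y > 1 the velocity is bounded below. The split at y = 1 reflects that u_x is
    bounded only locally in y. *)
Lemma phi_q_bdd (X : R) : 0 < X -> exists K, 0 <= K /\ forall x p, 0 < x <= X -> 0 < p -> phi_q x p <= K.
Proof.
  intros HX. destruct (min_lower X HX) as [k [Hk [HU _]]].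
  destruct (P_bdd X HX) as [Mp HMp]. destruct (Q_bdd X HX) as [Mq HMq]. destruct (W_bdd X HX) as [Mw HMw].
  assert (Hp0 : 0 <= Mp) by (generalize (HMp X 0 ltac:(lra) ltac:(lra)) (Rabs_pos (P X 0)); lra).
  assert (Hq0 : 0 <= Mq) by (generalize (HMq X 0 ltac:(lra) ltac:(lra)) (Rabs_pos (Q X 0)); lra).
  assert (Hw0 : 0 <= Mw) by (generalize (HMw X 0 ltac:(lra) ltac:(lra)) (Rabs_pos (W X 0)); lra).
  set (K := Mq / k + (Mw + Mw * Mp / k)).
  assert (K1 : 0 <= Mq / k) by (apply Rdiv_le_0_compat; lra).
  assert (K2 : 0 <= Mw * Mp / k) by (apply Rdiv_le_0_compat; nra).
  exists (2 * K). split; [unfold K; lra | ]. intros x p Hx Hp.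
  assert (Hy := vm_Y_pos U V psi Y HV x p Hp). set (y := Y x p) in *.
  unfold vm_phi_q. fold y.
  assert (HUy := HU x y ltac:(lra) ltac:(lra)).
  assert (HUp := pr_U_pos _ _ _ _ _ HP x y Hy).
  enough (HK : Q x y <= K * U x y).
  { apply Rmult_le_reg_r with (U x y); auto. replace (2 * Q x y / U x y * U x y) with (2 * Q x y) by (field; lra). lra. }
  destruct (Rle_dec y 1) as [Hy1 | Hy1].
  - rewrite Rmin_left in HUy by lra.
    assert (HVy : Rabs (V x y) <= Mw * y).
    { destruct (mvt (V x) (fun t => - W x t) 0 y Hy) as [c [Hc E]].
      - intros t Ht. apply (pr_V_y _ _ _ _ _ HP); lra.
      - intros t _. apply cont2_sec, (pr_V_cont _ _ _ _ _ HP).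
      - rewrite (pr_V_0 _ _ _ _ _ HP), !Rminus_0_r in E. rewrite E, Rabs_mult, Rabs_Ropp, (Rabs_right y) by lra.
        apply Rmult_le_compat_r; [lra | ]. apply HMw; lra. }
    assert (E := pr_eq _ _ _ _ _ HP x y ltac:(lra) Hy).
    assert (HW := HMw x y ltac:(lra) ltac:(lra)). assert (HPp := HMp x y ltac:(lra) ltac:(lra)).
    assert (HVP : Rabs (V x y * P x y) <= Mw * y * Mp).
    { rewrite Rabs_mult. apply Rmult_le_compat; auto using Rabs_pos. }
    apply Rabs_le_between in HW, HVP.
    assert (HyU : y <= U x y / k) by (apply Rmult_le_reg_r with k; auto; replace (U x y / k * k) with (U x y) by (field; lra); lra).
    assert (Mw * y * Mp <= Mw * Mp / k * U x y).
    { replace (Mw * Mp / k * U x y) with (Mw * Mp * (U x y / k)) by (field; lra).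
      replace (Mw * y * Mp) with (Mw * Mp * y) by ring. apply Rmult_le_compat_l; nra. }
    unfold K. nra.
  - rewrite Rmin_right in HUy by lra.
    assert (HQ := HMq x y ltac:(lra) ltac:(lra)). apply Rabs_le_between in HQ.
    assert (Mq <= Mq / k * U x y).
    { replace Mq with (Mq / k * k) at 1 by (field; lra). apply Rmult_le_compat_l; lra. }
    unfold K. nra.
Qed.

Variables u1 u2 : R -> R.
Hypothesis init_D1 : forall y, 0 < y -> is_derive (U 0) y (u1 y).
Hypothesis init_D2 : forall y, 0 < y -> is_derive u1 y (u2 y).
Hypothesis init_u2 : forall y, 0 < y -> u2 y <= 0.
Hypothesis init_incr : forall y1 y2, 0 <= y1 -> y1 <= y2 -> U 0 y1 <= U 0 y2.

Lemma phi_le_initial (x p : R) : 0 <= x -> 0 <= p -> phi x p <= phi 0 p.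
Proof.
  intros Hx Hp. destruct (phi_bdd U V W P Q psi Y HP HV U_bdd (x + 1) ltac:(lra)) as [M HM].
  apply (vm_comparison_concave (x + 1) M phi phi_x phi_p phi_q
    (fun _ p => phi 0 p) (fun _ _ => 0) (fun _ p => 2 * u1 (Y 0 p)) (fun _ p => 2 * u2 (Y 0 p) / U 0 (Y 0 p))); try lra.
  - now apply (phi_regular U V W P Q psi Y).
  - split; [intros s q _ _; apply (cont2_of_snd (phi 0)), cont2_sec, (phi_cont U V W P Q psi Y HP HV) | ].
    split; [intros; apply D_const | ].
    assert (HY : forall q, 0 < q -> 0 < Y 0 q) by (intros; now apply (vm_Y_pos U V psi Y HV)).
    split; [ | split].
    + intros s q _ Hq. assert (HU := pr_U_pos _ _ _ _ _ HP 0 _ (HY q Hq)).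
      assert (D : is_derive (fun q => U 0 (Y 0 q)) q (u1 (Y 0 q) * / U 0 (Y 0 q))).
      { apply (D_comp (U 0) (Y 0)); [now apply init_D1, HY | now apply (vm_Y_p _ _ _ _ HV)]. }
      apply (D_eq _ _ _ _ (D_mult _ _ _ _ _ D D)). field. lra.
    + intros s q _ Hq. assert (HU := pr_U_pos _ _ _ _ _ HP 0 _ (HY q Hq)).
      assert (D : is_derive (fun q => u1 (Y 0 q)) q (u2 (Y 0 q) * / U 0 (Y 0 q))).
      { apply (D_comp u1 (Y 0)); [now apply init_D2, HY | now apply (vm_Y_p _ _ _ _ HV)]. }
      apply (D_eq _ _ _ _ (D_mult (fun _ => 2) _ _ _ _ (D_const 2 q) D)). field. lra.
    + intros s q _ Hq. now apply (phi_pos U V W P Q psi Y HP HV).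
  - intros s q Hs Hq. right. now apply (phi_eq U V W P Q psi Y).
  - intros s q Hs Hq. rewrite (sqrt_phi U V W P Q Y HP).
    assert (HY := vm_Y_pos U V psi Y HV 0 q Hq). assert (HU := pr_U_pos _ _ _ _ _ HP 0 _ HY).
    replace (U 0 (Y 0 q) * (2 * u2 (Y 0 q) / U 0 (Y 0 q))) with (2 * u2 (Y 0 q)) by (field; lra).
    specialize (init_u2 _ HY). lra.
  - intros s q Hs Hq. specialize (HM s q Hs Hq). generalize (phi_ge0 U Y 0 q). lra.
  - intros q Hq. apply Rle_refl.
  - intros s Hs. cbv beta. rewrite !(phi_at_0 U V W P Q psi Y HP HV). lra.
  - intros s q Hs Hq. right. assert (HY := vm_Y_pos U V psi Y HV 0 q Hq).
    assert (HU := pr_U_pos _ _ _ _ _ HP 0 _ HY). specialize (init_u2 _ HY).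
    assert (0 < / U 0 (Y 0 q)) by now apply Rinv_0_lt_compat. unfold Rdiv. nra.
Qed.

Lemma phi_decr (x h p : R) : 0 <= x -> 0 <= h -> 0 <= p -> phi (x + h) p <= phi x p.
Proof.
  intros Hx Hh Hp. set (X := x + h + 1).
  destruct (phi_bdd U V W P Q psi Y HP HV U_bdd X ltac:(unfold X; lra)) as [M HM].
  destruct (phi_q_bdd X ltac:(unfold X; lra)) as [K [HK HqK]].
  destruct (min_lower X ltac:(unfold X; lra)) as [k [Hk [_ Hphi]]].
  destruct (phi_regular U V W P Q psi Y HP HV X) as [R0 [R1 [R2 [R3 R4]]]].
  apply (vm_comparison_bounded (x + 1) M K k
    (fun x p => phi (x + h) p) (fun x p => phi_x (x + h) p) (fun x p => phi_p (x + h) p) (fun x p => phi_q (x + h) p)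
    phi phi_x phi_p phi_q); auto; try lra.
  - split; [ | split; [ | split; [ | split]]].
    + intros s q Hs Hq. apply (cont2_comp phi (fun z => fst z + h) snd).
      * apply cont_plus; [apply continuous_fst | apply cont_const].
      * apply continuous_snd.
      * apply R0; unfold X; simpl; lra.
    + intros s q Hs Hq. apply (D_eq _ _ (phi_x (s + h) q * (1 + 0))); [ | ring].
      apply (D_comp (fun s => phi s q) (fun s => s + h)); [apply R1; auto; unfold X; lra | ].
      apply D_plus; [apply D_id | apply D_const].
    + intros s q Hs Hq. apply R2; auto; unfold X; lra.
    + intros s q Hs Hq. apply R3; auto; unfold X; lra.
    + intros s q Hs Hq. apply R4; auto; unfold X; lra.
  - now apply (phi_regular U V W P Q psi Y).
  - intros s q Hs Hq. right. now apply (phi_eq U V W P Q psi Y).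
  - intros s q Hs Hq. right. symmetry. now apply (phi_eq U V W P Q psi Y).
  - intros s q Hs Hq. specialize (HM (s + h) q ltac:(unfold X; lra) Hq). generalize (phi_ge0 U Y s q). lra.
  - intros q Hq. apply phi_le_initial; lra.
  - intros s Hs. cbv beta. rewrite !(phi_at_0 U V W P Q psi Y HP HV). lra.
  - intros s q Hs Hq. right. apply HqK; auto. unfold X; lra.
  - intros s q Hs Hq. apply Hphi; unfold X; lra.
Qed.

Lemma phi_scaling (x l p : R) : 0 <= x -> 1 <= l -> 0 <= p -> phi x p <= phi (l * l * x) (l * p).
Proof.
  intros Hx Hl Hp. set (X := x + 1). set (X' := l * l * X).
  assert (Hl2 : 1 <= l * l) by nra.
  assert (HX' : 0 < X') by (unfold X', X; nra).
  destruct (phi_bdd U V W P Q psi Y HP HV U_bdd X ltac:(unfold X; lra)) as [M HM].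
  destruct (phi_q_bdd X ltac:(unfold X; lra)) as [K [HK HqK]].
  destruct (min_lower X' HX') as [k [Hk [_ Hphi]]].
  destruct (phi_regular U V W P Q psi Y HP HV X') as [R0 [R1 [R2 [R3 R4]]]].
  assert (Hdom : forall s, 0 <= s <= X -> 0 <= l * l * s <= X').
  { intros s Hs. unfold X'. split; [apply Rmult_le_pos; lra | apply Rmult_le_compat_l; lra]. }
  assert (Hdom' : forall s, 0 < s <= X -> 0 < l * l * s <= X').
  { intros s Hs. unfold X'. split; [apply Rmult_lt_0_compat; lra | apply Rmult_le_compat_l; lra]. }
  apply (vm_comparison_bounded X M K k phi phi_x phi_p phi_q
    (fun x p => phi (l * l * x) (l * p)) (fun x p => phi_x (l * l * x) (l * p) * (l * l))
    (fun x p => phi_p (l * l * x) (l * p) * l) (fun x p => phi_q (l * l * x) (l * p) * l * l));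
    auto; try (unfold X; lra).
  - now apply (phi_regular U V W P Q psi Y).
  - split; [ | split; [ | split; [ | split]]].
    + intros s q Hs Hq. apply (cont2_comp phi (fun z => l * l * fst z) (fun z => l * snd z)).
      * apply cont_mult; [apply cont_const | apply continuous_fst].
      * apply cont_mult; [apply cont_const | apply continuous_snd].
      * apply R0; simpl; [now apply Hdom | nra].
    + intros s q Hs Hq. apply (D_comp (fun s => phi s (l * q)) (fun s => l * l * s)).
      * apply R1; [now apply Hdom' | nra].
      * auto_derive; [exact I | ring].
    + intros s q Hs Hq. apply (D_comp (phi (l * l * s)) (fun q => l * q)).
      * apply R2; [now apply Hdom' | nra].
      * auto_derive; [exact I | ring].
    + intros s q Hs Hq. apply (D_eq _ _ (phi_q (l * l * s) (l * q) * l * l + phi_p (l * l * s) (l * q) * 0)); [ | ring].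
      apply (D_mult (fun q => phi_p (l * l * s) (l * q)) (fun _ => l)); [ | apply D_const].
      apply (D_comp (phi_p (l * l * s)) (fun q => l * q)).
      * apply R3; [now apply Hdom' | nra].
      * auto_derive; [exact I | ring].
    + intros s q Hs Hq. apply R4; [now apply Hdom' | nra].
  - intros s q Hs Hq. right. now apply (phi_eq U V W P Q psi Y).
  - intros s q Hs Hq. right. rewrite (phi_eq U V W P Q psi Y HP HV _ (l * q)) by nra. ring.
  - intros s q Hs Hq. specialize (HM s q Hs Hq). generalize (phi_ge0 U Y (l * l * s) (l * q)). lra.
  (* At x = 0 the ordering is the monotonicity of the datum, because l q >= q. *)
  - intros q Hq. rewrite Rmult_0_r. unfold vm_phi.
    assert (H0 := vm_Y_ge0 U V psi Y HV 0 q Hq).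
    assert (H1 : Y 0 q <= Y 0 (l * q)).
    { destruct (Req_dec q (l * q)) as [<- | E]; [lra | ]. left. apply (vm_Y_lt _ _ _ _ HV). nra. }
    assert (H2 := init_incr _ _ H0 H1). assert (H3 := U_nonneg _ _ _ _ _ HP 0 (Y 0 q)).
    apply Rmult_le_compat; auto.
  - intros s Hs. cbv beta. rewrite Rmult_0_r, !(phi_at_0 U V W P Q psi Y HP HV). lra.
  - intros s q Hs Hq. apply Rle_trans with (2 := Hphi (l * l * s) (l * q) (Hdom s ltac:(lra)) ltac:(nra)).
    apply Rmult_le_compat_l; [lra | ]. apply Rmin_glb; [ | apply Rmin_r].
    apply Rle_trans with (1 := Rmin_l _ _). nra.
Qed.

Lemma phi_x_le0 (x p : R) : 0 < x -> 0 < p -> phi_x x p <= 0.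
Proof.
  intros Hx Hp. apply (derive_le_right (fun s => phi s p) x _ 0 1 Rlt_0_1).
  - now apply (phi_Dx U V W P Q psi Y).
  - intros t Ht. generalize (phi_decr x (t - x) p ltac:(lra) ltac:(lra) ltac:(lra)).
    replace (x + (t - x)) with t by ring. lra.
Qed.

(** As phi decreases in x at fixed psi, 1 / sqrt phi increases and streamlines move away from the
    wall; at p = psi x y this says v >= 0. *)
Lemma Y_x_ge0 (x p : R) : 0 < x -> 0 < p -> 0 <= V x (Y x p) / U x (Y x p).
Proof.
  intros Hx Hp. apply (derive_ge_right (fun s => Y s p) x _ 0 1 Rlt_0_1).
  - now apply (vm_Y_x _ _ _ _ HV).
  - intros t Ht. rewrite Rmult_0_l, Rplus_0_r.
    apply (inverse_compare (Y t) (Y x) (fun p => sqrt (phi t p)) (fun p => sqrt (phi x p)) (sec_Y t) (sec_Y x)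
      (vm_Y_0 _ _ _ _ HV t) (vm_Y_0 _ _ _ _ HV x) (Y_derive_sec t) (Y_derive_sec x)); [ | lra].
    intros q Hq. split; [apply sqrt_lt_R0, (phi_pos U V W P Q psi Y HP HV); lra | ].
    apply sqrt_le_1_alt. replace t with (x + (t - x)) by ring. apply phi_decr; lra.
Qed.

(* Differentiation at [l = 1] along the scaling [(l^2 x, l p)], under which the von Mises
   equation is invariant. *)
Lemma scaling_derive (G Gx Gp : R -> R -> R) (x p : R) : 0 < x -> 0 < p ->
  (forall x p, 0 < x -> 0 < p -> is_derive (fun s => G s p) x (Gx x p)) ->
  (forall x p, 0 < x -> 0 < p -> is_derive (G x) p (Gp x p)) ->
  cont2 Gp x p ->
  is_derive (fun l => G (l * l * x) (l * p)) 1 (2 * x * Gx x p + p * Gp x p).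
Proof.
  intros Hx Hp Dx Dp Hc.
  apply (D_eq _ _ (Gx x p * (2 * x) + Gp (1 * 1 * x) p * p)); [ | rewrite !Rmult_1_l; ring].
  apply (derive_along_curve (fun l q => G (l * l * x) q) (fun l q => Gp (l * l * x) q) (fun l => l * p) 1 p _ _
    (Rmin 1 p)).
  - apply Rmin_glb_lt; lra.
  - apply (D_comp (fun s => G s p) (fun l => l * l * x)).
    + rewrite !Rmult_1_l. now apply Dx.
    + auto_derive; [exact I | ring].
  - intros t q Ht Hq. assert (L1 := Rmin_l 1 p). assert (L2 := Rmin_r 1 p).
    assert (0 < t) by (apply (near_pos 1); lra). assert (0 < q) by (apply (near_pos p); lra).
    apply Dp; auto. repeat apply Rmult_lt_0_compat; auto.
  - apply (cont2_comp Gp (fun z => fst z * fst z * x) snd).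
    + apply cont_mult; [apply cont_mult; apply continuous_fst | apply cont_const].
    + apply continuous_snd.
    + simpl. now rewrite !Rmult_1_l.
  - ring.
  - auto_derive; [exact I | ring].
Qed.

Lemma phi_scaling_derive (x p : R) : 0 < x -> 0 < p -> 0 <= 2 * x * phi_x x p + p * phi_p x p.
Proof.
  intros Hx Hp. apply (derive_ge_right (fun l => phi (l * l * x) (l * p)) 1 _ 0 1 Rlt_0_1).
  - apply scaling_derive; auto.
    + intros; now apply (phi_Dx U V W P Q psi Y).
    + intros; now apply (phi_Dp U V W P Q psi Y).
    + now apply (phi_p_cont U V W P Q psi Y).
  - intros t Ht. rewrite !Rmult_1_l, Rmult_0_l, Rplus_0_r. apply phi_scaling; lra.
Qed.

(** For l > 1 the inequality phi(l^2 x, l p) >= phi(x, p) integrates to Y(l^2 x, l p) <= l Y(x, p),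
    an equality at l = 1, where it is differentiated. At p = psi x y the result reads 2 x v + psi <=
    y u. *)
Lemma Y_scaling_derive (x p : R) : 0 < x -> 0 < p ->
  2 * x * (V x (Y x p) / U x (Y x p)) + p * / U x (Y x p) <= Y x p.
Proof.
  intros Hx Hp.
  apply (derive_le_right (fun l => Y (l * l * x) (l * p)) 1 _ (Y x p) 1 Rlt_0_1).
  - apply (scaling_derive Y (fun x p => V x (Y x p) / U x (Y x p)) (fun x p => / U x (Y x p))); auto.
    + intros; now apply (vm_Y_x _ _ _ _ HV).
    + intros; now apply (vm_Y_p _ _ _ _ HV).
    + apply (cont_comp (fun z : R * R => U (fst z) (Y (fst z) (snd z))) Rinv).
      * apply (comp_Y_cont U V psi Y HV U), (pr_U_cont _ _ _ _ _ HP).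
      * apply continuous_Rinv. apply Rgt_not_eq, (pr_U_pos _ _ _ _ _ HP), (vm_Y_pos U V psi Y HV). exact Hp.
  - intros l Hl. rewrite !Rmult_1_l.
    enough (H : Y (l * l * x) (l * p) * / l <= Y x p).
    { apply Rmult_le_compat_r with (r := l) in H; [ | lra].
      rewrite Rmult_assoc, Rinv_l, Rmult_1_r in H by lra. lra. }
    apply (inverse_compare (Y x) (fun p => Y (l * l * x) (l * p) * / l) (fun p => sqrt (phi x p))
      (fun p => sqrt (phi (l * l * x) (l * p)))); auto; try lra.
    + intros q. apply cont_mult; [ | apply cont_const].
      apply (cont_comp (fun q => l * q) (Y (l * l * x))); [ | apply sec_Y].
      apply cont_mult; [apply cont_const | apply continuous_id].
    + apply (vm_Y_0 _ _ _ _ HV).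
    + rewrite Rmult_0_r, (vm_Y_0 _ _ _ _ HV). ring.
    + apply Y_derive_sec.
    + intros q Hq. assert (Hq' : 0 < l * q) by nra.
      assert (Hs : 0 < sqrt (phi (l * l * x) (l * q))) by now apply sqrt_lt_R0, (phi_pos U V W P Q psi Y HP HV).
      assert (D : is_derive (fun q => Y (l * l * x) (l * q)) q (/ sqrt (phi (l * l * x) (l * q)) * l)).
      { apply (D_comp (Y (l * l * x)) (fun q => l * q)); [now apply Y_derive_sec | ].
        auto_derive; [exact I | ring]. }
      apply (D_eq _ _ _ _ (D_mult _ (fun _ => / l) _ _ _ D (D_const (/ l) q))). field. lra.
    + intros q Hq. split; [apply sqrt_lt_R0, (phi_pos U V W P Q psi Y HP HV); lra | ].
      apply sqrt_le_1_alt, phi_scaling; lra.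
Qed.

End Monotonicity.

(** * Decay of the first and second derivatives *)

Lemma poly_gauss (c t : R) : 0 < c -> 0 <= t -> t * exp (- c * t ^ 2) <= (1 + 2 / c) * exp (- (c / 2) * t ^ 2).
Proof.
  intros Hc Ht.
  assert (E : exp (- c * t ^ 2) = exp (- (c / 2) * t ^ 2) * exp (- (c / 2) * t ^ 2)).
  { rewrite <- exp_plus. f_equal. field. }
  assert (H : exp (- (c / 2) * t ^ 2) * (1 + c / 2 * t ^ 2) <= 1).
  { apply Rle_trans with (exp (- (c / 2) * t ^ 2) * exp (c / 2 * t ^ 2)).
    - apply Rmult_le_compat_l; [left; apply exp_pos | apply exp_ineq1_le].
    - rewrite <- exp_plus, <- exp_0. right. f_equal. ring. }
  assert (H2 : t <= (1 + 2 / c) * (1 + c / 2 * t ^ 2)).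
  { replace ((1 + 2 / c) * (1 + c / 2 * t ^ 2)) with (1 + 2 / c + c / 2 * t ^ 2 + t ^ 2) by (field; lra).
    assert (0 <= 2 / c) by (apply Rdiv_le_0_compat; lra).
    assert (0 <= c / 2 * t ^ 2) by (apply Rmult_le_pos; [lra | apply pow2_ge_0]).
    assert (0 <= (t - 1) ^ 2) by apply pow2_ge_0. nra. }
  rewrite E. set (e := exp (- (c / 2) * t ^ 2)) in *. assert (He : 0 < e) by apply exp_pos.
  assert (0 < 1 + 2 / c) by (assert (0 < 2 / c) by (apply Rdiv_lt_0_compat; lra); lra).
  apply Rle_trans with ((1 + 2 / c) * (1 + c / 2 * t ^ 2) * (e * e)).
  - rewrite <- Rmult_assoc. rewrite (Rmult_assoc _ e e). apply Rmult_le_compat_r; nra.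
  - replace ((1 + 2 / c) * (1 + c / 2 * t ^ 2) * (e * e)) with ((1 + 2 / c) * e * (e * (1 + c / 2 * t ^ 2))) by ring.
    assert (0 < (1 + 2 / c) * e) by (apply Rmult_lt_0_compat; lra). nra.
Qed.

Lemma gauss_le (c c' s t : R) : 0 <= c' * t -> c' * t <= c * s -> exp (- c * s) <= exp (- c' * t).
Proof. intros H1 H2. apply exp_le. lra. Qed.

Lemma sq_div_sqrt (y x : R) : 0 < x -> (y / sqrt x) ^ 2 = y ^ 2 / x.
Proof.
  intros Hx. assert (Hr : 0 < sqrt x) by now apply sqrt_lt_R0.
  rewrite <- (sqrt_sqrt x) at 2 by lra. field. lra.
Qed.

(** A step of fixed length 1 suffices here: the function and its second derivative will both be
    O(1/x) with Gaussian weight, so optimising the step would not improve the power of x. *)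
Lemma derivative_interpolation (d d' d'' : R -> R) (y A B : R) :
  (forall t, y <= t <= y + 1 -> is_derive d t (d' t)) ->
  (forall t, y <= t <= y + 1 -> is_derive d' t (d'' t)) ->
  (forall t, y <= t <= y + 1 -> Rabs (d t) <= A) ->
  (forall t, y <= t <= y + 1 -> Rabs (d'' t) <= B) ->
  Rabs (d' y) <= 2 * A + B.
Proof.
  intros D1 D2 HA HB.
  destruct (mvt d d' y (y + 1)) as [e [He E]]; [lra | intros; apply D1; lra | | ].
  { intros t Ht. apply (cont_of_derive _ _ (d' t)), D1; lra. }
  destruct (mvt d' d'' y e) as [x [Hx F]]; [lra | intros; apply D2; lra | | ].
  { intros t Ht. apply (cont_of_derive _ _ (d'' t)), D2; lra. }
  assert (A1 := HA y ltac:(lra)). assert (A2 := HA (y + 1) ltac:(lra)). assert (B1 := HB x ltac:(lra)).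
  apply Rabs_le_between in A1, A2, B1. apply Rabs_le. nra.
Qed.

Section Decay.

Variables U V W P Q psi : R -> R -> R.
Variables (f f1 f2 f3 : R -> R) (C1 C2 : R).
Hypothesis HB : blasius f f1 f2 f3 C1 C2.
Variable b : R.
Hypothesis b_ge1 : 1 <= b.
Hypothesis U_0 : forall x, U x 0 = 0.
Hypothesis U_cont : forall x y, cont2 U x y.
Hypothesis U_y : forall x y, 0 < x -> 0 < y -> is_derive (U x) y (P x y).
Hypothesis P_y : forall x y, 0 < x -> 0 < y -> is_derive (P x) y (Q x y).
Hypothesis U_pos : forall x y, 0 < y -> 0 < U x y.
Hypothesis psi_pos : forall x y, 0 < y -> 0 < psi x y.
Hypothesis eq_U : forall x y, 0 < x -> 0 < y -> U x y * W x y + V x y * P x y - Q x y = 0.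
Hypothesis U_low : forall x y, 0 <= x -> 0 <= y -> f1 (y / sqrt (x + b)) <= U x y.
Hypothesis U_up : forall x y, 0 < x -> 0 <= y -> U x y <= f1 (y / sqrt x).
Hypothesis Q_le0 : forall x y, 0 < x -> 0 < y -> Q x y <= 0.
Hypothesis Q_ge : forall x y, 0 < x -> 0 < y -> 0 <= 2 * x * Q x y + psi x y * P x y.
Hypothesis V_ge0 : forall x y, 0 < x -> 0 < y -> 0 <= V x y.
Hypothesis V_le : forall x y, 0 < x -> 0 < y -> 2 * x * V x y + psi x y <= y * U x y.

Lemma P_ge0 (x y : R) : 0 < x -> 0 < y -> 0 <= P x y.
Proof.
  intros Hx Hy. specialize (Q_le0 x y Hx Hy). specialize (Q_ge x y Hx Hy). specialize (psi_pos x y Hy).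
  apply Rnot_lt_le. intros Hn. nra.
Qed.

Lemma U_lt1 (x y : R) : 0 < x -> 0 <= y -> U x y <= 1.
Proof.
  intros Hx Hy. apply Rle_trans with (1 := U_up x y Hx Hy). left.
  apply (bl_f1_lt1 _ _ _ _ _ _ HB). apply Rdiv_le_0_compat; [auto | now apply sqrt_lt_R0].
Qed.

Lemma psi_le_y (x y : R) : 0 < x -> 0 < y -> psi x y <= y.
Proof.
  intros Hx Hy. specialize (V_ge0 x y Hx Hy). specialize (V_le x y Hx Hy).
  assert (H := U_lt1 x y Hx ltac:(lra)).
  assert (0 <= 2 * x * V x y) by (apply Rmult_le_pos; lra). nra.
Qed.

Lemma Q_abs (x y : R) : 0 < x -> 0 < y -> Rabs (Q x y) <= psi x y * P x y / (2 * x).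
Proof.
  intros Hx Hy. rewrite Rabs_left1 by auto. specialize (Q_ge x y Hx Hy).
  apply Rmult_le_reg_r with (2 * x); [lra | ].
  replace (psi x y * P x y / (2 * x) * (2 * x)) with (psi x y * P x y) by (field; lra). lra.
Qed.

(** In 2 x u u_x = 2 x u_yy - 2 x v u_y the two scaling inequalities bound the right side below by
    -psi u_y - (y u - psi) u_y; the terms in psi cancel and leave -y u u_y. *)
Lemma W_bounds (x y : R) : 0 < x -> 0 < y -> - (y * P x y / (2 * x)) <= W x y <= 0.
Proof.
  intros Hx Hy. assert (HPp := P_ge0 x y Hx Hy). assert (Hu := U_pos x y Hy).
  specialize (eq_U x y Hx Hy). specialize (Q_le0 x y Hx Hy). specialize (Q_ge x y Hx Hy).
  specialize (V_ge0 x y Hx Hy). specialize (V_le x y Hx Hy).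
  assert (E : U x y * W x y = Q x y - V x y * P x y) by lra. split.
  - apply Rmult_le_reg_l with (2 * x * U x y); [apply Rmult_lt_0_compat; lra | ].
    replace (2 * x * U x y * - (y * P x y / (2 * x))) with (- (y * U x y * P x y)) by (field; lra).
    replace (2 * x * U x y * W x y) with (2 * x * (U x y * W x y)) by ring. rewrite E.
    assert ((2 * x * V x y + psi x y) * P x y <= y * U x y * P x y) by (apply Rmult_le_compat_r; auto). nra.
  - apply Rmult_le_reg_l with (U x y); auto. rewrite E, Rmult_0_r. nra.
Qed.

Lemma P_decr (x a c : R) : 0 < x -> 0 < a -> a <= c -> P x c <= P x a.
Proof.
  intros Hx Ha Hac. enough (- P x a <= - P x c) by lra.
  apply (nondecr_of_derive (fun y => - P x y) (fun y => - Q x y)); auto.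
  - intros; apply D_opp, P_y; lra.
  - intros t Ht. specialize (Q_le0 x t Hx ltac:(lra)). lra.
  - intros t Ht. apply cont_opp, (cont_of_derive _ _ (Q x t)), P_y; lra.
Qed.

Lemma P_le_quotient (x a y : R) : 0 < x -> 0 <= a -> a < y -> P x y <= (U x y - U x a) / (y - a).
Proof.
  intros Hx Ha Hay. destruct (mvt (U x) (P x) a y Hay) as [e [He E]].
  - intros; apply U_y; lra.
  - intros; apply cont2_sec, U_cont.
  - rewrite E. replace (P x e * (y - a) / (y - a)) with (P x e) by (field; lra). apply P_decr; lra.
Qed.

(** By concavity u_y(y) is at most the slope of any chord ending at y. For y >= sqrt x the chord
    from y/2 gives (2/y)(1 - u(y/2)) and the Gaussian tail; for y < sqrt x the chord from 0 gives
    f''(0) / sqrt x. The 4 in c' comes from y/2, the 1 + b from x + b <= (1 + b) x. *)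
Lemma P_gauss : exists C c, 0 < C /\ 0 < c /\ forall x y, 1 <= x -> 0 < y ->
  P x y <= C / sqrt x * exp (- c * (y ^ 2 / x)).
Proof.
  destruct (bl_upper _ _ _ _ _ _ HB) as [K [c [HK [Hc Hup]]]].
  assert (Hf2 := bl_f2_pos _ _ _ _ _ _ HB 0 ltac:(lra)).
  set (c' := c / (4 * (1 + b))). assert (Hc' : 0 < c') by (apply Rdiv_lt_0_compat; lra).
  exists (2 * K + f2 0 * exp c'), c'. split; [ | split; [auto | ]].
  { assert (0 < f2 0 * exp c') by (apply Rmult_lt_0_compat; [auto | apply exp_pos]). lra. }
  intros x y Hx Hy. set (r := sqrt x). assert (Hr : 0 < r) by (apply sqrt_lt_R0; lra).
  assert (Er : r * r = x) by (apply sqrt_sqrt; lra).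
  set (E := exp (- c' * (y ^ 2 / x))). assert (HE : 0 < E) by apply exp_pos.
  destruct (Rle_dec r y) as [Hry | Hry].
  - assert (H1 : P x y <= 2 / y * (1 - U x (y / 2))).
    { apply Rle_trans with (1 := P_le_quotient x (y / 2) y ltac:(lra) ltac:(lra) ltac:(lra)).
      replace ((U x y - U x (y / 2)) / (y - y / 2)) with (2 / y * (U x y - U x (y / 2))) by (field; lra).
      apply Rmult_le_compat_l; [apply Rdiv_le_0_compat; lra | ].
      generalize (U_lt1 x y ltac:(lra) ltac:(lra)). lra. }
    assert (H2 : 1 - U x (y / 2) <= K * E).
    { specialize (U_low x (y / 2) ltac:(lra) ltac:(lra)).
      assert (Hz : 0 <= y / 2 / sqrt (x + b)) by (apply Rdiv_le_0_compat; [lra | apply sqrt_lt_R0; lra]).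
      destruct (Hup _ Hz) as [H2 _]. rewrite sq_div_sqrt in H2 by lra.
      apply Rle_trans with (K * exp (- c * ((y / 2) ^ 2 / (x + b)))); [lra | ].
      apply Rmult_le_compat_l; [lra | ]. apply gauss_le.
      - apply Rmult_le_pos; [lra | apply Rdiv_le_0_compat; [apply pow2_ge_0 | lra]].
      - replace (c' * (y ^ 2 / x)) with (c * (y ^ 2 / 4) * / ((1 + b) * x)) by (unfold c'; field; lra).
        replace (c * ((y / 2) ^ 2 / (x + b))) with (c * (y ^ 2 / 4) * / (x + b)) by (field; lra).
        apply Rmult_le_compat_l.
        + apply Rmult_le_pos; [lra | ]. generalize (pow2_ge_0 y). lra.
        + apply Rinv_le_contravar; nra. }
    assert (H3 : / y <= / r) by (apply Rinv_le_contravar; auto).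
    apply Rle_trans with (1 := H1). apply Rle_trans with (2 / r * (K * E)).
    + apply Rmult_le_compat; auto.
      * apply Rdiv_le_0_compat; lra.
      * generalize (U_lt1 x (y / 2) ltac:(lra) ltac:(lra)). lra.
      * unfold Rdiv. lra.
    + replace ((2 * K + f2 0 * exp c') / r * E) with (2 / r * (K * E) + f2 0 * exp c' * E / r) by (field; lra).
      assert (0 <= f2 0 * exp c' * E / r).
      { apply Rdiv_le_0_compat; auto. repeat apply Rmult_le_pos; try lra. left; apply exp_pos. }
      lra.
  - assert (H1 : P x y <= f2 0 / r).
    { apply Rle_trans with (1 := P_le_quotient x 0 y ltac:(lra) ltac:(lra) Hy).
      rewrite U_0, !Rminus_0_r. apply Rmult_le_reg_r with y; auto.
      replace (U x y / y * y) with (U x y) by (field; lra).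
      apply Rle_trans with (1 := U_up x y ltac:(lra) ltac:(lra)). fold r.
      assert (Hyr : 0 <= y / r) by (apply Rdiv_le_0_compat; lra).
      assert (H := bl_f1_diff _ _ _ _ _ _ HB 0 (y / r) (Rle_refl 0) Hyr).
      rewrite (bl_f10 _ _ _ _ _ _ HB), !Rminus_0_r in H. replace (f2 0 / r * y) with (f2 0 * (y / r)) by (field; lra). exact H. }
    assert (H2 : 1 <= exp c' * E).
    { unfold E. rewrite <- exp_plus, <- exp_0. apply exp_le.
      assert (y ^ 2 / x <= 1).
      { apply Rmult_le_reg_r with x; [lra | ]. replace (y ^ 2 / x * x) with (y ^ 2) by (field; lra). nra. }
      nra. }
    apply Rle_trans with (1 := H1). unfold Rdiv at 2.
    apply Rle_trans with (f2 0 * exp c' * / r * E).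
    + replace (f2 0 * exp c' * / r * E) with (f2 0 / r * (exp c' * E)) by (field; lra).
      assert (0 <= f2 0 / r) by (apply Rdiv_le_0_compat; lra). nra.
    + assert (0 < / r) by now apply Rinv_0_lt_compat.
      apply Rmult_le_compat_r; [lra | ]. apply Rmult_le_compat_r; lra.
Qed.

Lemma decay_bounds : exists C c, 0 < C /\ 0 < c /\ forall x y, 1 <= x -> 0 < y ->
  P x y <= C / sqrt x * exp (- c * (y ^ 2 / x)) /\
  Rabs (Q x y) <= C / x * exp (- c * (y ^ 2 / x)) /\
  Rabs (W x y) <= C / x * exp (- c * (y ^ 2 / x)).
Proof.
  destruct P_gauss as [C [c [HC [Hc HPg]]]].
  set (C' := C * (1 + 2 / c)). assert (Hc2 : 0 < 2 / c) by (apply Rdiv_lt_0_compat; lra).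
  assert (HC' : C <= C') by (unfold C'; nra).
  exists C', (c / 2). split; [lra | split; [lra | ]]. intros x y Hx Hy.
  specialize (HPg x y Hx Hy). set (r := sqrt x) in *.
  assert (Hr : 0 < r) by (apply sqrt_lt_R0; lra). assert (Er : r * r = x) by (apply sqrt_sqrt; lra).
  assert (Ey : y ^ 2 / x = (y / r) ^ 2) by (symmetry; apply sq_div_sqrt; lra).
  assert (Hyr : 0 <= y / r) by (apply Rdiv_le_0_compat; lra).
  assert (HyP : y * P x y / (2 * x) <= C' / x * exp (- (c / 2) * (y ^ 2 / x))).
  { apply Rle_trans with (C / x * (y / r * exp (- c * (y ^ 2 / x)))).
    - replace (y * P x y / (2 * x)) with (/ x * (y * P x y / 2)) by (field; lra).
      replace (C / x * (y / r * exp (- c * (y ^ 2 / x)))) with (/ x * (y * (C / r * exp (- c * (y ^ 2 / x))))) by (field; lra).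
      apply Rmult_le_compat_l; [left; apply Rinv_0_lt_compat; lra | ].
      assert (H0 := P_ge0 x y ltac:(lra) Hy). nra.
    - unfold C'. replace (C * (1 + 2 / c) / x * exp (- (c / 2) * (y ^ 2 / x)))
        with (C / x * ((1 + 2 / c) * exp (- (c / 2) * (y ^ 2 / x)))) by (field; lra).
      apply Rmult_le_compat_l; [apply Rdiv_le_0_compat; lra | ]. rewrite Ey. now apply poly_gauss. }
  assert (H0 := P_ge0 x y ltac:(lra) Hy).
  split; [ | split].
  - apply Rle_trans with (1 := HPg). apply Rmult_le_compat.
    + apply Rdiv_le_0_compat; lra.
    + left; apply exp_pos.
    + apply Rmult_le_compat_r; [left; now apply Rinv_0_lt_compat | lra].
    + assert (0 <= y ^ 2 / x) by (rewrite Ey; apply pow2_ge_0). apply gauss_le; nra.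
  - apply Rle_trans with (1 := Q_abs x y ltac:(lra) Hy). apply Rle_trans with (2 := HyP).
    apply Rmult_le_compat_r; [left; apply Rinv_0_lt_compat; lra | ].
    apply Rmult_le_compat_r; auto. apply psi_le_y; lra.
  - destruct (W_bounds x y ltac:(lra) Hy). rewrite Rabs_left1 by auto. lra.
Qed.

(** The origin of the rate 1/x: the similarity variables y / sqrt x and y / sqrt(x+b) differ by at
    most (b/x)(y / sqrt x), and the factor y / sqrt x is absorbed by the Gaussian decay of f''. *)
Lemma difference_bound : exists C c, 0 < C /\ 0 < c /\ forall x y, 1 <= x -> 0 < y ->
  Rabs (U x y - f1 (y / sqrt (x + 1))) <= C / x * exp (- c * (y ^ 2 / x)).
Proof.
  destruct (bl_upper _ _ _ _ _ _ HB) as [K [c [HK [Hc Hup]]]].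
  set (c' := c / (1 + b)). assert (Hc' : 0 < c') by (apply Rdiv_lt_0_compat; lra).
  assert (Hc2 : 0 < 2 / c') by (apply Rdiv_lt_0_compat; lra).
  exists (K * b * (1 + 2 / c')), (c' / 2). split; [repeat apply Rmult_lt_0_compat; lra | split; [lra | ]].
  intros x y Hx Hy. set (r := sqrt x). set (q := sqrt (x + b)). set (m := sqrt (x + 1)).
  assert (Hr : 0 < r) by (apply sqrt_lt_R0; lra). assert (Er : r * r = x) by (apply sqrt_sqrt; lra).
  assert (Eq : q * q = x + b) by (apply sqrt_sqrt; lra).
  assert (Hrm : r <= m) by (apply sqrt_le_1_alt; lra).
  assert (Hmq : m <= q) by (apply sqrt_le_1_alt; lra).
  assert (Hyq : 0 <= y / q) by (apply Rdiv_le_0_compat; lra).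
  assert (I1 : / q <= / m) by (apply Rinv_le_contravar; lra).
  assert (I2 : / m <= / r) by (apply Rinv_le_contravar; lra).
  assert (Z1 : y / q <= y / m) by (apply Rmult_le_compat_l; lra).
  assert (Z2 : y / m <= y / r) by (apply Rmult_le_compat_l; lra).
  assert (HL := U_low x y ltac:(lra) ltac:(lra)). fold q in HL.
  assert (HU := U_up x y ltac:(lra) ltac:(lra)). fold r in HU.
  assert (F1 := bl_f1_le _ _ _ _ _ _ HB (y / q) (y / m) Hyq Z1).
  assert (F2 := bl_f1_le _ _ _ _ _ _ HB (y / m) (y / r) ltac:(lra) Z2).
  assert (Hd : Rabs (U x y - f1 (y / m)) <= f1 (y / r) - f1 (y / q)) by (apply Rabs_le; lra).
  apply Rle_trans with (1 := Hd).
  apply Rle_trans with (1 := bl_f1_diff _ _ _ _ _ _ HB (y / q) (y / r) Hyq ltac:(lra)).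
  destruct (Hup _ Hyq) as [_ H2].
  assert (Hgap : y / r - y / q <= b / x * (y / r)).
  { replace (y / r - y / q) with (y / r * ((q - r) / q)) by (field; lra).
    rewrite (Rmult_comm (b / x)). apply Rmult_le_compat_l; [lra | ].
    apply Rmult_le_reg_r with (x * q); [apply Rmult_lt_0_compat; lra | ].
    replace ((q - r) / q * (x * q)) with ((q - r) * x) by (field; lra).
    replace (b / x * (x * q)) with (b * q) by (field; lra).
    assert (Eb : b = (q - r) * (q + r)) by lra. rewrite Eb.
    rewrite Rmult_assoc. apply Rmult_le_compat_l; [lra | ]. nra. }
  assert (Hf2 := bl_f2_pos _ _ _ _ _ _ HB (y / q) Hyq).
  assert (Ey : y ^ 2 / x = (y / r) ^ 2) by (symmetry; apply sq_div_sqrt; lra).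
  assert (Hyr : 0 <= y / r) by (apply Rdiv_le_0_compat; lra).
  apply Rle_trans with (K * exp (- c' * (y / r) ^ 2) * (b / x * (y / r))).
  - apply Rmult_le_compat; [lra | lra | | exact Hgap].
    apply Rle_trans with (1 := H2). apply Rmult_le_compat_l; [lra | ]. apply gauss_le.
    + apply Rmult_le_pos; [lra | apply pow2_ge_0].
    + rewrite <- Ey. unfold q. rewrite sq_div_sqrt by lra. unfold c'.
      replace (c / (1 + b) * (y ^ 2 / x)) with (c * y ^ 2 * / ((1 + b) * x)) by (field; lra).
      replace (c * (y ^ 2 / (x + b))) with (c * y ^ 2 * / (x + b)) by (field; lra).
      apply Rmult_le_compat_l; [apply Rmult_le_pos; [lra | apply pow2_ge_0] | ].
      apply Rinv_le_contravar; nra.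
  - replace (K * exp (- c' * (y / r) ^ 2) * (b / x * (y / r)))
      with (K * b / x * (y / r * exp (- c' * (y / r) ^ 2))) by (field; lra).
    replace (K * b * (1 + 2 / c') / x * exp (- (c' / 2) * (y ^ 2 / x)))
      with (K * b / x * ((1 + 2 / c') * exp (- (c' / 2) * (y / r) ^ 2))) by (rewrite Ey; field; lra).
    apply Rmult_le_compat_l; [apply Rdiv_le_0_compat; [apply Rmult_le_pos; lra | lra] | ]. now apply poly_gauss.
Qed.

Lemma blasius_f3_gauss : exists C c, 0 < C /\ 0 < c /\ forall z, 0 <= z -> Rabs (f3 z) <= C * exp (- c * z ^ 2).
Proof.
  destruct (bl_upper _ _ _ _ _ _ HB) as [K [c [HK [Hc Hup]]]].
  assert (Hc2 : 0 < 2 / c) by (apply Rdiv_lt_0_compat; lra).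
  exists (K * (1 + 2 / c)), (c / 2). split; [apply Rmult_lt_0_compat; lra | split; [lra | ]].
  intros z Hz. rewrite (bl_ode _ _ _ _ _ _ HB) by auto.
  assert (H0 := bl_f_ge0 _ _ _ _ _ _ HB z Hz). assert (H1 := bl_f_le _ _ _ _ _ _ HB z Hz).
  assert (H2 := bl_f2_pos _ _ _ _ _ _ HB z Hz). destruct (Hup z Hz) as [_ H3].
  rewrite Rabs_Ropp, Rabs_right by (apply Rle_ge; repeat apply Rmult_le_pos; lra).
  apply Rle_trans with (z * (K * exp (- c * z ^ 2))).
  - apply Rmult_le_compat; nra.
  - assert (H := poly_gauss c z Hc Hz). nra.
Qed.

Lemma derivative_difference_bound : exists C c, 0 < C /\ 0 < c /\ forall x y, 1 <= x -> 0 < y ->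
  Rabs (P x y - f2 (y / sqrt (x + 1)) / sqrt (x + 1)) <= C / x * exp (- c * (y ^ 2 / x)).
Proof.
  destruct decay_bounds as [A [a [HA [Ha HAb]]]].
  destruct difference_bound as [D [d [HD [Hd HDb]]]].
  destruct blasius_f3_gauss as [B [e [HB3 [He HBb]]]].
  set (c := Rmin (Rmin a d) (e / 2)).
  assert (Hc : 0 < c) by (unfold c; repeat apply Rmin_glb_lt; lra).
  assert (Hca : c <= a) by (unfold c; apply Rle_trans with (1 := Rmin_l _ _), Rmin_l).
  assert (Hcd : c <= d) by (unfold c; apply Rle_trans with (1 := Rmin_l _ _), Rmin_r).
  assert (Hce : c <= e / 2) by (unfold c; apply Rmin_r).
  exists (2 * D + (A + B)), c. split; [lra | split; [auto | ]]. intros x y Hx Hy.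
  set (m := sqrt (x + 1)). assert (Hm : 0 < m) by (apply sqrt_lt_R0; lra).
  assert (Em : m * m = x + 1) by (apply sqrt_sqrt; lra).
  set (E := exp (- c * (y ^ 2 / x))).
  (* The interpolation interval [y, y+1] lies to the right of y, so every Gaussian on it is
     dominated by the one at y. *)
  assert (Hmon : forall k t, c <= k -> y <= t -> exp (- k * (t ^ 2 / x)) <= E).
  { intros k t Hk Ht. assert (y ^ 2 <= t ^ 2) by (apply pow_incr; lra).
    assert (0 <= y ^ 2 / x) by (apply Rdiv_le_0_compat; [apply pow2_ge_0 | lra]).
    assert (y ^ 2 / x <= t ^ 2 / x) by (apply Rmult_le_compat_r; [left; apply Rinv_0_lt_compat; lra | auto]).
    apply gauss_le; nra. }
  replace ((2 * D + (A + B)) / x * E) with (2 * (D / x * E) + (A + B) / x * E) by (field; lra).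
  apply (derivative_interpolation (fun y => U x y - f1 (y / m)) (fun y => P x y - f2 (y / m) / m)
    (fun y => Q x y - f3 (y / m) / m / m)).
  - intros t Ht. apply D_minus; [apply U_y; lra | ].
    apply (D_eq _ _ (f2 (t / m) * / m)); [ | reflexivity].
    apply (D_comp f1 (fun y => y / m)); [apply (bl_Df1 _ _ _ _ _ _ HB), Rdiv_le_0_compat; lra | ].
    auto_derive; [exact I | field; lra].
  - intros t Ht. apply D_minus; [apply P_y; lra | ].
    apply (D_eq _ _ (f3 (t / m) * / m * / m + f2 (t / m) * 0)); [ | unfold Rdiv; ring].
    apply (D_mult (fun y => f2 (y / m)) (fun _ => / m)); [ | apply D_const].
    apply (D_comp f2 (fun y => y / m)); [apply (bl_Df2 _ _ _ _ _ _ HB), Rdiv_le_0_compat; lra | ].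
    auto_derive; [exact I | field; lra].
  - intros t Ht. apply Rle_trans with (1 := HDb x t Hx ltac:(lra)).
    apply Rmult_le_compat_l; [apply Rdiv_le_0_compat; lra | ]. apply Hmon; lra.
  - intros t Ht. destruct (HAb x t Hx ltac:(lra)) as [_ [HQ _]].
    assert (Htm : 0 <= t / m) by (apply Rdiv_le_0_compat; lra). assert (H3 := HBb _ Htm).
    assert (G1 : Rabs (Q x t) <= A / x * E).
    { apply Rle_trans with (1 := HQ). apply Rmult_le_compat_l; [apply Rdiv_le_0_compat; lra | ]. apply Hmon; lra. }
    assert (G2 : Rabs (f3 (t / m) / m / m) <= B / x * E).
    { replace (f3 (t / m) / m / m) with (f3 (t / m) * / (m * m)) by (field; lra).
      rewrite Em, Rabs_mult, (Rabs_right (/ (x + 1))) by (left; apply Rinv_0_lt_compat; lra).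
      replace (B / x * E) with (B * E * / x) by (field; lra).
      apply Rmult_le_compat; [apply Rabs_pos | left; apply Rinv_0_lt_compat; lra | | apply Rinv_le_contravar; lra].
      apply Rle_trans with (1 := H3). apply Rmult_le_compat_l; [lra | ].
      apply Rle_trans with (2 := Hmon (e / 2) t Hce ltac:(lra)).
      unfold m. rewrite sq_div_sqrt by lra. assert (0 <= t ^ 2) by apply pow2_ge_0.
      apply gauss_le; [apply Rmult_le_pos; [lra | apply Rdiv_le_0_compat; lra] | ].
      replace (e / 2 * (t ^ 2 / x)) with (e * t ^ 2 * / (2 * x)) by (field; lra).
      replace (e * (t ^ 2 / (x + 1))) with (e * t ^ 2 * / (x + 1)) by (field; lra).
      apply Rmult_le_compat_l; [apply Rmult_le_pos; lra | apply Rinv_le_contravar; lra]. }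
    replace ((A + B) / x * E) with (A / x * E + B / x * E) by (field; lra).
    apply Rle_trans with (1 := Rabs_triang _ _). rewrite Rabs_Ropp. lra.
Qed.

End Decay.

(** * Second derivative estimate *)

Lemma Rabs_near (a b d : R) : Rabs (a - b) <= d -> b - d <= a <= b + d.
Proof. intros H. apply Rabs_le_between in H. lra. Qed.

(* Kruzhkov's estimate for the difference quotients of [u] in [p]. *)
Lemma parabolic_second_derivative_step (u ux up uq a F : R -> R -> R) (x0 p0 T rho lam S L Lf N : R) :
  0 < T -> 0 < rho -> 0 < lam -> 0 <= S -> 0 <= L -> 0 <= N ->
  (forall x p, x0 - T <= x <= x0 -> Rabs (p - p0) <= 2 * rho ->
     cont2 u x p /\ is_derive (fun s => u s p) x (ux x p) /\
     is_derive (u x) p (up x p) /\ is_derive (up x) p (uq x p) /\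
     ux x p = a x p * uq x p + F x p /\ lam <= a x p /\ Rabs (up x p) <= S /\ Rabs (uq x p) <= N) ->
  (forall x p q, x0 - T <= x <= x0 -> Rabs (p - p0) <= 2 * rho -> Rabs (q - p0) <= 2 * rho ->
     Rabs (a x p - a x q) <= L * Rabs (p - q) /\ Rabs (F x p - F x q) <= Lf * Rabs (p - q)) ->
  Rabs (uq x0 p0) <= 8 * S / rho + rho * (L * N + Lf) / lam + S * rho / (lam * T).
Proof.
  intros HT Hrho Hlam HS HL HN H Hlip.
  set (B := 8 * S / rho + rho * (L * N + Lf) / lam + S * rho / (lam * T)).
  assert (Hin : forall p, Rabs (p - p0) <= rho -> Rabs (p - p0) <= 2 * rho) by (intros; lra).
  apply (derive_abs_le_right (up x0) p0 _ B rho Hrho).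
  { apply H; [lra | ]. rewrite Rminus_diag, Rabs_R0. lra. }
  intros q Hq. set (k := q - p0). assert (Hk : 0 < k < rho) by (unfold k; lra).
  assert (Hin' : forall p, Rabs (p - p0) <= rho -> Rabs (p + k - p0) <= 2 * rho).
  { intros p Hp. apply Rabs_near in Hp. apply Rabs_le. lra. }
  (* Discrete product rule: [a] at the shifted point stays as coefficient, and the difference
     quotient of [a] times [uq] joins the source, which is then bounded by [L * N + Lf]. The
     quotient of [u] itself is bounded by [S], the bound on [up]. *)
  assert (G := parabolic_gradient_bound (fun x p => (u x (p + k) - u x p) / k) (fun x p => (ux x (p + k) - ux x p) / k)
    (fun x p => (up x (p + k) - up x p) / k) (fun x p => (uq x (p + k) - uq x p) / k)
    (fun x p => a x (p + k))
    (fun x p => (a x (p + k) - a x p) / k * uq x p + (F x (p + k) - F x p) / k) x0 p0 T rho lam S (L * N + Lf)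
    HT Hrho Hlam HS).
  cbv beta in G. fold B in G.
  replace (p0 + k) with q in G by (unfold k; ring).
  assert (Hquot : Rabs ((up x0 q - up x0 p0) / k) <= B).
  { apply G. clear G. intros x p Hx Hp.
    destruct (H x p Hx (Hin p Hp)) as [C1 [Dx1 [Dp1 [Dq1 [E1 [A1 [S1 N1]]]]]]].
    destruct (H x (p + k) Hx (Hin' p Hp)) as [C2 [Dx2 [Dp2 [Dq2 [E2 [A2 [S2 N2]]]]]]].
    destruct (Hlip x (p + k) p Hx (Hin' p Hp) (Hin p Hp)) as [La LF].
    replace (p + k - p) with k in La, LF by ring. rewrite (Rabs_right k) in La, LF by lra.
    assert (Hshift : forall (v : R -> R) (l : R), is_derive v (p + k) l -> is_derive (fun p => v (p + k)) p l).
    { intros v l D. apply (D_eq _ _ (l * (1 + 0))); [ | ring].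
      apply (D_comp v (fun p => p + k)); [exact D | ]. apply D_plus; [apply D_id | apply D_const]. }
    assert (Hdiv : forall (v : R -> R) (y l : R), is_derive v y l -> is_derive (fun t => v t / k) y (l / k)).
    { intros v y l D. apply (D_eq _ _ (l * / k + v y * 0)); [ | unfold Rdiv; ring].
      apply (D_mult v (fun _ => / k)); [exact D | apply D_const]. }
    split; [ | split; [ | split; [ | split; [ | split; [ | split; [ | split]]]]]].
    - apply cont_mult; [ | apply cont_const]. apply cont_minus; [ | exact C1].
      apply (cont2_comp u fst (fun z => snd z + k)); [apply continuous_fst | | exact C2].
      apply cont_plus; [apply continuous_snd | apply cont_const].
    - apply (Hdiv (fun s => u s (p + k) - u s p)). now apply D_minus.
    - apply (Hdiv (fun p => u x (p + k) - u x p)). apply D_minus; [now apply Hshift | exact Dp1].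
    - apply (Hdiv (fun p => up x (p + k) - up x p)). apply D_minus; [now apply Hshift | exact Dq1].
    - rewrite E1, E2. field. lra.
    - exact A2.
    - assert (I1 : Rabs ((a x (p + k) - a x p) / k) <= L).
      { unfold Rdiv. rewrite Rabs_mult, (Rabs_right (/ k)) by (left; apply Rinv_0_lt_compat; lra).
        apply Rmult_le_reg_r with k; [lra | ]. rewrite Rmult_assoc, Rinv_l, Rmult_1_r by lra. exact La. }
      assert (I2 : Rabs ((F x (p + k) - F x p) / k) <= Lf).
      { unfold Rdiv. rewrite Rabs_mult, (Rabs_right (/ k)) by (left; apply Rinv_0_lt_compat; lra).
        apply Rmult_le_reg_r with k; [lra | ]. rewrite Rmult_assoc, Rinv_l, Rmult_1_r by lra. exact LF. }
      apply Rle_trans with (1 := Rabs_triang _ _). apply Rplus_le_compat; auto.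
      rewrite Rabs_mult. apply Rmult_le_compat; auto using Rabs_pos.
    - unfold Rdiv. rewrite Rabs_mult, (Rabs_right (/ k)) by (left; apply Rinv_0_lt_compat; lra).
      apply Rmult_le_reg_r with k; [lra | ]. rewrite Rmult_assoc, Rinv_l, Rmult_1_r by lra.
      apply Rabs_near in Hp.
      replace k with (Rabs (p + k - p)) at 2 by (replace (p + k - p) with k by ring; apply Rabs_right; lra).
      apply (lipschitz_of_derive (u x) (up x) p (p + k)); try lra.
      + intros t Ht. apply H; auto. apply Rabs_le. lra.
      + intros t Ht. apply H; auto. apply Rabs_le. lra. }
  unfold Rdiv in Hquot. rewrite Rabs_mult, (Rabs_right (/ k)) in Hquot by (left; apply Rinv_0_lt_compat; lra).
  apply Rmult_le_compat_r with (r := k) in Hquot; [ | lra].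
  rewrite Rmult_assoc, Rinv_l, Rmult_1_r in Hquot by lra. exact Hquot.
Qed.

(* The bound does not involve [uq]: at a maximum of [d |uq|], [d] the distance to the
   parabolic boundary, the previous estimate on a box of size [eps d] absorbs the term in [uq]. *)
Lemma parabolic_second_derivative_bound (xs xe p0 r lam S L Lf : R) :
  xs < xe -> 0 < r -> 0 < lam -> 0 <= S -> 0 <= L -> 0 <= Lf ->
  exists N, 0 <= N /\ forall (u ux up uq a F : R -> R -> R),
  (forall x p, xs <= x <= xe -> Rabs (p - p0) <= r ->
     cont2 u x p /\ is_derive (fun s => u s p) x (ux x p) /\
     is_derive (u x) p (up x p) /\ is_derive (up x) p (uq x p) /\
     ux x p = a x p * uq x p + F x p /\ lam <= a x p /\ Rabs (up x p) <= S /\ cont2 uq x p) ->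
  (forall x p q, xs <= x <= xe -> Rabs (p - p0) <= r -> Rabs (q - p0) <= r ->
     Rabs (a x p - a x q) <= L * Rabs (p - q) /\ Rabs (F x p - F x q) <= Lf * Rabs (p - q)) ->
  forall x p d, xs <= x <= xe -> 0 <= d -> d <= x - xs -> Rabs (p - p0) <= r - d ->
  d * Rabs (uq x p) <= N.
Proof.
  intros Hxs Hr Hlam HS HL HLf.
  (* Small enough for two purposes: the coefficient 2 e L d1 / lam of the maximum is at most 1/2,
     and e <= 1/4 keeps the box within half the distance to the boundary. *)
  set (e := lam / (4 * lam + 4 * L * r)).
  assert (Hden : 0 < 4 * lam + 4 * L * r) by (assert (0 <= L * r) by (apply Rmult_le_pos; lra); lra).
  assert (He : 0 < e) by (apply Rdiv_lt_0_compat; lra).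
  assert (HeE : e * (4 * lam + 4 * L * r) = lam) by (unfold e; field; lra).
  clearbody e.
  assert (HLr : 0 <= L * r) by (apply Rmult_le_pos; lra).
  assert (He4 : e <= / 4) by nra.
  set (N := 2 * (8 * S / e + e * Lf * (r * r) / lam + 2 * S * e * r / lam)).
  assert (HN : 0 <= N).
  { unfold N. assert (0 <= 8 * S / e) by (apply Rdiv_le_0_compat; lra).
    assert (0 <= e * Lf * (r * r) / lam) by (apply Rdiv_le_0_compat; [repeat apply Rmult_le_pos; lra | lra]).
    assert (0 <= 2 * S * e * r / lam) by (apply Rdiv_le_0_compat; [repeat apply Rmult_le_pos; lra | lra]). lra. }
  exists N. split; auto. intros u ux up uq a F H Hlip.
  (* Distance to the bottom and the lateral sides only; the final time [xe] belongs to the parabolic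
     interior. *)
  set (D := fun x p => Rmin (x - xs) (Rmin (p - (p0 - r)) (p0 + r - p))).
  assert (HD : forall x p, D x p <= x - xs /\ D x p <= p - (p0 - r) /\ D x p <= p0 + r - p).
  { intros x p. unfold D. split; [apply Rmin_l | ]. split.
    - apply Rle_trans with (1 := Rmin_r _ _), Rmin_l.
    - apply Rle_trans with (1 := Rmin_r _ _), Rmin_r. }
  destruct (extreme_value_2 (fun x p => D x p * Rabs (uq x p)) xs xe (p0 - r) (p0 + r))
    as [x1 [p1 [Hx1 [Hp1 Hmax]]]]; [lra | lra | | ].
  { intros x p Hx Hp. assert (C : cont2 uq x p) by (apply H; auto; apply Rabs_le; lra).
    apply cont_mult.
    - unfold D. cont_tac.
    - apply cont_abs, C. }
  cbv beta in Hmax. set (d1 := D x1 p1) in *. set (m := d1 * Rabs (uq x1 p1)) in *.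
  assert (Hm : m <= N).
  { destruct (HD x1 p1) as [B1 [B2 B3]]. fold d1 in B1, B2, B3.
    destruct (Rle_dec d1 0) as [Hd | Hd].
    { unfold m. generalize (Rabs_pos (uq x1 p1)). nra. }
    assert (Hd1 : 0 < d1) by lra. assert (Hd1r : d1 <= r) by lra.
    assert (Hm0 : 0 <= m) by (apply Rmult_le_pos; [lra | apply Rabs_pos]).
    assert (Hed : 2 * (e * d1) <= d1 / 2) by nra.
    assert (Hsub : forall x p, x1 - d1 / 2 <= x <= x1 -> Rabs (p - p1) <= 2 * (e * d1) ->
      (xs <= x <= xe /\ Rabs (p - p0) <= r) /\ d1 / 2 <= D x p).
    { intros x p Hx Hp. apply Rabs_near in Hp. split; [split; [lra | apply Rabs_le; lra] | ].
      unfold D. repeat apply Rmin_glb; lra. }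
    (* On the small box the distance is at least d1 / 2, so maximality bounds [uq] by 2 m / d1
       there. The maximum m is finite because [uq] is continuous, and so it can be absorbed. *)
    assert (Step : Rabs (uq x1 p1) <= 8 * S / (e * d1) + e * d1 * (L * (2 * m / d1) + Lf) / lam + S * (e * d1) / (lam * (d1 / 2))).
    { apply (parabolic_second_derivative_step u ux up uq a F x1 p1 (d1 / 2) (e * d1) lam S L Lf (2 * m / d1)); auto; try lra.
      - now apply Rmult_lt_0_compat.
      - apply Rdiv_le_0_compat; lra.
      - intros x p Hx Hp. destruct (Hsub x p Hx Hp) as [[X1 X2] X3].
        destruct (H x p X1 X2) as [Y1 [Y2 [Y3 [Y4 [Y5 [Y6 [Y7 _]]]]]]].
        do 7 (split; [assumption | ]).
        assert (Z := Hmax x p X1). apply Rabs_near in X2. specialize (Z ltac:(lra)).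
        apply Rmult_le_reg_l with (d1 / 2); [lra | ]. replace (d1 / 2 * (2 * m / d1)) with m by (field; lra).
        apply Rle_trans with (2 := Z). apply Rmult_le_compat_r; [apply Rabs_pos | exact X3].
      - intros x p q Hx Hp Hq. destruct (Hsub x p Hx Hp) as [[X1 X2] _]. destruct (Hsub x q Hx Hq) as [[_ X4] _].
        now apply Hlip. }
    apply Rmult_le_compat_l with (r := d1) in Step; [ | lra]. fold m in Step.
    replace (d1 * (8 * S / (e * d1) + e * d1 * (L * (2 * m / d1) + Lf) / lam + S * (e * d1) / (lam * (d1 / 2))))
      with (8 * S / e + (2 * e * L * d1 / lam * m + e * Lf * (d1 * d1) / lam + 2 * S * e * d1 / lam)) in Step
      by (field; lra).
    assert (Q1 : 2 * e * L * d1 / lam <= / 2).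
    { apply Rmult_le_reg_r with lam; auto. replace (2 * e * L * d1 / lam * lam) with (2 * e * L * d1) by (field; lra).
      assert (e * L * d1 <= e * L * r) by (apply Rmult_le_compat_l; [apply Rmult_le_pos; lra | lra]). nra. }
    assert (Q2 : e * Lf * (d1 * d1) / lam <= e * Lf * (r * r) / lam).
    { apply Rmult_le_compat_r; [left; now apply Rinv_0_lt_compat | ].
      apply Rmult_le_compat_l; [apply Rmult_le_pos; lra | nra]. }
    assert (Q3 : 2 * S * e * d1 / lam <= 2 * S * e * r / lam).
    { apply Rmult_le_compat_r; [left; now apply Rinv_0_lt_compat | ].
      apply Rmult_le_compat_l; [apply Rmult_le_pos; lra | lra]. }
    assert (2 * e * L * d1 / lam * m <= / 2 * m) by (apply Rmult_le_compat_r; lra).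
    unfold N. lra. }
  intros x p d Hx Hd0 Hdx Hdp. apply Rabs_near in Hdp.
  apply Rle_trans with (2 := Hm). apply Rle_trans with (2 := Hmax x p Hx ltac:(lra)).
  apply Rmult_le_compat_r; [apply Rabs_pos | ]. unfold D. repeat apply Rmin_glb; lra.
Qed.

(** * Existence and decay of the mixed derivative *)

Lemma bounded_on_box (F : R -> R -> R) (a1 b1 a2 b2 : R) :
  a1 <= b1 -> a2 <= b2 ->
  (forall x y, a1 <= x <= b1 -> a2 <= y <= b2 -> cont2 F x y) ->
  exists M, 0 <= M /\ forall x y, a1 <= x <= b1 -> a2 <= y <= b2 -> Rabs (F x y) <= M.
Proof.
  intros H1 H2 HF.
  destruct (extreme_value_2 (fun x y => Rabs (F x y)) a1 b1 a2 b2 H1 H2) as [x [y [_ [_ Hm]]]].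
  { intros x y Hx Hy. apply cont_abs. now apply HF. }
  exists (Rabs (F x y)). split; [apply Rabs_pos | exact Hm].
Qed.

Lemma positive_on_box (F : R -> R -> R) (a1 b1 a2 b2 : R) :
  a1 <= b1 -> a2 <= b2 ->
  (forall x y, a1 <= x <= b1 -> a2 <= y <= b2 -> cont2 F x y) ->
  (forall x y, a1 <= x <= b1 -> a2 <= y <= b2 -> 0 < F x y) ->
  exists m, 0 < m /\ forall x y, a1 <= x <= b1 -> a2 <= y <= b2 -> m <= F x y.
Proof.
  intros H1 H2 HF Hpos.
  destruct (extreme_value_2 (fun x y => - F x y) a1 b1 a2 b2 H1 H2) as [x [y [Hx [Hy Hm]]]].
  { intros x y Hx Hy. apply cont_opp. now apply HF. }
  exists (F x y). split; [now apply Hpos | ]. intros x' y' Hx' Hy'. specialize (Hm x' y' Hx' Hy'). lra.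
Qed.

Lemma product_lip (a1 a2 b1 b2 A B La Lb d : R) :
  Rabs a1 <= A -> Rabs b2 <= B -> Rabs (a1 - a2) <= La * d -> Rabs (b1 - b2) <= Lb * d ->
  Rabs (a1 * b1 - a2 * b2) <= (A * Lb + La * B) * d.
Proof.
  intros HA HB HLa HLb.
  replace (a1 * b1 - a2 * b2) with (a1 * (b1 - b2) + (a1 - a2) * b2) by ring.
  apply Rle_trans with (1 := Rabs_triang _ _). rewrite !Rabs_mult.
  assert (Rabs a1 * Rabs (b1 - b2) <= A * (Lb * d)) by (apply Rmult_le_compat; auto using Rabs_pos).
  assert (Rabs (a1 - a2) * Rabs b2 <= La * d * B) by (apply Rmult_le_compat; auto using Rabs_pos).
  lra.
Qed.

Lemma inverse_lip (a1 a2 l : R) : 0 < l -> l <= a1 -> l <= a2 ->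
  Rabs (/ a1 - / a2) <= / (l * l) * Rabs (a1 - a2).
Proof.
  intros Hl H1 H2. replace (/ a1 - / a2) with (/ (a1 * a2) * - (a1 - a2)) by (field; lra).
  rewrite Rabs_mult, Rabs_Ropp. apply Rmult_le_compat_r; [apply Rabs_pos | ].
  rewrite Rabs_right by (left; apply Rinv_0_lt_compat; nra). apply Rinv_le_contravar; nra.
Qed.

Lemma sqrt_lip (a1 a2 l : R) : 0 < l -> l * l <= a1 -> l * l <= a2 ->
  Rabs (sqrt a1 - sqrt a2) <= / (2 * l) * Rabs (a1 - a2).
Proof.
  intros Hl H1 H2.
  assert (S1 : l <= sqrt a1) by (rewrite <- (sqrt_square l) by lra; now apply sqrt_le_1_alt).
  assert (S2 : l <= sqrt a2) by (rewrite <- (sqrt_square l) by lra; now apply sqrt_le_1_alt).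
  assert (Hl2 : 0 < l * l) by nra.
  assert (E1 := sqrt_sqrt a1 ltac:(lra)). assert (E2 := sqrt_sqrt a2 ltac:(lra)).
  assert (E : sqrt a1 - sqrt a2 = / (sqrt a1 + sqrt a2) * (a1 - a2)).
  { assert (a1 - a2 = (sqrt a1 - sqrt a2) * (sqrt a1 + sqrt a2)) as -> by lra. field. lra. }
  rewrite E, Rabs_mult. apply Rmult_le_compat_r; [apply Rabs_pos | ].
  rewrite Rabs_right by (left; apply Rinv_0_lt_compat; lra). apply Rinv_le_contravar; lra.
Qed.

(** * Difference quotients in x for the von Mises equation *)

Section Quotients.

Variables f fx fp fq : R -> R -> R.
Hypothesis f_cont : forall x p, 0 < x -> 0 < p -> cont2 f x p.
Hypothesis fx_cont : forall x p, 0 < x -> 0 < p -> cont2 fx x p.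
Hypothesis fp_cont : forall x p, 0 < x -> 0 < p -> cont2 fp x p.
Hypothesis fq_cont : forall x p, 0 < x -> 0 < p -> cont2 fq x p.
Hypothesis f_x : forall x p, 0 < x -> 0 < p -> is_derive (fun s => f s p) x (fx x p).
Hypothesis f_p : forall x p, 0 < x -> 0 < p -> is_derive (f x) p (fp x p).
Hypothesis f_q : forall x p, 0 < x -> 0 < p -> is_derive (fp x) p (fq x p).
Hypothesis f_pos : forall x p, 0 < x -> 0 < p -> 0 < f x p.
Hypothesis f_eq : forall x p, 0 < x -> 0 < p -> fx x p = sqrt (f x p) * fq x p.

Definition quot (h : R) (G : R -> R -> R) (x p : R) : R := (G (x + h) p - G x p) / h.
Definition quot_coef (h x p : R) : R := sqrt (f (x + h) p).
(** The difference quotient of sqrt f in x, rationalised by the sum of the two roots, times [fq]: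
    the remainder in the product rule for sqrt f times [fq]. *)
Definition quot_rhs (h x p : R) : R :=
  fq x p * (/ (sqrt (f (x + h) p) + sqrt (f x p)) * quot h f x p).

Lemma quot_cont (G : R -> R -> R) (h x p : R) : 0 < h -> 0 < x -> 0 < p ->
  (forall x p, 0 < x -> 0 < p -> cont2 G x p) -> cont2 (quot h G) x p.
Proof.
  intros Hh Hx Hp HG. apply cont_mult; [ | apply cont_const]. apply cont_minus; [ | now apply HG].
  apply (cont2_comp G (fun z => fst z + h) snd).
  - apply cont_plus; [apply continuous_fst | apply cont_const].
  - apply continuous_snd.
  - apply HG; simpl; lra.
Qed.

Lemma quot_Dx (h x p : R) : 0 < h -> 0 < x -> 0 < p ->
  is_derive (fun s => quot h f s p) x (quot h fx x p).
Proof.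
  intros Hh Hx Hp. unfold quot, Rdiv.
  apply (D_eq _ _ ((fx (x + h) p * (1 + 0) - fx x p) * / h + (f (x + h) p - f x p) * 0)); [ | ring].
  apply (D_mult (fun s => f (s + h) p - f s p) (fun _ => / h)); [ | apply D_const].
  apply D_minus; [ | now apply f_x].
  apply (D_comp (fun s => f s p) (fun s => s + h)); [apply f_x; lra | ].
  apply D_plus; [apply D_id | apply D_const].
Qed.

Lemma quot_Dsec (G G' : R -> R -> R) (h x p : R) : 0 < h -> 0 < x -> 0 < p ->
  (forall x p, 0 < x -> 0 < p -> is_derive (G x) p (G' x p)) ->
  is_derive (quot h G x) p (quot h G' x p).
Proof.
  intros Hh Hx Hp HG. unfold quot, Rdiv.
  apply (D_eq _ _ ((G' (x + h) p - G' x p) * / h + (G (x + h) p - G x p) * 0)); [ | ring].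
  apply (D_mult (fun p => G (x + h) p - G x p) (fun _ => / h)); [ | apply D_const].
  apply D_minus; apply HG; lra.
Qed.

Lemma quot_eq (h x p : R) : 0 < h -> 0 < x -> 0 < p ->
  quot h fx x p = quot_coef h x p * quot h fq x p + quot_rhs h x p.
Proof.
  intros Hh Hx Hp. unfold quot_rhs, quot, quot_coef.
  assert (P1 := f_pos (x + h) p ltac:(lra) Hp). assert (P2 := f_pos x p Hx Hp).
  rewrite (f_eq (x + h) p), (f_eq x p) by lra.
  assert (S1 := sqrt_lt_R0 _ P1). assert (S2 := sqrt_lt_R0 _ P2).
  assert (E1 := sqrt_sqrt _ (Rlt_le _ _ P1)). assert (E2 := sqrt_sqrt _ (Rlt_le _ _ P2)).
  rewrite <- E1 at 4. rewrite <- E2 at 3. field. split; lra.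
Qed.

Lemma quot_bound (h x p M : R) : 0 < h -> 0 < x -> 0 < p ->
  (forall s, x <= s <= x + h -> Rabs (fx s p) <= M) -> Rabs (quot h f x p) <= M.
Proof.
  intros Hh Hx Hp HM. unfold quot.
  destruct (mvt (fun s => f s p) (fun s => fx s p) x (x + h)) as [c [Hc E]]; [lra | | | ].
  - intros; apply f_x; lra.
  - intros t Ht. apply (cont_of_derive _ _ (fx t p)), f_x; lra.
  - rewrite E. replace (fx c p * (x + h - x) / h) with (fx c p) by (field; lra). apply HM; lra.
Qed.

(** The estimate is uniform in h. The source is quadratic in the bound on [fx], since [fq] equals
    [fx] / sqrt f, and the mean value theorem bounds the quotient of f by the same M. *)
Lemma quot_gradient_bound (x0 p0 h T rho lam M : R) :
  0 < h -> 0 < T -> T < x0 -> 0 < rho -> rho < p0 -> 0 < lam -> 0 <= M ->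
  (forall x p, x0 - T <= x <= x0 + h -> Rabs (p - p0) <= rho -> lam * lam <= f x p /\ Rabs (fx x p) <= M) ->
  Rabs (quot h fp x0 p0) <= 8 * M / rho + rho * (M * M / (2 * (lam * lam))) / lam + M * rho / (lam * T).
Proof.
  intros Hh HT HTx Hrho Hrp Hlam HM H.
  assert (Hsq : forall x p, x0 - T <= x <= x0 + h -> Rabs (p - p0) <= rho -> lam <= sqrt (f x p)).
  { intros x p Hx Hp. rewrite <- (sqrt_square lam) by lra. apply sqrt_le_1_alt. now apply H. }
  apply (parabolic_gradient_bound (quot h f) (quot h fx) (quot h fp) (quot h fq) (quot_coef h) (quot_rhs h));
    auto. intros x p Hx Hp. assert (Hp' := Rabs_near _ _ _ Hp).
  assert (Hx0 : 0 < x) by lra. assert (Hp0 : 0 < p) by lra.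
  assert (Hq : Rabs (quot h f x p) <= M) by (apply quot_bound; auto; intros; apply H; auto; lra).
  split; [ | split; [ | split; [ | split; [ | split; [ | split; [ | split]]]]]].
  - now apply quot_cont.
  - now apply quot_Dx.
  - now apply quot_Dsec.
  - now apply quot_Dsec.
  - now apply quot_eq.
  - apply Hsq; auto. lra.
  - assert (S1 := Hsq x p ltac:(lra) Hp). assert (S2 := Hsq (x + h) p ltac:(lra) Hp).
    destruct (H x p ltac:(lra) Hp) as [_ Hfx]. unfold quot_rhs.
    assert (Efq : fq x p = fx x p * / sqrt (f x p)) by (rewrite f_eq by auto; field; lra).
    rewrite Efq, !Rabs_mult, (Rabs_right (/ sqrt (f x p))), (Rabs_right (/ (sqrt (f (x + h) p) + sqrt (f x p))))
      by (left; apply Rinv_0_lt_compat; lra).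
    assert (I1 : 0 < / sqrt (f x p) <= / lam).
    { split; [apply Rinv_0_lt_compat; lra | apply Rinv_le_contravar; lra]. }
    assert (I2 : 0 < / (sqrt (f (x + h) p) + sqrt (f x p)) <= / (2 * lam)).
    { split; [apply Rinv_0_lt_compat; lra | apply Rinv_le_contravar; lra]. }
    replace (M * M / (2 * (lam * lam))) with (M * / lam * (/ (2 * lam) * M)) by (field; lra).
    apply Rmult_le_compat.
    + apply Rmult_le_pos; [apply Rabs_pos | lra].
    + apply Rmult_le_pos; [lra | apply Rabs_pos].
    + apply Rmult_le_compat; [apply Rabs_pos | lra | auto | lra].
    + apply Rmult_le_compat; [lra | apply Rabs_pos | lra | auto].
  - exact Hq.
Qed.

(** A bootstrap in p. The gradient bound on the quotients of f passes to the limit as a Lipschitz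
    bound on [fx]; with f bounded below, [fq] = [fx] / sqrt f is Lipschitz too. Hence [quot_coef]
    and [quot_rhs] are Lipschitz in p uniformly in h, as the second derivative estimate requires. *)
Lemma quot_second_bound (x0 p0 : R) : 0 < x0 -> 0 < p0 -> exists r N, 0 < r /\ r < x0 /\ r < p0 /\ 0 <= N /\
  forall h x p, 0 < h <= r -> x0 - r <= x <= x0 -> Rabs (p - p0) <= r -> Rabs (quot h fq x p) <= N.
Proof.
  intros Hx0 Hp0. set (r := Rmin x0 p0 / 8).
  assert (Hr : 0 < r /\ 8 * r <= x0 /\ 8 * r <= p0).
  { unfold r. generalize (Rmin_l x0 p0) (Rmin_r x0 p0). assert (0 < Rmin x0 p0) by now apply Rmin_glb_lt. lra. }
  destruct Hr as [Hr [Hrx Hrp]]. clearbody r.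
  assert (Hbox : forall x p, x0 - 4 * r <= x <= x0 + 4 * r -> p0 - 4 * r <= p <= p0 + 4 * r -> 0 < x /\ 0 < p) by (intros; lra).
  destruct (positive_on_box f (x0 - 4 * r) (x0 + 4 * r) (p0 - 4 * r) (p0 + 4 * r)) as [m [Hm Hfm]]; try lra.
  { intros x p Hx Hp. apply f_cont; now apply (Hbox x p). }
  { intros x p Hx Hp. apply f_pos; now apply (Hbox x p). }
  destruct (bounded_on_box fx (x0 - 4 * r) (x0 + 4 * r) (p0 - 4 * r) (p0 + 4 * r)) as [M [HM Hfx]]; try lra.
  { intros x p Hx Hp. apply fx_cont; now apply (Hbox x p). }
  destruct (bounded_on_box fp (x0 - 4 * r) (x0 + 4 * r) (p0 - 4 * r) (p0 + 4 * r)) as [Mp [HMp Hfp]]; try lra.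
  { intros x p Hx Hp. apply fp_cont; now apply (Hbox x p). }
  destruct (bounded_on_box fq (x0 - 4 * r) (x0 + 4 * r) (p0 - 4 * r) (p0 + 4 * r)) as [Mq [HMq Hfq]]; try lra.
  { intros x p Hx Hp. apply fq_cont; now apply (Hbox x p). }
  set (lam := sqrt m). assert (Hlam : 0 < lam) by now apply sqrt_lt_R0.
  assert (Elam : lam * lam = m) by (apply sqrt_sqrt; lra).
  set (S := 8 * M / r + r * (M * M / (2 * (lam * lam))) / lam + M * r / (lam * r)).
  assert (Hgrad : forall h x p, 0 < h <= r -> x0 - 2 * r <= x <= x0 + 2 * r -> Rabs (p - p0) <= 2 * r -> Rabs (quot h fp x p) <= S).
  { intros h x p Hh Hx Hp. apply Rabs_near in Hp. apply quot_gradient_bound; try lra.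
    intros s q Hs Hq. apply Rabs_near in Hq. rewrite Elam. split; [apply Hfm | apply Hfx]; lra. }
  assert (HS : 0 <= S).
  { apply Rle_trans with (2 := Hgrad r x0 p0 ltac:(lra) ltac:(lra) ltac:(rewrite Rminus_diag, Rabs_R0; lra)). apply Rabs_pos. }
  clearbody S.
  assert (Hsec : forall (G G' : R -> R) K p q, (forall t, p0 - 2 * r <= t <= p0 + 2 * r -> is_derive G t (G' t)) ->
    (forall t, p0 - 2 * r <= t <= p0 + 2 * r -> Rabs (G' t) <= K) ->
    Rabs (p - p0) <= 2 * r -> Rabs (q - p0) <= 2 * r -> Rabs (G p - G q) <= K * Rabs (p - q)).
  { intros G G' K p q HG HK Hp Hq. apply Rabs_near in Hp, Hq.
    apply (lipschitz_of_derive G G' (p0 - 2 * r) (p0 + 2 * r)); auto; lra. }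
  assert (Lf : forall x p q, x0 - 4 * r <= x <= x0 + 4 * r -> Rabs (p - p0) <= 2 * r -> Rabs (q - p0) <= 2 * r ->
    Rabs (f x p - f x q) <= Mp * Rabs (p - q)).
  { intros x p q Hx Hp Hq. apply (Hsec (f x) (fp x)); auto; intros; [apply f_p | apply Hfp]; lra. }
  assert (Lsqrt : forall x p q, x0 - 4 * r <= x <= x0 + 4 * r -> Rabs (p - p0) <= 2 * r -> Rabs (q - p0) <= 2 * r ->
    Rabs (sqrt (f x p) - sqrt (f x q)) <= / (2 * lam) * Mp * Rabs (p - q)).
  { intros x p q Hx Hp Hq. assert (Hp' := Rabs_near _ _ _ Hp). assert (Hq' := Rabs_near _ _ _ Hq).
    apply Rle_trans with (1 := sqrt_lip (f x p) (f x q) lam Hlam ltac:(rewrite Elam; apply Hfm; lra) ltac:(rewrite Elam; apply Hfm; lra)).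
    rewrite Rmult_assoc. apply Rmult_le_compat_l; [left; apply Rinv_0_lt_compat; lra | auto]. }
  assert (Bsqrt : forall x p, x0 - 4 * r <= x <= x0 + 4 * r -> Rabs (p - p0) <= 2 * r -> lam <= sqrt (f x p)).
  { intros x p Hx Hp. apply Rabs_near in Hp. apply sqrt_le_1_alt, Hfm; lra. }
  (* The p-increment of [fx] is the limit of the p-increments of [quot h f], which the gradient
     bound controls uniformly in h. *)
  assert (Lfx : forall x p q, x0 - 2 * r <= x <= x0 + 2 * r -> Rabs (p - p0) <= 2 * r -> Rabs (q - p0) <= 2 * r ->
    Rabs (fx x p - fx x q) <= S * Rabs (p - q)).
  { intros x p q Hx Hp Hq. assert (Hp' := Rabs_near _ _ _ Hp). assert (Hq' := Rabs_near _ _ _ Hq).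
    apply (derive_abs_le_right (fun s => f s p - f s q) x _ _ r Hr).
    - apply D_minus; apply f_x; lra.
    - intros t Ht. set (h := t - x). assert (Hh : 0 < h <= r) by (unfold h; lra).
      replace (f t p - f t q - (f x p - f x q)) with (h * (quot h f x p - quot h f x q)).
      2:{ unfold quot. replace (x + h) with t by (unfold h; ring). field. lra. }
      rewrite Rabs_mult, (Rabs_right h), Rmult_comm by lra. apply Rmult_le_compat_r; [lra | ].
      apply (Hsec (quot h f x) (quot h fp x)); auto.
      + intros y Hy. apply quot_Dsec; auto; lra.
      + intros y Hy. apply Hgrad; auto. apply Rabs_le; lra. }
  set (Lq := M * (/ (lam * lam) * (/ (2 * lam) * Mp)) + S * / lam).
  assert (Lfq : forall x p q, x0 - 2 * r <= x <= x0 + 2 * r -> Rabs (p - p0) <= 2 * r -> Rabs (q - p0) <= 2 * r ->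
    Rabs (fq x p - fq x q) <= Lq * Rabs (p - q)).
  { intros x p q Hx Hp Hq. assert (Hp' := Rabs_near _ _ _ Hp). assert (Hq' := Rabs_near _ _ _ Hq).
    assert (B1 := Bsqrt x p ltac:(lra) Hp). assert (B2 := Bsqrt x q ltac:(lra) Hq).
    assert (E : forall t, Rabs (t - p0) <= 2 * r -> fq x t = fx x t * / sqrt (f x t)).
    { intros t Ht. assert (Bt := Bsqrt x t ltac:(lra) Ht). apply Rabs_near in Ht.
      rewrite f_eq by lra. field. lra. }
    rewrite !E by auto. apply product_lip.
    - apply Hfx; lra.
    - rewrite Rabs_right by (left; apply Rinv_0_lt_compat; lra). apply Rinv_le_contravar; lra.
    - auto.
    - apply Rle_trans with (1 := inverse_lip _ _ lam Hlam B1 B2). rewrite (Rmult_assoc (/ (lam * lam))).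
      apply Rmult_le_compat_l; [left; apply Rinv_0_lt_compat; nra | ]. apply Lsqrt; auto; lra. }
  set (La := / (2 * lam) * Mp). set (Li := / (2 * lam * (2 * lam)) * (2 * La)).
  set (Lr := Mq * (/ (2 * lam) * S + Li * M) + Lq * (/ (2 * lam) * M)).
  assert (Il : 0 < / lam) by now apply Rinv_0_lt_compat.
  assert (I2 : 0 < / (2 * lam)) by (apply Rinv_0_lt_compat; lra).
  assert (HLa : 0 <= La) by (apply Rmult_le_pos; lra).
  assert (HLi : 0 <= Li) by (apply Rmult_le_pos; [left; apply Rinv_0_lt_compat; nra | lra]).
  assert (HLq : 0 <= Lq).
  { unfold Lq. apply Rplus_le_le_0_compat; apply Rmult_le_pos; try lra.
    apply Rmult_le_pos; [left; apply Rinv_0_lt_compat; nra | exact HLa]. }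
  assert (HLr : 0 <= Lr).
  { unfold Lr. apply Rplus_le_le_0_compat; apply Rmult_le_pos; auto; [apply Rplus_le_le_0_compat | ]; apply Rmult_le_pos; lra. }
  destruct (parabolic_second_derivative_bound (x0 - 2 * r) x0 p0 (2 * r) lam S La Lr) as [N [HN HNb]]; try lra.
  exists r, (N / r). split; [auto | split; [lra | split; [lra | split; [apply Rdiv_le_0_compat; lra | ]]]].
  intros h x p Hh Hx Hp.
  apply Rmult_le_reg_l with r; auto. replace (r * (N / r)) with N by (field; lra).
  apply (HNb (quot h f) (quot h fx) (quot h fp) (quot h fq) (quot_coef h) (quot_rhs h)); try lra.
  - intros s q Hs Hq. assert (Hq' := Rabs_near _ _ _ Hq).
    split; [apply quot_cont; auto; lra | ]. split; [apply quot_Dx; lra | ].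
    split; [apply quot_Dsec; auto; lra | ]. split; [apply quot_Dsec; auto; lra | ].
    split; [apply quot_eq; lra | ]. split; [apply Bsqrt; auto; lra | ].
    split; [apply Hgrad; auto; lra | apply quot_cont; auto; lra].
  - intros s q t Hs Hq Ht. assert (Hq' := Rabs_near _ _ _ Hq). assert (Ht' := Rabs_near _ _ _ Ht). split.
    + unfold quot_coef, La. apply Lsqrt; auto; lra.
    + assert (B1 := Bsqrt s q ltac:(lra) Hq). assert (B2 := Bsqrt (s + h) q ltac:(lra) Hq).
      assert (B3 := Bsqrt s t ltac:(lra) Ht). assert (B4 := Bsqrt (s + h) t ltac:(lra) Ht).
      assert (Qb : forall y, Rabs (y - p0) <= 2 * r -> Rabs (quot h f s y) <= M).
      { intros y Hy. apply Rabs_near in Hy. apply quot_bound; try lra. intros z Hz. apply Hfx; lra. }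
      assert (Ib : forall y, Rabs (y - p0) <= 2 * r -> Rabs (/ (sqrt (f (s + h) y) + sqrt (f s y))) <= / (2 * lam)).
      { intros y Hy. assert (Y1 := Bsqrt s y ltac:(lra) Hy). assert (Y2 := Bsqrt (s + h) y ltac:(lra) Hy).
        rewrite Rabs_right by (left; apply Rinv_0_lt_compat; lra). apply Rinv_le_contravar; lra. }
      unfold quot_rhs, Lr. apply product_lip.
      * apply Hfq; lra.
      * rewrite Rabs_mult. apply Rmult_le_compat; auto using Rabs_pos.
      * apply Lfq; auto; lra.
      * apply product_lip; auto.
        -- apply Rle_trans with (/ (2 * lam * (2 * lam)) *
             Rabs (sqrt (f (s + h) q) + sqrt (f s q) - (sqrt (f (s + h) t) + sqrt (f s t)))).
           { apply inverse_lip; lra. }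
           unfold Li. rewrite (Rmult_assoc (/ (2 * lam * (2 * lam)))).
           apply Rmult_le_compat_l; [left; apply Rinv_0_lt_compat; nra | ].
           replace (sqrt (f (s + h) q) + sqrt (f s q) - (sqrt (f (s + h) t) + sqrt (f s t)))
             with ((sqrt (f (s + h) q) - sqrt (f (s + h) t)) + (sqrt (f s q) - sqrt (f s t))) by ring.
           apply Rle_trans with (1 := Rabs_triang _ _).
           assert (G1 := Lsqrt (s + h) q t ltac:(lra) Hq Ht). assert (G2 := Lsqrt s q t ltac:(lra) Hq Ht).
           fold La in G1, G2. lra.
        -- apply (Hsec (quot h f s) (quot h fp s)); auto.
           ++ intros y Hy. apply quot_Dsec; auto; lra.
           ++ intros y Hy. apply Hgrad; auto; try lra. apply Rabs_le; lra.
Qed.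

(* The quotients [(f(x0+h,.) - f(x0,.))/h] converge pointwise and their derivatives are
   equi-Lipschitz, so the derivatives at [p0] form a Cauchy family as [h -> 0]. *)
Lemma mixed_derivative_exists (x0 p0 : R) : 0 < x0 -> 0 < p0 -> exists l, is_derive (fun s => fp s p0) x0 l.
Proof.
  intros Hx0 Hp0. destruct (quot_second_bound x0 p0 Hx0 Hp0) as [r [N [Hr [Hrx [Hrp [HN HNb]]]]]].
  set (D := fun t => (fp t p0 - fp x0 p0) / (t - x0)).
  set (A := fun k t => ((f t (p0 + k) - f t p0) - (f x0 (p0 + k) - f x0 p0)) / (t - x0)).
  (* The difference between the quotient of [fp] in x, multiplied by k, and the mixed second
     difference of f is a first order Taylor remainder of a quotient in p, hence of size N k^2
     uniformly in t. *)
  assert (Key : forall k t, 0 < k <= r -> t <> x0 -> Rabs (t - x0) <= r -> Rabs (k * D t - A k t) <= N * k * k).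
  { intros k t Hk Ht Htr.
    (* Quotients have h > 0, so for t < [x0] the base point is t itself. *)
    assert (Base : exists h x, 0 < h <= r /\ x0 - r <= x <= x0 /\
      (forall G p, quot h G x p = (G t p - G x0 p) / (t - x0))).
    { apply Rabs_near in Htr. destruct (Rlt_dec x0 t) as [H | H].
      - exists (t - x0), x0. split; [lra | split; [lra | ]]. intros G p. unfold quot.
        now replace (x0 + (t - x0)) with t by ring.
      - exists (x0 - t), t. split; [lra | split; [lra | ]]. intros G p. unfold quot.
        replace (t + (x0 - t)) with x0 by ring. field. lra. }
    destruct Base as [h [x [Hh [Hx HG]]]].
    assert (Eq : k * D t - A k t = - (quot h f x (p0 + k) - quot h f x p0 - quot h fp x p0 * k)).
    { rewrite !HG. unfold D, A. field. lra. }
    rewrite Eq, Rabs_Ropp.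
    destruct (mvt (quot h f x) (quot h fp x) p0 (p0 + k)) as [c [Hc E]]; [lra | | | ].
    { intros s Hs. apply quot_Dsec; auto; lra. }
    { intros s Hs. apply (cont_of_derive _ _ (quot h fp x s)), quot_Dsec; auto; lra. }
    rewrite E. replace (quot h fp x c * (p0 + k - p0) - quot h fp x p0 * k) with ((quot h fp x c - quot h fp x p0) * k) by ring.
    rewrite Rabs_mult, (Rabs_right k) by lra. apply Rmult_le_compat_r; [lra | ].
    apply Rle_trans with (N * Rabs (c - p0)).
    - apply (lipschitz_of_derive (quot h fp x) (quot h fq x) p0 (p0 + k)); try lra.
      + intros s Hs. apply quot_Dsec; auto; lra.
      + intros s Hs. apply HNb; auto. apply Rabs_le; lra.
    - rewrite Rabs_right by lra. apply Rmult_le_compat_l; lra. }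
  assert (HC : exists l, filterlim D (locally' x0) (locally l)).
  { apply (proj1 (filterlim_locally_cauchy (U := R_CompleteSpace) (FF := Rbar_locally'_filter (Finite x0)) D)).
    intros [eps Heps].
    (* The order of the choices matters: k first, making the Taylor remainder at most k eps / 8, and
       only then the neighbourhood of [x0] on which the mixed second difference is within k eps / 8
       of its limit. *)
    set (k := Rmin r (eps / (8 * (N + 1)))).
    assert (Hk : 0 < k /\ k <= r /\ N * k <= eps / 8).
    { assert (0 < eps / (8 * (N + 1))) by (apply Rdiv_lt_0_compat; lra).
      split; [apply Rmin_glb_lt; auto | split; [apply Rmin_l | ]].
      apply Rle_trans with ((N + 1) * (eps / (8 * (N + 1)))).
      - apply Rmult_le_compat; try lra; [apply Rmin_glb; lra | apply Rmin_r].
      - right. field. lra. }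
    destruct Hk as [Hk [Hkr HkN]]. clearbody k.
    assert (DA : is_derive (fun t => f t (p0 + k) - f t p0) x0 (fx x0 (p0 + k) - fx x0 p0)).
    { apply D_minus; apply f_x; lra. }
    destruct (proj1 (derive_eps _ _ _) DA (eps * k / 8)) as [d [Hd Hdd]].
    { apply Rdiv_lt_0_compat; [apply Rmult_lt_0_compat | ]; lra. }
    exists (fun t => t <> x0 /\ Rabs (t - x0) < Rmin d r). split.
    - exists (mkposreal (Rmin d r) (Rmin_glb_lt _ _ _ Hd Hr)). intros t Ht Hne. now split.
    - intros s t [Hs1 Hs2] [Ht1 Ht2]. change (Rabs (D t - D s) < eps).
      assert (L1 := Rmin_l d r). assert (L2 := Rmin_r d r).
      assert (K1 := Key k s ltac:(lra) Hs1 ltac:(lra)). assert (K2 := Key k t ltac:(lra) Ht1 ltac:(lra)).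
      assert (A1 := Hdd s Hs1 ltac:(lra)). assert (A2 := Hdd t Ht1 ltac:(lra)).
      fold (A k s) in A1. fold (A k t) in A2.
      assert (HNk : N * k * k <= eps / 8 * k) by (apply Rmult_le_compat_r; lra).
      apply Rabs_le_between in K1, K2. apply Rabs_def2 in A1, A2.
      apply Rmult_lt_reg_l with k; auto.
      rewrite <- (Rabs_right k) at 1 by lra. rewrite <- Rabs_mult. apply Rabs_def1; nra. }
  destruct HC as [l Hl]. exists l. apply derive_eps. intros eps Heps.
  destruct (proj1 (filterlim_locally _ _) Hl (mkposreal eps Heps)) as [d Hd].
  exists d. split; [apply cond_pos | ]. intros t Hne Ht. apply (Hd t Ht Hne).
Qed.

Lemma mixed_derivative_bound (x0 p0 T rho lam M l : R) :
  0 < T -> T < x0 -> 0 < rho -> rho < p0 -> 0 < lam -> 0 <= M ->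
  (forall x p, x0 - T <= x <= x0 + T -> Rabs (p - p0) <= rho -> lam * lam <= f x p /\ Rabs (fx x p) <= M) ->
  is_derive (fun s => fp s p0) x0 l ->
  Rabs l <= 8 * M / rho + rho * (M * M / (2 * (lam * lam))) / lam + M * rho / (lam * T).
Proof.
  intros HT HTx Hrho Hrp Hlam HM H Hl.
  apply (derive_abs_le_right (fun s => fp s p0) x0 l _ T HT Hl). intros t Ht.
  set (h := t - x0). assert (Hh : 0 < h < T) by (unfold h; lra).
  replace (fp t p0 - fp x0 p0) with (quot h fp x0 p0 * h).
  2:{ unfold quot. replace (x0 + h) with t by (unfold h; ring). field. lra. }
  rewrite Rabs_mult, (Rabs_right h) by lra. apply Rmult_le_compat_r; [lra | ].
  apply quot_gradient_bound; auto; try lra. intros x p Hx Hp. apply H; auto; lra.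
Qed.

End Quotients.

(** * Decay of the mixed derivative along streamlines *)

Section MixedDecay.

Variables f fx fp fq : R -> R -> R.
Hypothesis f_cont : forall x p, 0 < x -> 0 < p -> cont2 f x p.
Hypothesis f_x : forall x p, 0 < x -> 0 < p -> is_derive (fun s => f s p) x (fx x p).
Hypothesis f_p : forall x p, 0 < x -> 0 < p -> is_derive (f x) p (fp x p).
Hypothesis f_q : forall x p, 0 < x -> 0 < p -> is_derive (fp x) p (fq x p).
Hypothesis f_pos : forall x p, 0 < x -> 0 < p -> 0 < f x p.
Hypothesis f_eq : forall x p, 0 < x -> 0 < p -> fx x p = sqrt (f x p) * fq x p.
Variables k b C c : R.
Hypothesis k_pos : 0 < k <= 1.
Hypothesis b_ge1 : 1 <= b.
Hypothesis C_pos : 0 < C.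
Hypothesis c_pos : 0 < c.
Hypothesis f_low : forall x p, 0 < x -> 0 < p -> k * Rmin (p / sqrt (x + b)) 1 <= f x p.
Hypothesis fx_decay : forall x p, 1 <= x -> 0 < p ->
  Rabs (fx x p) <= C / x * (p / sqrt x * exp (- c * (p ^ 2 / x))).

(** The gradient estimate is used on a box of height x/4 and width mu sqrt x / 4, mu = min(p / sqrt
    x, 1), with lam proportional to mu. As [fx] is of size mu E / x with a Gaussian E, mu cancels in
    the first two terms, and the third has a surplus factor mu <= 1; all three are of order
    x^(-3/2), uniformly up to the wall. *)
Lemma mixed_derivative_decay : exists C' c', 0 < C' /\ 0 < c' /\ forall x p l, 2 <= x -> 0 < p ->
  is_derive (fun s => fp s p) x l -> Rabs l <= C' / (x * sqrt x) * exp (- c' * (p ^ 2 / x)).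
Proof.
  set (ka := 1 + 8 / c). assert (Hc8 : 0 < 8 / c) by (apply Rdiv_lt_0_compat; lra).
  set (A := 4 * C * ka). assert (HA : 0 < A) by (unfold A, ka; nra).
  set (B := sqrt (5 / 4 + b)).
  assert (EB : B * B = 5 / 4 + b) by (apply sqrt_sqrt; lra).
  assert (HB0 : 0 < B) by (apply sqrt_lt_R0; lra). assert (HB : 1 <= B) by nra.
  set (k2 := k * (3 / (4 * B))).
  assert (HB3 : 0 < 3 / (4 * B) <= 1).
  { split; [apply Rdiv_lt_0_compat; lra | ]. apply Rmult_le_reg_r with (4 * B); [lra | ].
    unfold Rdiv. rewrite Rmult_assoc, Rinv_l by lra. lra. }
  assert (Hk2 : 0 < k2 <= 1) by (unfold k2; nra).
  set (Cf := 32 * A + A * A / (8 * (k2 * k2 * k2)) + A / k2).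
  assert (Hk23 : 0 < k2 * k2 * k2) by (repeat apply Rmult_lt_0_compat; lra).
  assert (HCf : 0 < Cf).
  { assert (0 < A * A / (8 * (k2 * k2 * k2))) by (apply Rdiv_lt_0_compat; nra).
    assert (0 < A / k2) by (apply Rdiv_lt_0_compat; lra). unfold Cf. lra. }
  exists Cf, (c / 8). split; [auto | split; [lra | ]]. intros x0 p0 l Hx0 Hp0 Hl.
  set (r := sqrt x0). assert (Hr : 0 < r) by (apply sqrt_lt_R0; lra).
  assert (Er : r * r = x0) by (apply sqrt_sqrt; lra).
  set (s := p0 / r). assert (Hs : 0 < s) by (apply Rdiv_lt_0_compat; auto).
  assert (Es : p0 = s * r) by (unfold s; field; lra).
  assert (Ey : p0 ^ 2 / x0 = s ^ 2) by (rewrite Es, <- Er; field; lra).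
  set (mu := Rmin s 1).
  assert (Hmu : 0 < mu /\ mu <= s /\ mu <= 1) by (unfold mu; split; [apply Rmin_glb_lt; lra | split; [apply Rmin_l | apply Rmin_r]]).
  destruct Hmu as [Hmu0 [Hmus Hmu1]].
  set (E := exp (- (c / 8) * s ^ 2)). assert (HE : 0 < E) by apply exp_pos.
  assert (HE1 : E <= 1).
  { unfold E. rewrite <- exp_0. apply exp_le. assert (0 <= s ^ 2) by apply pow2_ge_0. nra. }
  (* The factor s is kept for s <= 1, where vanishing at the wall is needed, and spent against half
     of the Gaussian for s > 1; the constant 8 / c is 2 / (c/4). *)
  assert (HsE : s * exp (- (c / 4) * s ^ 2) <= ka * (mu * E)).
  { unfold mu, Rmin. destruct (Rle_dec s 1) as [H1 | H1].
    - assert (exp (- (c / 4) * s ^ 2) <= E).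
      { apply exp_le. assert (0 <= s ^ 2) by apply pow2_ge_0. nra. }
      assert (s * exp (- (c / 4) * s ^ 2) <= s * E) by (apply Rmult_le_compat_l; lra).
      assert (0 < s * E) by (apply Rmult_lt_0_compat; lra). unfold ka. nra.
    - assert (H := poly_gauss (c / 4) s ltac:(lra) ltac:(lra)).
      replace (2 / (c / 4)) with (8 / c) in H by (field; lra).
      replace (- (c / 4 / 2)) with (- (c / 8)) in H by field. fold E ka in H. lra. }
  set (M := A / x0 * (mu * E)).
  assert (HM : 0 <= M).
  { unfold M. apply Rmult_le_pos; [apply Rdiv_le_0_compat; lra | nra]. }
  assert (Hmr : mu * r <= p0) by (rewrite Es; apply Rmult_le_compat_r; lra).
  assert (Hmr0 : 0 < mu * r) by (now apply Rmult_lt_0_compat).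
  rewrite Ey. fold E.
  assert (G := mixed_derivative_bound f fx fp fq f_cont f_x f_p f_q f_pos f_eq x0 p0 (x0 / 4) (mu * r / 4) (k2 * mu) M l
    ltac:(lra) ltac:(lra) ltac:(lra) ltac:(lra) ltac:(apply Rmult_lt_0_compat; lra) HM).
  apply Rle_trans with (8 * M / (mu * r / 4) + mu * r / 4 * (M * M / (2 * (k2 * mu * (k2 * mu)))) / (k2 * mu)
     + M * (mu * r / 4) / (k2 * mu * (x0 / 4))).
  - apply G; auto. clear G. intros x p Hx Hp. apply Rabs_near in Hp.
    assert (Hp1 : 3 / 4 * p0 <= p <= 5 / 4 * p0) by lra. split.
    + apply Rle_trans with (2 := f_low x p ltac:(lra) ltac:(lra)).
      assert (HxB : sqrt (x + b) <= B * r).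
      { rewrite <- (sqrt_square (B * r)) by (apply Rmult_le_pos; lra). apply sqrt_le_1_alt.
        replace (B * r * (B * r)) with (B * B * (r * r)) by ring. rewrite EB, Er. nra. }
      assert (Hxb : 0 < sqrt (x + b)) by (apply sqrt_lt_R0; lra).
      assert (Hlow : 3 / (4 * B) * s <= p / sqrt (x + b)).
      { apply Rle_trans with (3 / 4 * p0 / (B * r)).
        - right. unfold s. field. lra.
        - apply Rmult_le_compat; try lra; [left; apply Rinv_0_lt_compat; nra | apply Rinv_le_contravar; auto]. }
      assert (Hmin : 3 / (4 * B) * mu <= Rmin (p / sqrt (x + b)) 1).
      { apply Rmin_glb; [ | nra]. apply Rle_trans with (2 := Hlow). apply Rmult_le_compat_l; lra. }
      (* The lower bound on f is linear in mu; as k2 mu <= 1, it also dominates the square (k2 mu)^2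
         demanded by the ellipticity. *)
      apply Rle_trans with (k2 * mu).
      * assert (0 < k2 * mu) by (apply Rmult_lt_0_compat; lra). assert (k2 * mu <= 1) by nra. nra.
      * unfold k2. rewrite Rmult_assoc. apply Rmult_le_compat_l; lra.
    + apply Rle_trans with (1 := fx_decay x p ltac:(lra) ltac:(lra)).
      assert (Hsx : 4 / 5 * r <= sqrt x).
      { rewrite <- (sqrt_square (4 / 5 * r)) by lra. apply sqrt_le_1_alt. nra. }
      assert (H1 : p / sqrt x <= 2 * s).
      { apply Rle_trans with (5 / 4 * p0 / (4 / 5 * r)).
        - apply Rmult_le_compat; try lra; [left; apply Rinv_0_lt_compat; lra | apply Rinv_le_contravar; lra].
        - rewrite Es. replace (5 / 4 * (s * r) / (4 / 5 * r)) with (25 / 16 * s) by (field; lra). lra. }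
      assert (H2 : exp (- c * (p ^ 2 / x)) <= exp (- (c / 4) * s ^ 2)).
      { assert (0 <= s ^ 2) by apply pow2_ge_0. apply gauss_le; [nra | ].
        enough (/ 4 * s ^ 2 <= p ^ 2 / x) by nra.
        apply Rmult_le_reg_r with x; [lra | ]. replace (p ^ 2 / x * x) with (p ^ 2) by (field; lra).
        assert ((3 / 4 * p0) ^ 2 <= p ^ 2) by (apply pow_incr; lra).
        replace ((3 / 4 * p0) ^ 2) with (9 / 16 * (s ^ 2 * x0)) in H0 by (rewrite Es, <- Er; field). nra. }
      assert (H3 : C / x <= 2 * C / x0).
      { apply Rmult_le_reg_r with (x * x0); [nra | ].
        replace (C / x * (x * x0)) with (C * x0) by (field; lra).
        replace (2 * C / x0 * (x * x0)) with (2 * C * x) by (field; lra). nra. }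
      assert (P1 : 0 <= p / sqrt x) by (apply Rdiv_le_0_compat; lra).
      apply Rle_trans with (2 * C / x0 * (2 * s * exp (- (c / 4) * s ^ 2))).
      * apply Rmult_le_compat; auto.
        -- apply Rdiv_le_0_compat; lra.
        -- apply Rmult_le_pos; [auto | left; apply exp_pos].
        -- apply Rmult_le_compat; auto. left; apply exp_pos.
      * unfold M, A. replace (4 * C * ka / x0 * (mu * E)) with (4 * C / x0 * (ka * (mu * E))) by (field; lra).
        replace (2 * C / x0 * (2 * s * exp (- (c / 4) * s ^ 2))) with (4 * C / x0 * (s * exp (- (c / 4) * s ^ 2))) by (field; lra).
        apply Rmult_le_compat_l; [apply Rdiv_le_0_compat; lra | exact HsE].
  - assert (I : 0 < / (x0 * r)) by (apply Rinv_0_lt_compat; nra).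
    unfold M. rewrite <- Er.
    replace (8 * (A / (r * r) * (mu * E)) / (mu * r / 4)) with (32 * A * E * / (r * r * r)) by (field; lra).
    replace (mu * r / 4 * (A / (r * r) * (mu * E) * (A / (r * r) * (mu * E)) / (2 * (k2 * mu * (k2 * mu)))) / (k2 * mu))
      with (A * A / (8 * (k2 * k2 * k2)) * (E * E) * / (r * r * r)) by (field; lra).
    replace (A / (r * r) * (mu * E) * (mu * r / 4) / (k2 * mu * (r * r / 4)))
      with (A / k2 * (mu * E) * / (r * r * r)) by (field; lra).
    replace (Cf / (r * r * r) * E) with (Cf * E * / (r * r * r)) by (field; lra).
    rewrite <- !Rmult_plus_distr_r. rewrite Er. apply Rmult_le_compat_r; [lra | ]. unfold Cf.
    assert (0 <= A * A / (8 * (k2 * k2 * k2))) by (apply Rdiv_le_0_compat; nra).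
    assert (0 <= A / k2) by (apply Rdiv_le_0_compat; lra).
    assert (E * E <= E) by nra. assert (mu * E <= E) by nra. nra.
Qed.

End MixedDecay.

(** * Estimates for the Prandtl system *)

Lemma gauss_weaken (A A' a a' t : R) : 0 <= A -> A <= A' -> 0 <= a' -> a' <= a -> 0 <= t ->
  A * exp (- a * t) <= A' * exp (- a' * t).
Proof.
  intros HA HAA Ha Haa Ht. apply Rmult_le_compat; auto; [left; apply exp_pos | ].
  apply gauss_le; [apply Rmult_le_pos; lra | apply Rmult_le_compat_r; lra].
Qed.

Lemma inv_x_sqrt_le (x : R) : 1 <= x -> / (x * sqrt x) <= / x.
Proof.
  intros Hx. apply Rinv_le_contravar; [lra | ].
  assert (1 <= sqrt x) by (rewrite <- sqrt_1; apply sqrt_le_1_alt; lra). nra.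
Qed.

Section Estimates.

Variables U V W P Q : R -> R -> R.
Hypothesis HP : prandtl U V W P Q.
Variables (f f1 f2 f3 : R -> R) (C1 C2 : R).
Hypothesis HB : blasius f f1 f2 f3 C1 C2.
Variables (k0 K0 C4 C5 : R).
Hypothesis k0_pos : 0 < k0.
Hypothesis K0_pos : 0 < K0.
Hypothesis C4_pos : 0 < C4.
Hypothesis C5_pos : 0 < C5.
Hypothesis init_low : forall y, 0 <= y -> k0 * Rmin y 1 <= U 0 y.
Hypothesis init_lin : forall y, 0 <= y -> U 0 y <= K0 * y.
Hypothesis init_le1 : forall y, 0 <= y -> U 0 y <= 1.
Hypothesis init_gauss : forall y, 0 <= y -> 1 - U 0 y <= C4 * exp (- C5 * y ^ 2).
Hypothesis init_incr : forall y1 y2, 0 <= y1 -> y1 <= y2 -> U 0 y1 <= U 0 y2.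
Variables u1 u2 : R -> R.
Hypothesis init_D1 : forall y, 0 < y -> is_derive (U 0) y (u1 y).
Hypothesis init_D2 : forall y, 0 < y -> is_derive u1 y (u2 y).
Hypothesis init_u1 : forall y, 0 < y -> u1 y <= K0.
Hypothesis init_u2 : forall y, 0 < y -> u2 y <= 0.
Hypothesis U_bdd : forall X, 0 < X -> exists M, forall x y, 0 <= x <= X -> 0 <= y -> Rabs (U x y) <= M.
Hypothesis P_bdd : forall X, 0 < X -> exists M, forall x y, 0 <= x <= X -> 0 <= y -> Rabs (P x y) <= M.
Hypothesis Q_bdd : forall X, 0 < X -> exists M, forall x y, 0 <= x <= X -> 0 <= y -> Rabs (Q x y) <= M.
Hypothesis W_bdd : forall X, 0 < X -> exists M, forall x y, 0 <= x <= X -> 0 <= y <= 1 -> Rabs (W x y) <= M.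

(** u_xy is recovered from u_y(x, y) = phi_psi(x, psi(x, y)) / 2 by the chain rule: u_xy = (phi_xpsi
    - v phi_psipsi) / 2. The restriction x >= 2 keeps the boxes of the mixed estimate inside x >= 1,
    where the decay bounds hold. *)
Lemma prandtl_estimates : exists C c, 0 < C /\ 0 < c /\ forall x y, 2 <= x -> 0 < y ->
  let E := C / x * exp (- c * (y ^ 2 / x)) in
  - E <= Q x y <= 0 /\
  Rabs (P x y - f2 (y / sqrt (x + 1)) / sqrt (x + 1)) <= E /\
  Rabs (W x y) <= E /\
  exists l, is_derive (fun s => P s y) x l /\ Rabs l <= E.
Proof.
  destruct (von_mises_exists U V W P Q HP) as [psi [Y HV]].
  destruct (blasius_inverse f f1 f2 f3 C1 C2 HB) as [g [g_f [f_g [g_0 [g_lt [g_cont g_D]]]]]].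
  destruct (sandwich_lower U V W P Q psi Y HP HV f f1 f2 f3 C1 C2 HB g g_f g_0 g_lt g_cont g_D
    k0 K0 C4 C5 k0_pos K0_pos C4_pos C5_pos init_low init_lin init_le1 init_gauss) as [b [b_ge1 low]].
  assert (up : forall x p, 0 < x -> 0 <= p -> vm_phi U Y x p <= prof f1 g (p / sqrt x)).
  { apply (sandwich_upper U V W P Q psi Y HP HV f f1 f2 f3 C1 C2 HB g g_f f_g g_0 g_lt g_cont g_D K0 K0_pos
      init_le1 u1 init_D1 init_u1 U_bdd). }
  assert (ULow : forall x y, 0 <= x -> 0 <= y -> f1 (y / sqrt (x + b)) <= U x y).
  { now apply (U_lower U V W P Q psi Y HP HV f f1 f2 f3 C1 C2 HB g). }
  assert (UUp : forall x y, 0 < x -> 0 <= y -> U x y <= f1 (y / sqrt x)).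
  { now apply (U_upper U V W P Q psi Y HP HV f f1 f2 f3 C1 C2 HB g). }
  assert (Q0 : forall x y, 0 < x -> 0 < y -> Q x y <= 0).
  { intros x y Hx Hy.
    assert (H : vm_phi_x Q Y x (psi x y) <= 0).
    { apply (phi_x_le0 U V W P Q psi Y HP HV f f1 f2 f3 C1 C2 HB g g_0 g_lt g_cont g_D b b_ge1 low
        U_bdd P_bdd Q_bdd W_bdd u1 u2 init_D1 init_D2 init_u2); auto. now apply (vm_psi_pos U V psi Y HV). }
    unfold vm_phi_x in H. rewrite (vm_Y_psi _ _ _ _ HV) in H. lra. }
  assert (QP : forall x y, 0 < x -> 0 < y -> 0 <= 2 * x * Q x y + psi x y * P x y).
  { intros x y Hx Hy.
    assert (H : 0 <= 2 * x * vm_phi_x Q Y x (psi x y) + psi x y * vm_phi_p P Y x (psi x y)).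
    { apply (phi_scaling_derive U V W P Q psi Y HP HV f f1 f2 f3 C1 C2 HB g g_0 g_lt g_cont g_D b b_ge1 low
        U_bdd P_bdd Q_bdd W_bdd init_incr); auto. now apply (vm_psi_pos U V psi Y HV). }
    unfold vm_phi_x, vm_phi_p in H. rewrite (vm_Y_psi _ _ _ _ HV) in H. lra. }
  assert (V0 : forall x y, 0 < x -> 0 < y -> 0 <= V x y).
  { intros x y Hx Hy. assert (HU := pr_U_pos _ _ _ _ _ HP x y Hy).
    assert (H : 0 <= V x (Y x (psi x y)) / U x (Y x (psi x y))).
    { apply (Y_x_ge0 U V W P Q psi Y HP HV f f1 f2 f3 C1 C2 HB g g_0 g_lt g_cont g_D b b_ge1 low
        U_bdd P_bdd Q_bdd W_bdd u1 u2 init_D1 init_D2 init_u2); auto. now apply (vm_psi_pos U V psi Y HV). }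
    rewrite (vm_Y_psi _ _ _ _ HV) in H. replace (V x y) with (V x y / U x y * U x y) by (field; lra).
    apply Rmult_le_pos; lra. }
  assert (V1 : forall x y, 0 < x -> 0 < y -> 2 * x * V x y + psi x y <= y * U x y).
  { intros x y Hx Hy. assert (HU := pr_U_pos _ _ _ _ _ HP x y Hy).
    assert (H : 2 * x * (V x (Y x (psi x y)) / U x (Y x (psi x y))) + psi x y * / U x (Y x (psi x y)) <= Y x (psi x y)).
    { apply (Y_scaling_derive U V W P Q psi Y HP HV f f1 f2 f3 C1 C2 HB g g_0 g_lt g_cont g_D b b_ge1 low
        U_bdd P_bdd Q_bdd W_bdd init_incr); auto. now apply (vm_psi_pos U V psi Y HV). }
    rewrite (vm_Y_psi _ _ _ _ HV) in H. apply Rmult_le_compat_r with (r := U x y) in H; [ | lra].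
    replace ((2 * x * (V x y / U x y) + psi x y * / U x y) * U x y) with (2 * x * V x y + psi x y) in H by (field; lra).
    exact H. }
  assert (Ux0 : forall x, U x 0 = 0) by (intros; apply (pr_U_0 _ _ _ _ _ HP); lra).
  assert (Uc := pr_U_cont _ _ _ _ _ HP).
  assert (Uy := pr_U_y _ _ _ _ _ HP). assert (Py := pr_P_y _ _ _ _ _ HP).
  assert (Up := pr_U_pos _ _ _ _ _ HP).
  assert (psip := vm_psi_pos U V psi Y HV).
  assert (Heq := pr_eq _ _ _ _ _ HP).
  destruct (decay_bounds U V W P Q psi f f1 f2 f3 C1 C2 HB b b_ge1 Ux0 Uc Uy Py Up psip Heq ULow UUp Q0 QP V0 V1)
    as [A [a [HA [Ha HAb]]]].
  destruct (derivative_difference_bound U V W P Q psi f f1 f2 f3 C1 C2 HB b b_ge1 Ux0 Uc Uy Py Up psip Heq ULow UUp Q0 QP V0 V1)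
    as [B [b' [HBp [Hb' HBb]]]].
  assert (Hpsi_le : forall x y, 0 < x -> 0 < y -> psi x y <= y).
  { intros x y Hx Hy. now apply (psi_le_y U V psi f f1 f2 f3 C1 C2 HB). }
  assert (Hp1 := prof_pos _ _ _ _ _ _ HB g g_0 g_lt 1 ltac:(lra)).
  assert (Hp1' := prof_le_1 _ _ _ _ _ _ HB g g_0 g_lt 1 ltac:(lra)).
  assert (phi_low : forall x p, 0 < x -> 0 < p -> prof f1 g 1 * Rmin (p / sqrt (x + b)) 1 <= vm_phi U Y x p).
  { intros x p Hx Hp. apply Rle_trans with (2 := low x p ltac:(lra) ltac:(lra)).
    apply (prof_ge_min _ _ _ _ _ _ HB g); auto. apply Rdiv_le_0_compat; [lra | apply sqrt_lt_R0; lra]. }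
  assert (phi_x_decay : forall x p, 1 <= x -> 0 < p ->
    Rabs (vm_phi_x Q Y x p) <= A / x * (p / sqrt x * exp (- a * (p ^ 2 / x)))).
  { intros x p Hx Hp. set (y := Y x p). assert (Hy : 0 < y) by now apply (vm_Y_pos U V psi Y HV).
    assert (Ep : p = psi x y) by (unfold y; now rewrite (vm_psi_Y _ _ _ _ HV)).
    unfold vm_phi_x. fold y.
    assert (HQ := Q_abs P Q psi Q0 QP x y ltac:(lra) Hy). rewrite <- Ep in HQ.
    destruct (HAb x y Hx Hy) as [HPb _]. assert (Hpy : p <= y) by (rewrite Ep; apply Hpsi_le; lra).
    rewrite Rabs_mult, (Rabs_right 2) by lra.
    assert (Hr : 0 < sqrt x) by (apply sqrt_lt_R0; lra).
    apply Rle_trans with (p * P x y / x).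
    { apply Rle_trans with (2 * (p * P x y / (2 * x))); [lra | right; field; lra]. }
    replace (A / x * (p / sqrt x * exp (- a * (p ^ 2 / x)))) with (p * (A / sqrt x * exp (- a * (p ^ 2 / x))) / x) by (field; lra).
    apply Rmult_le_compat_r; [left; apply Rinv_0_lt_compat; lra | ]. apply Rmult_le_compat_l; [lra | ].
    apply Rle_trans with (1 := HPb). apply Rmult_le_compat_l; [apply Rdiv_le_0_compat; lra | ].
    assert (p ^ 2 <= y ^ 2) by (apply pow_incr; lra).
    assert (p ^ 2 / x <= y ^ 2 / x) by (apply Rmult_le_compat_r; [left; apply Rinv_0_lt_compat; lra | auto]).
    assert (0 <= p ^ 2 / x) by (apply Rdiv_le_0_compat; [apply pow2_ge_0 | lra]). apply gauss_le; nra. }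
  assert (phi_cont' : forall x p, 0 < x -> 0 < p -> cont2 (vm_phi U Y) x p) by (intros; now apply (phi_cont U V W P Q psi Y)).
  assert (phi_x_cont' : forall x p, 0 < x -> 0 < p -> cont2 (vm_phi_x Q Y) x p) by (intros; now apply (phi_x_cont U V W P Q psi Y)).
  assert (phi_p_cont' : forall x p, 0 < x -> 0 < p -> cont2 (vm_phi_p P Y) x p) by (intros; now apply (phi_p_cont U V W P Q psi Y)).
  assert (phi_q_cont' : forall x p, 0 < x -> 0 < p -> cont2 (vm_phi_q U Q Y) x p) by (intros; now apply (phi_q_cont U V W P Q psi Y)).
  assert (phi_Dx' := phi_Dx U V W P Q psi Y HP HV). assert (phi_Dp' := phi_Dp U V W P Q psi Y HP HV).
  assert (phi_Dq' := phi_Dq U V W P Q psi Y HP HV).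
  assert (phi_pos' : forall x p, 0 < x -> 0 < p -> 0 < vm_phi U Y x p) by (intros; now apply (phi_pos U V W P Q psi Y)).
  assert (phi_eq' : forall x p, 0 < x -> 0 < p -> vm_phi_x Q Y x p = sqrt (vm_phi U Y x p) * vm_phi_q U Q Y x p)
    by (intros; now apply (phi_eq U V W P Q psi Y)).
  destruct (mixed_derivative_decay (vm_phi U Y) (vm_phi_x Q Y) (vm_phi_p P Y) (vm_phi_q U Q Y) phi_cont' phi_Dx' phi_Dp' phi_Dq'
    phi_pos' phi_eq' (prof f1 g 1) b A a ltac:(lra) b_ge1 HA Ha phi_low phi_x_decay) as [L [e [HL [He HLb]]]].
  (* [psi >= r f(y / r)], [r = sqrt (x + b)], and [f] grows linearly *)
  set (kf := f1 1). assert (Hkf : 0 < kf) by (apply (bl_f1_pos _ _ _ _ _ _ HB); lra).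
  (* Squaring kf y <= psi + kf r gives kf^2 y^2 <= 2 psi^2 + 2 kf^2 (x + b). The first 2, with x + b
     <= (1 + b) x, produces the denominator; the last term is the constant factor exp(e kf^2) of
     [L']. *)
  set (e' := e * (kf * kf) / (2 * (1 + b))).
  assert (He' : 0 < e') by (apply Rdiv_lt_0_compat; [repeat apply Rmult_lt_0_compat | ]; lra).
  set (L' := L * exp (e * (kf * kf))).
  assert (HL' : 0 < L') by (apply Rmult_lt_0_compat; [lra | apply exp_pos]).
  assert (Hconv : forall x y, 1 <= x -> 0 < y ->
    L * exp (- e * (psi x y ^ 2 / x)) <= L' * exp (- e' * (y ^ 2 / x))).
  { intros x y Hx Hy. set (r := sqrt (x + b)). assert (Hr : 0 < r) by (apply sqrt_lt_R0; lra).
    assert (Er : r * r = x + b) by (apply sqrt_sqrt; lra).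
    assert (Hpl : r * f (y / r) <= psi x y).
    { enough (psi x 0 - r * f (0 / r) <= psi x y - r * f (y / r)).
      { rewrite (vm_psi_0 _ _ _ _ HV), Rdiv_0_l, (bl_f0 _ _ _ _ _ _ HB) in H. lra. }
      apply (nondecr_of_derive (fun t => psi x t - r * f (t / r)) (fun t => U x t - f1 (t / r))); [lra | | | ].
      - intros t Ht. apply D_minus; [apply (vm_psi_y _ _ _ _ HV); lra | ].
        apply (D_eq _ _ (0 * f (t / r) + r * (f1 (t / r) * / r))); [ | field; lra].
        apply (D_mult (fun _ => r) (fun t => f (t / r))); [apply D_const | ].
        apply (D_comp f (fun t => t / r)); [apply (bl_Df _ _ _ _ _ _ HB), Rdiv_le_0_compat; lra | ].
        auto_derive; [exact I | field; lra].
      - intros t Ht. specialize (ULow x t ltac:(lra) ltac:(lra)). fold r in ULow. lra.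
      - intros t Ht. apply cont_minus; [apply cont2_sec, (vm_psi_cont _ _ _ _ HV) | ].
        apply cont_mult; [apply cont_const | ]. apply (cont_comp (fun t => t / r) f).
        + apply cont_mult; [apply continuous_id | apply cont_const].
        + apply (bl_cf _ _ _ _ _ _ HB), Rdiv_le_0_compat; lra. }
    assert (Hyr : 0 <= y / r) by (apply Rdiv_le_0_compat; lra).
    assert (Hfl := bl_f_ge_linear _ _ _ _ _ _ HB (y / r) Hyr). fold kf in Hfl.
    assert (Hlin : kf * y <= psi x y + kf * r).
    { assert (r * (kf * (y / r - 1)) <= r * f (y / r)) by (apply Rmult_le_compat_l; lra).
      replace (r * (kf * (y / r - 1))) with (kf * y - kf * r) in H by (field; lra). lra. }
    assert (Hpp := psip x y Hy).
    assert (Hsq : kf * kf * y ^ 2 <= 2 * psi x y ^ 2 + 2 * (kf * kf) * (x + b)).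
    { rewrite <- Er. assert (0 <= kf * y) by (apply Rmult_le_pos; lra).
      assert ((kf * y) ^ 2 <= (psi x y + kf * r) ^ 2) by (apply pow_incr; lra).
      assert (0 <= (psi x y - kf * r) ^ 2) by apply pow2_ge_0. nra. }
    unfold L'. rewrite Rmult_assoc. apply Rmult_le_compat_l; [lra | ]. rewrite <- exp_plus. apply exp_le.
    apply Rmult_le_reg_r with (2 * (1 + b) * x); [nra | ].
    replace (- e * (psi x y ^ 2 / x) * (2 * (1 + b) * x)) with (- (2 * e * (1 + b) * psi x y ^ 2)) by (field; lra).
    replace ((e * (kf * kf) + - e' * (y ^ 2 / x)) * (2 * (1 + b) * x))
      with (2 * (1 + b) * x * e * (kf * kf) - e * (kf * kf * y ^ 2)) by (unfold e'; field; lra).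
    assert (Hb1 : x + b <= (1 + b) * x) by nra.
    assert (0 <= psi x y ^ 2) by apply pow2_ge_0.
    assert (e * (kf * kf * y ^ 2) <= e * (2 * psi x y ^ 2 + 2 * (kf * kf) * (x + b))) by (apply Rmult_le_compat_l; lra).
    assert (e * (kf * kf) * (x + b) <= e * (kf * kf) * ((1 + b) * x)).
    { apply Rmult_le_compat_l; [ | auto]. apply Rmult_le_pos; nra. }
    assert (0 <= e * b * psi x y ^ 2) by (apply Rmult_le_pos; [apply Rmult_le_pos; lra | auto]). nra. }
  (* Here phi_psipsi v = u_yy (2 v / u), and 2 x v + psi <= y u bounds 2 v / u by y / x, so the
     quotient by u does no harm at the wall. *)
  assert (HVQ : forall x y, 1 <= x -> 0 < y ->
    Rabs (vm_phi_q U Q Y x (psi x y) * - V x y) <= A * (1 + 2 / a) / x * exp (- (a / 2) * (y ^ 2 / x))).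
  { intros x y Hx Hy. destruct (HAb x y Hx Hy) as [_ [HQ _]]. assert (HU := Up x y Hy).
    unfold vm_phi_q. rewrite (vm_Y_psi _ _ _ _ HV).
    replace (2 * Q x y / U x y * - V x y) with (Q x y * - (2 * V x y / U x y)) by (field; lra).
    set (r := sqrt x). assert (Hr : 1 <= r) by (unfold r; rewrite <- sqrt_1; apply sqrt_le_1_alt; lra).
    assert (Er : r * r = x) by (apply sqrt_sqrt; lra).
    assert (HVU : Rabs (- (2 * V x y / U x y)) <= y / r).
    { specialize (V0 x y ltac:(lra) Hy). specialize (V1 x y ltac:(lra) Hy). specialize (psip x y Hy).
      rewrite Rabs_Ropp, Rabs_right by (apply Rle_ge, Rdiv_le_0_compat; lra).
      apply Rle_trans with (y / x).
      - apply Rmult_le_reg_r with (x * U x y); [nra | ].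
        replace (2 * V x y / U x y * (x * U x y)) with (2 * x * V x y) by (field; lra).
        replace (y / x * (x * U x y)) with (y * U x y) by (field; lra). lra.
      - apply Rmult_le_compat_l; [lra | ]. apply Rinv_le_contravar; [lra | nra]. }
    rewrite Rabs_mult.
    apply Rle_trans with (A / x * exp (- a * (y ^ 2 / x)) * (y / r)).
    - apply Rmult_le_compat; auto using Rabs_pos.
    - assert (Ey : y ^ 2 / x = (y / r) ^ 2) by (symmetry; apply sq_div_sqrt; lra).
      assert (Hyr : 0 <= y / r) by (apply Rdiv_le_0_compat; lra).
      assert (G := poly_gauss a (y / r) Ha Hyr). rewrite Ey.
      replace (A / x * exp (- a * (y / r) ^ 2) * (y / r)) with (A / x * (y / r * exp (- a * (y / r) ^ 2))) by ring.
      replace (A * (1 + 2 / a) / x * exp (- (a / 2) * (y / r) ^ 2))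
        with (A / x * ((1 + 2 / a) * exp (- (a / 2) * (y / r) ^ 2))) by (field; lra).
      apply Rmult_le_compat_l; [apply Rdiv_le_0_compat; lra | exact G]. }
  set (A' := A * (1 + 2 / a)).
  assert (HA' : 0 < A') by (apply Rmult_lt_0_compat; [lra | assert (0 < 2 / a) by (apply Rdiv_lt_0_compat; lra); lra]).
  set (c := Rmin (Rmin (a / 2) b') e').
  assert (Hc : 0 < c) by (unfold c; repeat apply Rmin_glb_lt; lra).
  assert (Hca : c <= a / 2) by (unfold c; apply Rle_trans with (1 := Rmin_l _ _), Rmin_l).
  assert (Hcb : c <= b') by (unfold c; apply Rle_trans with (1 := Rmin_l _ _), Rmin_r).
  assert (Hce : c <= e') by (unfold c; apply Rmin_r).
  exists (A + B + L' + A'), c. split; [lra | split; [lra | ]]. intros x y Hx Hy E.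
  assert (Ht : 0 <= y ^ 2 / x) by (apply Rdiv_le_0_compat; [apply pow2_ge_0 | lra]).
  assert (Ix : 0 < / x) by (apply Rinv_0_lt_compat; lra).
  assert (Weak : forall K k, 0 <= K -> K <= A + B + L' + A' -> c <= k -> K / x * exp (- k * (y ^ 2 / x)) <= E).
  { intros K k HK HKK Hk. apply gauss_weaken; auto; try lra.
    - apply Rdiv_le_0_compat; lra.
    - apply Rmult_le_compat_r; lra. }
  destruct (HAb x y ltac:(lra) Hy) as [_ [HQ HW]].
  assert (HQE : Rabs (Q x y) <= E) by (apply Rle_trans with (1 := HQ), Weak; lra).
  split; [ | split; [ | split]].
  - apply Rabs_le_between in HQE. split; [lra | apply Q0; lra].
  - apply Rle_trans with (1 := HBb x y ltac:(lra) Hy), Weak; lra.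
  - apply Rle_trans with (1 := HW), Weak; lra.
  - destruct (mixed_derivative_exists (vm_phi U Y) (vm_phi_x Q Y) (vm_phi_p P Y) (vm_phi_q U Q Y) phi_cont' phi_x_cont' phi_p_cont'
      phi_q_cont' phi_Dx' phi_Dp' phi_Dq' phi_pos' phi_eq' x (psi x y) ltac:(lra) (psip x y Hy)) as [l Hl].
    (* The chain rule along the curve s -> psi s y, whose slope is -V. *)
    exists (/ 2 * (l + vm_phi_q U Q Y x (psi x y) * - V x y)). split.
    + apply (is_derive_ext (fun s => / 2 * vm_phi_p P Y s (psi s y))).
      { intros t. unfold vm_phi_p. rewrite (vm_Y_psi _ _ _ _ HV). simpl. field. }
      apply (D_eq _ _ (0 * vm_phi_p P Y x (psi x y) + / 2 * (l + vm_phi_q U Q Y x (psi x y) * - V x y))); [ | ring].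
      apply (D_mult (fun _ => / 2) (fun s => vm_phi_p P Y s (psi s y))); [apply D_const | ].
      apply (derive_along_curve (vm_phi_p P Y) (vm_phi_q U Q Y) (fun s => psi s y) x (psi x y) _ _ (Rmin x (psi x y))); auto.
      * apply Rmin_glb_lt; [lra | auto].
      * intros t q Htt Hq. assert (L1 := Rmin_l x (psi x y)). assert (L2 := Rmin_r x (psi x y)).
        assert (Hpp := psip x y Hy).
        apply phi_Dq'; [apply (near_pos x) | apply (near_pos (psi x y))]; lra.
      * apply phi_q_cont'; [lra | auto].
      * apply (vm_psi_x _ _ _ _ HV); lra.
    + assert (Hl1 : Rabs l <= L' / x * exp (- e' * (y ^ 2 / x))).
      { apply Rle_trans with (1 := HLb x (psi x y) l Hx (psip x y Hy) Hl).
        assert (Hi := inv_x_sqrt_le x ltac:(lra)). assert (Hcv := Hconv x y ltac:(lra) Hy).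
        assert (0 < exp (- e * (psi x y ^ 2 / x))) by apply exp_pos.
        apply Rle_trans with (L * exp (- e * (psi x y ^ 2 / x)) * / x).
        - replace (L / (x * sqrt x) * exp (- e * (psi x y ^ 2 / x))) with (L * exp (- e * (psi x y ^ 2 / x)) * / (x * sqrt x)) by (unfold Rdiv; ring).
          apply Rmult_le_compat_l; [nra | exact Hi].
        - replace (L' / x * exp (- e' * (y ^ 2 / x))) with (L' * exp (- e' * (y ^ 2 / x)) * / x) by (unfold Rdiv; ring).
          apply Rmult_le_compat_r; lra. }
      assert (Hl2 := HVQ x y ltac:(lra) Hy). fold A' in Hl2.
      assert (W1 : L' / x * exp (- e' * (y ^ 2 / x)) <= E) by (apply Weak; lra).
      assert (W2 : A' / x * exp (- (a / 2) * (y ^ 2 / x)) <= E) by (apply Weak; lra).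
      rewrite Rabs_mult, (Rabs_right (/ 2)) by lra.
      assert (T := Rabs_triang l (vm_phi_q U Q Y x (psi x y) * - V x y)). lra.
Qed.

End Estimates.

(** * Transfer between the quadrant and the plane, and conclusion *)

Lemma ext_Dx (F : R -> R -> R) (x y l : R) : 0 < x -> 0 <= y ->
  is_derive (fun s => F s y) x l -> is_derive (fun s => ext F s y) x l.
Proof.
  intros Hx Hy. apply is_derive_ext_loc. exists (mkposreal x Hx). intros t Ht.
  symmetry. apply ext_eq; auto. left. now apply (near_pos x).
Qed.

Lemma ext_Dy (F : R -> R -> R) (x y l : R) : 0 <= x -> 0 < y ->
  is_derive (F x) y l -> is_derive (ext F x) y l.
Proof.
  intros Hx Hy. apply is_derive_ext_loc. exists (mkposreal y Hy). intros t Ht.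
  symmetry. apply ext_eq; auto. left. now apply (near_pos y).
Qed.

Lemma ext_bdd (F : R -> R -> R) : (forall X, 0 < X -> bdd_on_strip X F) ->
  forall X, 0 < X -> exists M, forall x y, 0 <= x <= X -> 0 <= y -> Rabs (ext F x y) <= M.
Proof.
  intros H X HX. destruct (H X HX) as [M HM]. exists M. intros x y Hx Hy.
  rewrite ext_eq by lra. apply HM. unfold in_strip. lra.
Qed.

Lemma ext_loc_bdd (F : R -> R -> R) : (forall X, 0 < X -> loc_bdd_on_strip X F) ->
  forall X, 0 < X -> exists M, forall x y, 0 <= x <= X -> 0 <= y <= 1 -> Rabs (ext F x y) <= M.
Proof.
  intros H X HX. destruct (H X HX 1) as [M HM]. exists M. intros x y Hx Hy.
  rewrite ext_eq by lra. apply HM; unfold in_strip; lra.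
Qed.

Lemma le_at_0 (F G : R -> R) : continuous F 0 -> continuous G 0 ->
  (forall y, 0 < y -> F y <= G y) -> F 0 <= G 0.
Proof.
  intros CF CG H. apply Rnot_lt_le. intros Hlt.
  destruct (proj1 (cont_eps _ _) CF ((F 0 - G 0) / 2) ltac:(lra)) as [d1 [Hd1 H1]].
  destruct (proj1 (cont_eps _ _) CG ((F 0 - G 0) / 2) ltac:(lra)) as [d2 [Hd2 H2]].
  set (y := Rmin d1 d2 / 2).
  assert (Hy : 0 < y /\ y < d1 /\ y < d2).
  { unfold y. generalize (Rmin_l d1 d2) (Rmin_r d1 d2). assert (0 < Rmin d1 d2) by now apply Rmin_glb_lt. lra. }
  specialize (H1 y). specialize (H2 y). specialize (H y ltac:(lra)).
  rewrite Rminus_0_r, Rabs_right in H1, H2 by lra.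
  specialize (H1 ltac:(lra)). specialize (H2 ltac:(lra)). apply Rabs_def2 in H1, H2. lra.
Qed.

Lemma prandtl_of_oleinik (u0 : R -> R) (u v ux uy uyy vy : R -> R -> R) :
  oleinik_solution u0 u v ux uy uyy vy -> prandtl (ext u) (ext v) (ext ux) (ext uy) (ext uyy).
Proof.
  intros [Dux [Duy [Duyy [Dvy [Heq [Hdiv [_ [Hb0 [Hlim [Hpos Hreg]]]]]]]]]].
  assert (E : forall F x y, 0 < x -> 0 < y -> ext F x y = F x y) by (intros; apply ext_eq; lra).
  constructor.
  - apply ext_cont. intros X HX. apply (Hreg X HX).
  - apply ext_cont. intros X HX. apply (Hreg X HX).
  - apply ext_cont. intros X HX. apply (Hreg X HX).
  - apply ext_cont. intros X HX. apply (Hreg X HX).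
  - apply ext_cont. intros X HX. apply (Hreg X HX).
  - intros x y Hy. unfold ext. rewrite (Rmax_left 0 y) by auto. apply Hb0, Rmax_l.
  - intros x. unfold ext. rewrite (Rmax_left 0 0) by lra. apply Hb0, Rmax_l.
  - intros x y Hy. unfold ext. apply Hpos; [apply Rmax_l | rewrite Rmax_right; lra].
  - intros x. destruct (lim_infty_eps _ 1 (/ 2) (Hlim (Rmax 0 x) (Rmax_l _ _)) ltac:(lra)) as [M [HM HMl]].
    exists M. split; auto. intros y Hy. specialize (HMl y Hy). apply Rabs_def2 in HMl.
    unfold ext. rewrite (Rmax_right 0 y) by lra. lra.
  - intros x y Hx Hy. rewrite E by auto. apply ext_Dx; auto. lra.
  - intros x y Hx Hy. rewrite E by auto. apply ext_Dy; auto. lra.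
  - intros x y Hx Hy. rewrite E by auto. apply ext_Dy; auto. lra.
  - intros x y Hx Hy. rewrite E by auto. apply ext_Dy; auto; [lra | ].
    specialize (Hdiv x y Hx Hy). replace (- ux x y) with (vy x y) by lra. auto.
  - intros x y Hx Hy. rewrite !E by auto. auto.
Qed.

Lemma inv_le_power (x : R) : 1 <= x -> / x <= 2 / Rpower (x + 1) (3 / 4).
Proof.
  intros Hx. assert (H : Rpower (x + 1) (3 / 4) <= x + 1).
  { rewrite <- (Rpower_1 (x + 1)) at 2 by lra. apply Rle_Rpower; lra. }
  assert (0 < Rpower (x + 1) (3 / 4)) by apply exp_pos.
  apply Rmult_le_reg_r with (x * Rpower (x + 1) (3 / 4)); [nra | ].
  replace (/ x * (x * Rpower (x + 1) (3 / 4))) with (Rpower (x + 1) (3 / 4)) by (field; lra).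
  replace (2 / Rpower (x + 1) (3 / 4) * (x * Rpower (x + 1) (3 / 4))) with (2 * x) by (field; lra). lra.
Qed.

Theorem theorem1p5 :
  forall (u0 du0 d2u0 : R -> R) (alpha : R),
  oleinik_datum u0 du0 d2u0 alpha ->
  forall (f f1 f2 f3 : R -> R) (C1 C2 : R),
  blasius f f1 f2 f3 C1 C2 ->
  forall (C4 C5 C6 C7 : R),
  0 < C4 -> 0 < C5 -> 0 < C6 -> 0 < C7 -> C1 < C5 -> C1 < C7 ->
  (forall y, 0 <= y -> Rabs (u0 y - 1) <= C4 * exp (- C5 * y ^ 2)) ->
  (forall y, 0 <= y -> - C6 * exp (- C7 * y ^ 2) <= d2u0 y <= 0) ->
  forall (u v ux uy uyy vy : R -> R -> R),
  oleinik_solution u0 u v ux uy uyy vy ->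
  exists C c N, 0 < C /\ 0 < c /\ 0 < N /\
    forall x y, N < x -> 0 <= y ->
      let G := exp (- c * (y ^ 2 / (x + 1))) in
      (- C / (x + 1) * G <= uyy x y <= 0) /\
      Rabs (uy x y - Derive (fun t => ubar f1 x t) y)
        <= C / Rpower (x + 1) (3 / 4) * ln (x + exp 1) * G /\
      Rabs (ux x y) <= C / (x + 1) * G /\
      (0 < y -> ex_derive (fun s => uy s y) x) /\
      Rabs (Derive (fun s => uy s y) x) <= C / Rpower (x + 1) (3 / 4) * G.
Proof.
  intros u0 du0 d2u0 alpha Hdat f f1 f2 f3 C1 C2 HB C4 C5 C6 C7 H4 H5 H6 H7 _ _ Hgauss Hconc
    u v ux uy uyy vy Hsol.
  assert (HP := prandtl_of_oleinik _ _ _ _ _ _ _ Hsol).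
  destruct Hdat as [_ [Du0 [Ddu0 [_ [[M0 HM0] [_ [Hu00 [_ [Hu0pos [_ Hu0lim]]]]]]]]]].
  destruct Hsol as [_ [_ [_ [_ [_ [_ [Hinit [_ [_ [_ Hreg]]]]]]]]]].
  assert (E0 : forall y, 0 <= y -> ext u 0 y = u0 y).
  { intros y Hy. rewrite ext_eq by lra. auto. }
  assert (D1 : forall y, 0 < y -> is_derive (ext u 0) y (du0 y)).
  { intros y Hy. apply (is_derive_ext_loc u0); auto. exists (mkposreal y Hy). intros t Ht.
    symmetry. apply E0. left. now apply (near_pos y). }
  assert (Hneg : forall y, 0 < y -> d2u0 y <= 0) by (intros y Hy; apply Hconc; lra).
  assert (Hlim0 : is_lim (ext u 0) p_infty 1).
  { apply (is_lim_ext_loc u0); auto. exists 0. intros y Hy. symmetry. apply E0. lra. }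
  destruct (concave_datum (ext u 0) du0 d2u0 M0) as [Hincr [Hle1 [Hlow Hlin]]]; auto.
  { intros y. apply cont2_sec, (pr_U_cont _ _ _ _ _ HP). }
  { apply (pr_U_0 _ _ _ _ _ HP). lra. }
  { intros y Hy. now apply (pr_U_pos _ _ _ _ _ HP). }
  { intros y Hy. apply HM0. lra. }
  assert (HM : 0 <= M0) by (destruct (HM0 0 ltac:(lra)) as [HH _]; generalize (Rabs_pos (u0 0)); lra).
  (* The lower slope constant is the datum at y = 1, by concavity; [M0] is increased by 1 to be
     strictly positive. *)
  destruct (prandtl_estimates (ext u) (ext v) (ext ux) (ext uy) (ext uyy) HP f f1 f2 f3 C1 C2 HB
    (ext u 0 1) (M0 + 1) C4 C5) with (u1 := du0) (u2 := d2u0) as [C [c [HC [Hc Hest]]]]; auto; try lra.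
  { apply (pr_U_pos _ _ _ _ _ HP). lra. }
  { intros y Hy. specialize (Hlin y Hy). lra. }
  { intros y Hy. rewrite E0 by auto. specialize (Hgauss y Hy). apply Rabs_le_between in Hgauss. lra. }
  { intros y Hy. destruct (HM0 y ltac:(lra)) as [_ [HH _]]. apply Rabs_le_between in HH. lra. }
  { apply ext_bdd. intros X HX. apply (Hreg X HX). }
  { apply ext_bdd. intros X HX. apply (Hreg X HX). }
  { apply ext_bdd. intros X HX. apply (Hreg X HX). }
  { apply ext_loc_bdd. intros X HX. apply (Hreg X HX). }
  set (ubp := fun x y => f2 (y / sqrt (x + 1)) / sqrt (x + 1)).
  set (En := fun x y => C / x * exp (- c * (y ^ 2 / x))).
  assert (HE0 : forall x, En x 0 = C / x).
  { intros x. unfold En. replace (- c * (0 ^ 2 / x)) with 0 by (unfold Rdiv; ring). rewrite exp_0. ring. }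
  (* The estimates without x-derivatives of u_y reach the wall by continuity in y. *)
  assert (Hcl : forall x y, 2 <= x -> 0 <= y ->
    - En x y <= uyy x y <= 0 /\ Rabs (uy x y - ubp x y) <= En x y /\ Rabs (ux x y) <= En x y).
  { intros x y Hx [Hy | <-].
    - destruct (Hest x y Hx Hy) as [A1 [A2 [A3 _]]]. rewrite !ext_eq in A1, A2, A3 by lra. auto.
    - assert (CE : continuous (En x) 0).
      { unfold En. apply cont_mult; [apply cont_const | ]. apply cont_exp.
        apply cont_mult; [apply cont_const | ]. apply cont_mult; [ | apply cont_const].
        apply cont_pow, continuous_id. }
      assert (Cb : continuous (ubp x) 0).
      { unfold ubp. apply cont_mult; [ | apply cont_const].
        apply (cont_comp (fun t => t / sqrt (x + 1)) f2).
        - apply cont_mult; [apply continuous_id | apply cont_const].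
        - apply (bl_cf2 _ _ _ _ _ _ HB). rewrite Rdiv_0_l. lra. }
      assert (CQ := cont2_sec _ x 0 (pr_Q_cont _ _ _ _ _ HP x 0)).
      assert (CP := cont2_sec _ x 0 (pr_P_cont _ _ _ _ _ HP x 0)).
      assert (CW := cont2_sec _ x 0 (pr_W_cont _ _ _ _ _ HP x 0)).
      rewrite <- (ext_eq uyy x 0), <- (ext_eq uy x 0), <- (ext_eq ux x 0) by lra.
      split; [split | split].
      + apply (le_at_0 (fun y => - En x y) (ext uyy x)); auto; [now apply cont_opp | ].
        intros y Hy. now destruct (Hest x y Hx Hy) as [[? _] _].
      + apply (le_at_0 (ext uyy x) (fun _ => 0)); auto; [apply cont_const | ].
        intros y Hy. now destruct (Hest x y Hx Hy) as [[_ ?] _].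
      + apply (le_at_0 (fun y => Rabs (ext uy x y - ubp x y)) (En x)); auto; [now apply cont_abs, cont_minus | ].
        intros y Hy. now destruct (Hest x y Hx Hy) as [_ [? _]].
      + apply (le_at_0 (fun y => Rabs (ext ux x y)) (En x)); auto; [now apply cont_abs | ].
        intros y Hy. now destruct (Hest x y Hx Hy) as [_ [_ [? _]]]. }
  assert (Hmix : forall x y, 2 <= x -> 0 < y -> exists l, is_derive (fun s => uy s y) x l /\ Rabs l <= En x y).
  { intros x y Hx Hy. destruct (Hest x y Hx Hy) as [_ [_ [_ [l [Hl Hlb]]]]]. exists l. split; auto.
    apply (is_derive_ext_loc (fun s => ext uy s y)); auto.
    assert (Hx0 : 0 < x) by lra. exists (mkposreal x Hx0). intros t Ht. apply ext_eq; [ | lra].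
    left. now apply (near_pos x). }
  (* The 4 covers the passage from 1/x to 1/(x+1) or to (x+1)^(-3/4), together with a factor 2 lost
     at the wall, where the interior bound is used at points z >= x/2. N = 4 ensures x/2 >= 2, so
     that it is available there. *)
  exists (4 * C), c, 4. split; [lra | split; [auto | split; [lra | ]]].
  intros x y Hx Hy G.
  assert (HG : 0 < G) by apply exp_pos.
  assert (HR : 0 < Rpower (x + 1) (3 / 4)) by apply exp_pos.
  assert (Hgc : exp (- c * (y ^ 2 / x)) <= G).
  { assert (Hy2 : 0 <= y ^ 2) by apply pow2_ge_0. apply gauss_le.
    - apply Rmult_le_pos; [lra | apply Rdiv_le_0_compat; lra].
    - apply Rmult_le_compat_l; [lra | ]. apply Rmult_le_compat_l; auto. apply Rinv_le_contravar; lra. }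
  assert (HEn : En x y <= C / x * G).
  { apply Rmult_le_compat_l; auto. apply Rdiv_le_0_compat; lra. }
  assert (HE1 : En x y <= 4 * C / (x + 1) * G).
  { apply Rle_trans with (1 := HEn). apply Rmult_le_compat_r; [lra | ].
    apply Rmult_le_reg_r with (x * (x + 1)); [nra | ].
    replace (C / x * (x * (x + 1))) with (C * (x + 1)) by (field; lra).
    replace (4 * C / (x + 1) * (x * (x + 1))) with (4 * C * x) by (field; lra). nra. }
  assert (HE2 : 2 * (C / x) <= 4 * C / Rpower (x + 1) (3 / 4)).
  { replace (4 * C / Rpower (x + 1) (3 / 4)) with (2 * C * (2 / Rpower (x + 1) (3 / 4))) by (field; lra).
    replace (2 * (C / x)) with (2 * C * / x) by (field; lra).
    apply Rmult_le_compat_l; [lra | apply inv_le_power; lra]. }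
  assert (HCx : 0 < C / x) by (apply Rdiv_lt_0_compat; lra).
  assert (HE3 : En x y <= 4 * C / Rpower (x + 1) (3 / 4) * G).
  { apply Rle_trans with (1 := HEn). apply Rmult_le_compat_r; lra. }
  assert (Hln : 1 <= ln (x + exp 1)).
  { rewrite <- (ln_exp 1) at 1. apply Rcomplements.ln_le; [apply exp_pos | lra]. }
  destruct (Hcl x y ltac:(lra) Hy) as [[A1 A2] [A3 A4]].
  assert (Hub : Derive (fun t => ubar f1 x t) y = ubp x y).
  { apply is_derive_unique. assert (Hs : 0 < sqrt (x + 1)) by (apply sqrt_lt_R0; lra).
    unfold ubar, ubp. apply (D_comp f1 (fun t => t / sqrt (x + 1))).
    - apply (bl_Df1 _ _ _ _ _ _ HB). apply Rdiv_le_0_compat; lra.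
    - auto_derive; [exact I | field; lra]. }
  split; [ | split; [ | split; [ | split]]].
  - split; auto. replace (- (4 * C) / (x + 1) * G) with (- (4 * C / (x + 1) * G)) by (field; lra). lra.
  - rewrite Hub. apply Rle_trans with (1 := A3). apply Rle_trans with (1 := HE3).
    apply Rmult_le_compat_r; [lra | ]. assert (0 < 4 * C / Rpower (x + 1) (3 / 4)) by lra. nra.
  - lra.
  - intros Hy'. destruct (Hmix x y ltac:(lra) Hy') as [l [Hl _]]. now exists l.
  - destruct Hy as [Hy | <-].
    + destruct (Hmix x y ltac:(lra) Hy) as [l [Hl Hlb]].
      replace (Derive (fun s => uy s y) x) with l by (symmetry; apply is_derive_unique; exact Hl). lra.
    + (* at the wall only a Lipschitz bound in [x] is available, as a limit of the interior bounds *)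
      assert (HG1 : G = 1).
      { unfold G. rewrite <- exp_0. f_equal. unfold Rdiv. ring. }
      rewrite HG1, Rmult_1_r. apply Rle_trans with (2 := HE2).
      apply (Derive_abs_le _ _ _ (x / 2)); [lra | ]. intros t _ Ht. apply Rabs_def2 in Ht.
      assert (CPt := cont2_sec _ t 0 (pr_P_cont _ _ _ _ _ HP t 0)).
      assert (CPx := cont2_sec _ x 0 (pr_P_cont _ _ _ _ _ HP x 0)).
      rewrite <- (ext_eq uy t 0), <- (ext_eq uy x 0) by lra.
      apply (le_at_0 (fun y => Rabs (ext uy t y - ext uy x y)) (fun _ => 2 * (C / x) * Rabs (t - x)));
        [now apply cont_abs, cont_minus | apply cont_const | ].
      intros y Hy. rewrite !ext_eq by lra.
      destruct (mvt_abs (fun s => uy s y) (fun s => Derive (fun s => uy s y) s) x t) as [z [Hz Ez]].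
      { intros s Hs. assert (Hs2 : 2 <= s).
        { assert (Rabs (t - x) < x / 2) by (apply Rabs_def1; lra). apply Rabs_near in Hs. lra. }
        destruct (Hmix s y Hs2 Hy) as [l [Hl _]].
        replace (Derive (fun s => uy s y) s) with l by (symmetry; apply is_derive_unique; exact Hl). exact Hl. }
      rewrite Ez, Rabs_mult. apply Rmult_le_compat_r; [apply Rabs_pos | ].
      assert (Hz2 : x / 2 <= z).
      { assert (Rabs (t - x) < x / 2) by (apply Rabs_def1; lra). apply Rabs_near in Hz. lra. }
      destruct (Hmix z y ltac:(lra) Hy) as [l [Hl Hlb]].
      replace (Derive (fun s => uy s y) z) with l by (symmetry; apply is_derive_unique; exact Hl).
      apply Rle_trans with (1 := Hlb). unfold En.
      apply Rle_trans with (C / z * 1).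
      * apply Rmult_le_compat_l; [apply Rdiv_le_0_compat; lra | ]. rewrite <- exp_0. apply exp_le.
        assert (0 <= y ^ 2 / z) by (apply Rdiv_le_0_compat; [apply pow2_ge_0 | lra]). nra.
      * rewrite Rmult_1_r. replace (2 * (C / x)) with (C / (x / 2)) by (field; lra).
        apply Rmult_le_compat_l; [lra | apply Rinv_le_contravar; lra].
Qed.
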